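(* Let $r_+,r_-\in C^5(\mathbb R)$ be real-valued with $$-1\le r_-(x)\le\max r_-<\min r_+\le r_+(x)\le1\quad(x\in\mathbb R).$$ Suppose that $r_\pm(x)\to\pm1$, $r_+'(x)=O(|x|^{-1})$ and $r_+''(x)=O(|x|^{-2})$ as $|x|\to\infty$, and that $r_+'(0)=0$, $r_+''(0)>0$, and $\pm r_+'(x)>0$ for $\pm x>0$. Then for each $\lambda_{\max}\in(\min r_+,1)$, all eigenvalues $\lambda$ in the interval $\min r_+<\lambda\le\lambda_{\max}$ of the self-adjoint Zakharov-Shabat system $$\epsilon\frac{d\mathbf w}{dx}=\begin{bmatrix} -i\left(\lambda+\tfrac12S'(x)\right) & A(x) \\ A(x) & i\left(\lambda+\tfrac12S'(x)\right) \end{bmatrix}\mathbf w,\qquad x\in\mathbb R,$$ where $A:=\tfrac12(r_+-r_-)$ and $S':=-(r_++r_-)$, satisfy the (perturbed) Bohr-Sommerfeld quantization rule $$\cos\left(\frac1\epsilon\int_{x_-(\lambda)}^{x_+(\lambda)}\sqrt{(\lambda-r_+(x))(\lambda-r_-(x))}\,dx\right)=O(\epsilon),\qquad\epsilon\downarrow0,$$ where $x_-(\lambda)<0<x_+(\lambda)$ are the two preimages of $\lambda$ under $x\mapsto r_+(x)$. The error term is uniform given $\lambda_{\max}$: there are constants $C,\epsilon_0>0$ such that for every $\epsilon\in(0,\epsilon_0)$ and every eigenvalue $\lambda\in(\min r_+,\lambda_{\max}]$ for that $\epsilon$, the absolute value of the left-hand side is at most $C\epsilon$.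
   Context: For given $\epsilon>0$, a real number $\lambda$ is called an eigenvalue of a system $\epsilon\,\mathbf w'(x)=\mathbf B(x;\lambda)\mathbf w(x)$ on $\mathbb R$ if the system has a nontrivial solution $\mathbf w\in L^2(\mathbb R;\mathbb C^2)$. The functions $r_\pm$ are defined from the real-valued functions $A>0$ and $S'$ by $r_\pm(x)=-\tfrac12S'(x)\pm A(x)$; equivalently $A=\tfrac12(r_+-r_-)$, $S'=-(r_++r_-)$. The displayed system is obtained from $\epsilon\mathbf v'=\begin{bmatrix} -i\lambda & q_0 \\ q_0^* & i\lambda \end{bmatrix}\mathbf v$ with $q_0=Ae^{iS/\epsilon}$ by $\mathbf v=e^{iS\sigma_3/(2\epsilon)}\mathbf w$, $\sigma_3=\mathrm{diag}(1,-1)$. *)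

(* Defs.v *)
From Stdlib Require Import Reals Lra.
From Coquelicot Require Import Coquelicot.

Open Scope R_scope.

Definition Ck (n : nat) (f : R -> R) : Prop :=
  (forall (k : nat) (x : R), (k <= n)%nat -> ex_derive_n f k x) /\
  (forall x : R, continuous (Derive_n f n) x).

Definition is_max_value (f : R -> R) (M : R) : Prop :=
  (exists x : R, f x = M) /\ (forall x : R, f x <= M).

Definition is_min_value (f : R -> R) (m : R) : Prop :=
  (exists x : R, f x = m) /\ (forall x : R, m <= f x).

(* [f = O(g)] as [|x| -> oo], i.e. at both ends of the real line. *)
Definition bigO_infty (f g : R -> R) : Prop :=
  exists K X : R, forall x : R, X <= Rabs x -> Rabs (f x) <= K * Rabs (g x).

(* A matrix is given by its two rows. *)
Definition mat2 : Type := ((C * C) * (C * C))%type.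

Definition mat2_vec (M : mat2) (v : C * C) : C * C :=
  let '((a, b), (c, d)) := M in
  ((a * fst v + b * snd v)%C, (c * fst v + d * snd v)%C).

(* The derivative is that of a curve in [C^2], regarded as a real normed
    space. *)
Definition solves (eps : R) (B : R -> R -> mat2) (lambda : R)
    (w : R -> C * C) : Prop :=
  forall x : R, exists dw : C * C,
    is_derive (K := R_AbsRing)
      (V := prod_NormedModule R_AbsRing C_R_NormedModule C_R_NormedModule)
      w x dw /\
    ((RtoC eps * fst dw)%C, (RtoC eps * snd dw)%C)
      = mat2_vec (B x lambda) (w x).

Definition sqnorm2 (v : C * C) : R := Cmod (fst v) ^ 2 + Cmod (snd v) ^ 2.

(* Only used for solutions [w], which are differentiable: then [|w|^2] is
    continuous and nonnegative, so that its improper Riemann integral over the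
    real line converges exactly when its Lebesgue integral is finite. *)
Definition square_integrable (w : R -> C * C) : Prop :=
  ex_RInt_gen (fun x => sqnorm2 (w x))
    (Rbar_locally m_infty) (Rbar_locally p_infty).

Definition is_eigenvalue (eps : R) (B : R -> R -> mat2) (lambda : R) : Prop :=
  exists w : R -> C * C,
    solves eps B lambda w /\
    square_integrable w /\
    (exists x : R, w x <> (RtoC 0, RtoC 0)).

Definition amplitude (rp rm : R -> R) (x : R) : R := / 2 * (rp x - rm x).

(* This is the derivative [S'] of the phase, not [S] itself. *)
Definition dphase (rp rm : R -> R) (x : R) : R := - (rp x + rm x).

Definition zakharov_shabat (rp rm : R -> R) (x lambda : R) : mat2 :=
  let A := amplitude rp rm x in
  let mu := lambda + / 2 * dphase rp rm x in
  (((- (Ci * RtoC mu))%C, RtoC A),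
   (RtoC A, (Ci * RtoC mu)%C)).

(* Main.v *)
(* Write the system as [eps y' = (lambda - rm) u], [eps u' = - (lambda - rp) y] and
   straighten [rp] by the Morse coordinate [s], in which [rp = r0 + s^2], so that
   [lambda = r0 + kap^2] has the turning points [s = -kap] and [s = kap]. The phase
   integral is the integral of [sqrt (kap^2 - s^2) m] between them, with [m] smooth and
   positive. Langer's variable [z] satisfies
   [c^2 (kap^2 - z^2) z'^2 = (kap^2 - s^2) m^2], where [PI c kap^2 / 2] is the phase
   integral. It is sought as [z = s + (kap^2 - s^2) q]: then [q] solves an implicit
   equation driven by the smooth solution [Y] of the singular equation
   [(kap^2 - s^2) Y' = 3 s Y + m - c], and a maximum principle for such equations bounds
   [Y] and its derivatives uniformly down to [kap = 0], where the turning points merge.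

   After Liouville's transformation the eigenvalue equation becomes that of the harmonic
   oscillator, [W'' = (x^2 - L) W], where [L] is within [O(eps)] of [c kap^2 / eps]. Let
   [2 n - 1] and [2 n + 1] be the odd integers around [L]. The operator whose kernel is
   spanned by the Hermite functions number [n - 1] and [n], whose Wronskian is positive
   by Turan's inequality, yields a quadratic form in [(W, W')] that increases along
   solutions as long as [L] is not too close to the two odd integers. Solutions in [L^2]
   are exponentially small in the forbidden regions, which contradicts the growth unless
   [c kap^2 / eps] is within [O(eps)] of an odd integer, that is, unless the cosine of
   the phase integral over [eps] is [O(eps)]. *)

(* The obstacle is uniformity as [lambda] decreases to the minimum of [rp]: there the turning points
   merge, and an argument that treats them one at a time loses its constants. Hence regularity is
   stated throughout for families indexed by [kap]. The constant [c] is forced: a solution [Y]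
   smooth at both turning points exists only when [c] is the mean of [m] for the weight
   [sqrt (kap^2 - s^2)]. Derivatives are spent as follows: two of the five of [rp] on the quotient
   [(rp - r0) / x^2], one on passing from [m] to [Y], and the last two on the potential that
   Liouville's transformation adds. This potential is bounded and enters with a factor [eps], so it
   shifts [L] by [O(eps)], and the quadratic form tolerates a shift of half the distance that is
   assumed between [L] and the odd integers. The integer [n] may grow like [1 / eps], but the bounds
   on the form are polynomial in [n] and in the variable, which the exponential decay absorbs. No
   asymptotics of parabolic cylinder functions enter. *)
Require Import Defs.
From Stdlib Require Import Reals Lra Lia ClassicalEpsilon.
From Coquelicot Require Import Coquelicot.

Open Scope R_scope.

(** * Families of functions that are C^n with uniform bounds *)

(** The bounds are uniform over the index, which will be [kap], or [kap] with an integration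
    variable; no regularity in the index is asked for. The derivative is an existential witness, so
    that it can be given by whichever closed formula shows its smoothness. *)
Fixpoint UC {I : Type} (D : I -> R -> Prop) (n : nat) (F : I -> R -> R) : Prop :=
  (exists K, forall i x, D i x -> Rabs (F i x) <= K) /\
  (forall i x, D i x -> continuous (F i) x) /\
  match n with
  | O => True
  | S n' => exists F', (forall i x, D i x -> is_derive (F i) x (F' i x)) /\
                       UC D n' F'
  end.

Definition open_dom {I : Type} (D : I -> R -> Prop) : Prop :=
  forall i x, D i x -> locally x (D i).

Lemma UC_bound {I : Type} (D : I -> R -> Prop) n F :
  UC D n F -> exists K, 0 < K /\ forall i x, D i x -> Rabs (F i x) <= K.
Proof.
  destruct n; intros [[K HK] _]; exists (Rmax K 1); split;
    try (apply Rlt_le_trans with 1; [lra | apply Rmax_r]);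
    intros i x Hx; (eapply Rle_trans; [apply HK; exact Hx | apply Rmax_l]).
Qed.

Lemma UC_cont {I : Type} (D : I -> R -> Prop) n F :
  UC D n F -> forall i x, D i x -> continuous (F i) x.
Proof. destruct n; intros [_ [H _]]; exact H. Qed.

Lemma UC_deriv {I : Type} (D : I -> R -> Prop) n F : UC D (S n) F ->
  exists F' : I -> R -> R, (forall i x, D i x -> is_derive (F i) x (F' i x)) /\ UC D n F'.
Proof. intros [_ [_ H]]; exact H. Qed.

Lemma UC_S {I : Type} (D : I -> R -> Prop) n F : UC D (S n) F -> UC D n F.
Proof.
  revert F; induction n as [|n IH]; intros F [Hb [Hc [F' [Hd HF']]]].
  - split; [exact Hb | split; [exact Hc | exact Logic.I]].
  - split; [exact Hb | split; [exact Hc |]].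
    exists F'; split; [exact Hd | apply IH; exact HF'].
Qed.

Lemma UC_le {I : Type} (D : I -> R -> Prop) n k F :
  (k <= n)%nat -> UC D n F -> UC D k F.
Proof.
  induction 1 as [|n Hle IH]; intros H; [exact H | apply IH, UC_S, H].
Qed.

Lemma UC_sub {I : Type} (D D' : I -> R -> Prop) n F :
  (forall i x, D' i x -> D i x) -> UC D n F -> UC D' n F.
Proof.
  intros Hs; revert F; induction n as [|n IH]; intros F [[K Hb] [Hc H]].
  - split; [exists K; intros; apply Hb, Hs; assumption | split; [| exact Logic.I]].
    intros; apply Hc, Hs; assumption.
  - split; [exists K; intros; apply Hb, Hs; assumption | split].
    + intros; apply Hc, Hs; assumption.
    + destruct H as [F' [Hd HF']]; exists F'; split; [| apply IH, HF'].
      intros; apply Hd, Hs; assumption.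
Qed.

Lemma UC_reindex {I J : Type} (h : J -> I) (D : I -> R -> Prop) n F :
  UC D n F -> UC (fun j => D (h j)) n (fun j => F (h j)).
Proof.
  revert F; induction n as [|n IH]; intros F [[K Hb] [Hc H]].
  - split; [exists K; intros; apply Hb; assumption | split; [| exact Logic.I]].
    intros; apply Hc; assumption.
  - split; [exists K; intros; apply Hb; assumption | split].
    + intros; apply Hc; assumption.
    + destruct H as [F' [Hd HF']]; exists (fun j => F' (h j)); split;
        [| apply (IH F'), HF'].
      intros; apply Hd; assumption.
Qed.

Lemma UC_ext {I : Type} (D : I -> R -> Prop) n F G :
  open_dom D -> (forall i x, D i x -> F i x = G i x) -> UC D n F -> UC D n G.
Proof.
  intros Ho He; destruct n; intros [[K Hb] [Hc H]].
  1,2: split; [exists K; intros i x Hx; rewrite <- He by exact Hx; apply Hb, Hx |].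
  1,2: split; [intros i x Hx; apply continuous_ext_loc with (F i);
    [apply filter_imp with (D i); [intros y Hy; apply He, Hy | apply Ho, Hx]
    | apply Hc, Hx] |].
  - exact Logic.I.
  - destruct H as [F' [Hd HF']]; exists F'; split; [| exact HF'].
    intros i x Hx; apply is_derive_ext_loc with (F i); [| apply Hd, Hx].
    apply filter_imp with (D i); [intros y Hy; apply He, Hy | apply Ho, Hx].
Qed.

Lemma UC_Derive {I : Type} (D : I -> R -> Prop) n F :
  open_dom D -> UC D (S n) F ->
  (forall i x, D i x -> is_derive (F i) x (Derive (F i) x)) /\
  UC D n (fun i => Derive (F i)).
Proof.
  intros Ho [_ [_ [F' [Hd HF']]]]; split.
  - intros i x Hx; apply Derive_correct; eexists; apply Hd, Hx.
  - apply UC_ext with F'; [exact Ho | | exact HF'].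
    intros i x Hx; symmetry; apply is_derive_unique, Hd, Hx.
Qed.

Lemma UC_const {I : Type} (D : I -> R -> Prop) n (c : I -> R) K :
  (forall i x, D i x -> Rabs (c i) <= K) -> UC D n (fun i _ => c i).
Proof.
  revert c K; induction n as [|n IH]; intros c K Hc;
    (split; [exists K; exact Hc | split; [intros; apply continuous_const |]]).
  - exact Logic.I.
  - exists (fun _ _ => 0); split; [intros; apply @is_derive_const |].
    apply (IH (fun _ => 0) 0); intros; rewrite Rabs_R0; lra.
Qed.

Lemma UC_cst {I : Type} (D : I -> R -> Prop) n (c : R) : UC D n (fun _ _ => c).
Proof. apply (UC_const D n (fun _ => c) (Rabs c)); intros; lra. Qed.

Lemma UC_id {I : Type} (D : I -> R -> Prop) n K :
  (forall i x, D i x -> Rabs x <= K) -> UC D n (fun _ x => x).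
Proof.
  intros HK; destruct n;
    (split; [exists K; exact HK | split; [intros; apply continuous_id |]]).
  - exact Logic.I.
  - exists (fun _ _ => 1); split; [intros; apply @is_derive_id | apply UC_cst].
Qed.

Lemma UC_plus {I : Type} (D : I -> R -> Prop) n F G :
  UC D n F -> UC D n G -> UC D n (fun i x => F i x + G i x).
Proof.
  revert F G; induction n as [|n IH]; intros F G [[K Hb] [Hc H]] [[K' Hb'] [Hc' H']].
  1,2: split; [exists (K + K'); intros i x Hx; eapply Rle_trans;
    [apply Rabs_triang | apply Rplus_le_compat; auto] |].
  1,2: split; [intros i x Hx; apply (continuous_plus (F i) (G i)); auto |].
  - exact Logic.I.
  - destruct H as [F' [Hd HF']], H' as [G' [Hd' HG']].
    exists (fun i x => F' i x + G' i x); split; [| apply IH; assumption].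
    intros i x Hx; apply @is_derive_plus; auto.
Qed.

Lemma UC_mult {I : Type} (D : I -> R -> Prop) n F G :
  UC D n F -> UC D n G -> UC D n (fun i x => F i x * G i x).
Proof.
  revert F G; induction n as [|n IH]; intros F G HF HG.
  - destruct HF as [[K Hb] [Hc H]], HG as [[K' Hb'] [Hc' H']].
    split; [| split; [| exact Logic.I]].
    + exists (K * K'); intros i x Hx; rewrite Rabs_mult.
      apply Rmult_le_compat; auto using Rabs_pos.
    + intros i x Hx; apply (continuous_mult (F i) (G i)); auto.
  - pose proof (UC_S _ _ _ HF) as HF0; pose proof (UC_S _ _ _ HG) as HG0.
    destruct HF as [[K Hb] [Hc [F' [Hd HF']]]], HG as [[K' Hb'] [Hc' [G' [Hd' HG']]]].
    split; [| split].
    + exists (K * K'); intros i x Hx; rewrite Rabs_mult.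
      apply Rmult_le_compat; auto using Rabs_pos.
    + intros i x Hx; apply (continuous_mult (F i) (G i)); auto.
    + exists (fun i x => F' i x * G i x + F i x * G' i x); split.
      * intros i x Hx; apply (is_derive_mult (F i) (G i)); auto.
        intros; apply Rmult_comm.
      * apply UC_plus; apply IH; assumption.
Qed.

Lemma UC_opp {I : Type} (D : I -> R -> Prop) n F :
  open_dom D -> UC D n F -> UC D n (fun i x => - F i x).
Proof.
  intros Ho HF; apply UC_ext with (fun i x => (-1) * F i x); [exact Ho | intros; ring |].
  apply UC_mult; [apply UC_cst | exact HF].
Qed.

Lemma UC_minus {I : Type} (D : I -> R -> Prop) n F G :
  open_dom D -> UC D n F -> UC D n G -> UC D n (fun i x => F i x - G i x).
Proof. intros Ho HF HG; apply UC_plus; [exact HF | apply UC_opp; assumption]. Qed.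

(** In the derivative [- F' (/ F) (/ F)] the function [/ F] reappears, so the induction hypothesis
    at the lower order applies to it; [UC_sqrt] works likewise. *)
Lemma UC_inv {I : Type} (D : I -> R -> Prop) n F c :
  open_dom D -> 0 < c -> (forall i x, D i x -> c <= F i x) -> UC D n F ->
  UC D n (fun i x => / F i x).
Proof.
  intros Ho Hc0 Hlow; induction n as [|n IH]; intros HF.
  - destruct HF as [_ [Hc _]]; split; [| split; [| exact Logic.I]].
    + exists (/ c); intros i x Hx; specialize (Hlow i x Hx).
      rewrite Rabs_right.
      * apply Rinv_le_contravar; assumption.
      * apply Rle_ge, Rlt_le, Rinv_0_lt_compat; lra.
    + intros i x Hx; apply (continuous_comp (F i) Rinv); [auto |].
      apply continuous_Rinv; specialize (Hlow i x Hx); lra.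
  - pose proof (IH (UC_S _ _ _ HF)) as HI.
    destruct HF as [_ [Hc [F' [Hd HF']]]]; split; [| split].
    + exists (/ c); intros i x Hx; specialize (Hlow i x Hx).
      rewrite Rabs_right.
      * apply Rinv_le_contravar; assumption.
      * apply Rle_ge, Rlt_le, Rinv_0_lt_compat; lra.
    + intros i x Hx; apply (continuous_comp (F i) Rinv); [auto |].
      apply continuous_Rinv; specialize (Hlow i x Hx); lra.
    + exists (fun i x => - F' i x * (/ F i x * / F i x)); split.
      * intros i x Hx; specialize (Hlow i x Hx).
        replace (- F' i x * (/ F i x * / F i x)) with (- F' i x / F i x ^ 2)
          by (field; lra).
        apply is_derive_inv; [auto | lra].
      * apply UC_mult; [apply UC_opp; assumption | apply UC_mult; exact HI].
Qed.

Lemma UC_sqrt {I : Type} (D : I -> R -> Prop) n F c :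
  open_dom D -> 0 < c -> (forall i x, D i x -> c <= F i x) -> UC D n F ->
  UC D n (fun i x => sqrt (F i x)).
Proof.
  intros Ho Hc0 Hlow; induction n as [|n IH]; intros HF.
  - destruct (UC_bound _ _ _ HF) as [K [HK Hb]].
    split; [| split; [| exact Logic.I]].
    + exists (sqrt K); intros i x Hx; rewrite Rabs_right by apply Rle_ge, sqrt_pos.
      apply sqrt_le_1_alt; eapply Rle_trans; [apply Rle_abs | apply Hb, Hx].
    + intros i x Hx; apply continuous_sqrt_comp, (UC_cont _ _ _ HF), Hx.
  - pose proof (IH (UC_S _ _ _ HF)) as HI.
    destruct (UC_bound _ _ _ HF) as [K [HK Hb]].
    destruct HF as [_ [Hc [F' [Hd HF']]]]; split; [| split].
    + exists (sqrt K); intros i x Hx; rewrite Rabs_right by apply Rle_ge, sqrt_pos.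
      apply sqrt_le_1_alt; eapply Rle_trans; [apply Rle_abs | apply Hb, Hx].
    + intros i x Hx; apply continuous_sqrt_comp, Hc, Hx.
    + exists (fun i x => F' i x * / (2 * sqrt (F i x))); split.
      * intros i x Hx; specialize (Hlow i x Hx).
        apply is_derive_sqrt; [auto | lra].
      * apply UC_mult; [exact HF' |].
        apply UC_inv with (2 * sqrt c); [exact Ho | | |].
        -- apply Rmult_lt_0_compat; [lra | apply sqrt_lt_R0, Hc0].
        -- intros i x Hx; apply Rmult_le_compat_l; [lra | apply sqrt_le_1_alt; auto].
        -- apply UC_mult; [apply UC_cst | exact HI].
Qed.

Lemma UC_comp {I : Type} (D : I -> R -> Prop) (E : unit -> R -> Prop) n
    (f : unit -> R -> R) (G : I -> R -> R) :
  (forall i x, D i x -> E tt (G i x)) -> UC E n f -> UC D n G ->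
  UC D n (fun i x => f tt (G i x)).
Proof.
  intros HE; revert f; induction n as [|n IH]; intros f Hf HG.
  - destruct Hf as [[K Hb] [Hc _]], HG as [_ [Hc' _]].
    split; [| split; [| exact Logic.I]].
    + exists K; intros; apply Hb; auto.
    + intros i x Hx; apply (continuous_comp (G i) (f tt)); auto.
  - pose proof (UC_S _ _ _ HG) as HG0.
    destruct Hf as [[K Hb] [Hc [f' [Hd Hf']]]], HG as [_ [Hc' [G' [Hd' HG']]]].
    split; [| split].
    + exists K; intros; apply Hb; auto.
    + intros i x Hx; apply (continuous_comp (G i) (f tt)); auto.
    + exists (fun i x => G' i x * f' tt (G i x)); split.
      * intros i x Hx; apply (is_derive_comp (f tt) (G i)); auto.
      * apply UC_mult; [exact HG' | apply IH; assumption].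
Qed.

(** The two hypotheses may carry different derivative witnesses; [Derive] serves on both domains. *)
Lemma UC_union {I : Type} (D1 D2 : I -> R -> Prop) n F :
  open_dom D1 -> open_dom D2 -> UC D1 n F -> UC D2 n F ->
  UC (fun i x => D1 i x \/ D2 i x) n F.
Proof.
  intros Ho1 Ho2; revert F; induction n as [|n IH]; intros F H1 H2.
  - destruct H1 as [[K Hb] [Hc _]], H2 as [[K' Hb'] [Hc' _]].
    split; [| split; [| exact Logic.I]].
    + exists (Rmax K K'); intros i x [Hx|Hx]; eapply Rle_trans;
        [apply Hb, Hx | apply Rmax_l | apply Hb', Hx | apply Rmax_r].
    + intros i x [Hx|Hx]; auto.
  - destruct (UC_Derive _ _ _ Ho1 H1) as [Hd1 HD1].
    destruct (UC_Derive _ _ _ Ho2 H2) as [Hd2 HD2].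
    destruct H1 as [[K Hb] [Hc _]], H2 as [[K' Hb'] [Hc' _]].
    split; [| split].
    + exists (Rmax K K'); intros i x [Hx|Hx]; eapply Rle_trans;
        [apply Hb, Hx | apply Rmax_l | apply Hb', Hx | apply Rmax_r].
    + intros i x [Hx|Hx]; auto.
    + exists (fun i => Derive (F i)); split; [| apply IH; assumption].
      intros i x [Hx|Hx]; auto.
Qed.

Lemma open_interval (a b : R) x : a < x < b -> locally x (fun y => a < y < b).
Proof.
  intros [H1 H2]; apply filter_and.
  - apply (open_gt a x H1).
  - apply (open_lt b x H2).
Qed.

(** * A maximum principle at turning points *)

(* Values of [is_derive] live in the carrier of a normed module, which [ring]
   does not recognise as [R]. *)
Ltac as_R := match goal with |- ?a = ?b => change (@eq R a b) end.

Ltac to_R := unfold minus;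
  repeat match goal with
  | |- context [@plus ?G ?a ?b] => change (@plus G a b) with (Rplus a b)
  | |- context [@opp ?G ?a] => change (@opp G a) with (Ropp a)
  | |- context [@mult ?G ?a ?b] => change (@mult G a b) with (Rmult a b)
  | |- context [@scal ?K ?V ?a ?b] => change (@scal K V a b) with (Rmult a b)
  | |- context [@zero ?G] => change (@zero G) with R0
  | |- context [@one ?G] => change (@one G) with R1
  end; try as_R.

Lemma is_derive_pos_right f x l :
  is_derive f x l -> 0 < l ->
  exists d, 0 < d /\ forall y, x < y < x + d -> f x < f y.
Proof.
  intros Hd Hl; apply is_derive_Reals in Hd.
  destruct (Hd l Hl) as [d Hd']; exists d; split; [apply cond_pos |].
  intros y Hy; specialize (Hd' (y - x)).
  assert (H : Rabs ((f (x + (y - x)) - f x) / (y - x) - l) < l).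
  { apply Hd'; [lra | rewrite Rabs_right; lra]. }
  replace (x + (y - x)) with y in H by ring.
  apply Rabs_def2 in H; destruct H as [_ H].
  assert (H1 : 0 < (f y - f x) / (y - x)) by lra.
  apply Rmult_lt_compat_r with (r := y - x) in H1; [| lra].
  unfold Rdiv in H1; rewrite Rmult_assoc, Rinv_l in H1; lra.
Qed.

Lemma is_derive_pos_left f x l :
  is_derive f x l -> 0 < l ->
  exists d, 0 < d /\ forall y, x - d < y < x -> f y < f x.
Proof.
  intros Hd Hl; apply is_derive_Reals in Hd.
  destruct (Hd l Hl) as [d Hd']; exists d; split; [apply cond_pos |].
  intros y Hy; specialize (Hd' (y - x)).
  assert (H : Rabs ((f (x + (y - x)) - f x) / (y - x) - l) < l).
  { apply Hd'; [lra | rewrite Rabs_left; lra]. }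
  replace (x + (y - x)) with y in H by ring.
  apply Rabs_def2 in H; destruct H as [_ H].
  assert (H1 : 0 < (f y - f x) / (y - x)) by lra.
  apply Rmult_lt_compat_r with (r := x - y) in H1; [| lra].
  replace ((f y - f x) / (y - x) * (x - y)) with (f x - f y) in H1 by (field; lra).
  lra.
Qed.

Lemma is_derive_max_left f a b l :
  a < b -> is_derive f b l -> (forall y, a <= y <= b -> f y <= f b) -> 0 <= l.
Proof.
  intros Hab Hd Hm; destruct (Rle_or_lt 0 l) as [H|H]; [exact H | exfalso].
  destruct (is_derive_pos_left (fun x => - f x) b (- l)) as [d [Hd0 H1]]; [| lra |].
  - apply (is_derive_opp f b l Hd).
  - specialize (H1 (Rmax (b - d / 2) ((a + b) / 2))).
    specialize (Hm (Rmax (b - d / 2) ((a + b) / 2))).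
    assert (b - d / 2 <= Rmax (b - d / 2) ((a + b) / 2)) by apply Rmax_l.
    assert ((a + b) / 2 <= Rmax (b - d / 2) ((a + b) / 2)) by apply Rmax_r.
    assert (Rmax (b - d / 2) ((a + b) / 2) < b) by (apply Rmax_lub_lt; lra).
    lra.
Qed.

Lemma is_derive_max_right f a b l :
  a < b -> is_derive f a l -> (forall y, a <= y <= b -> f y <= f a) -> l <= 0.
Proof.
  intros Hab Hd Hm; destruct (Rle_or_lt l 0) as [H|H]; [exact H | exfalso].
  destruct (is_derive_pos_right f a l Hd H) as [d [Hd0 H1]].
  specialize (H1 (Rmin (a + d / 2) ((a + b) / 2))).
  specialize (Hm (Rmin (a + d / 2) ((a + b) / 2))).
  assert (Rmin (a + d / 2) ((a + b) / 2) <= a + d / 2) by apply Rmin_l.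
  assert (Rmin (a + d / 2) ((a + b) / 2) <= (a + b) / 2) by apply Rmin_r.
  assert (a < Rmin (a + d / 2) ((a + b) / 2)) by (apply Rmin_glb_lt; lra).
  lra.
Qed.

Lemma is_derive_cont (f : R -> R) x l : is_derive f x l -> continuous f x.
Proof. intros H; apply (ex_derive_continuous f x); exists l; exact H. Qed.

Lemma is_derive_continuity_pt (f : R -> R) x l : is_derive f x l -> continuity_pt f x.
Proof. intros H; apply continuity_pt_filterlim, (is_derive_cont f x l H). Qed.

Lemma MVT_is_derive f f' a b :
  a < b -> (forall c, a <= c <= b -> is_derive f c (f' c)) ->
  exists c, f b - f a = f' c * (b - a) /\ a < c < b.
Proof.
  intros Hab Hd; apply MVT_cor2; [exact Hab |].
  intros c Hc; apply is_derive_Reals, Hd, Hc.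
Qed.

Lemma is_derive_le_compat f f' a b :
  a <= b -> (forall c, a <= c <= b -> is_derive f c (f' c)) ->
  (forall c, a <= c <= b -> 0 <= f' c) -> f a <= f b.
Proof.
  intros [Hab|<-] Hd Hp; [| lra].
  destruct (MVT_is_derive f f' a b Hab Hd) as [c [Hc Hc']].
  assert (0 <= f' c * (b - a)) by (apply Rmult_le_pos; [apply Hp; lra | lra]).
  lra.
Qed.

Lemma is_derive_eq (f : R -> R) x l l' : is_derive f x l -> l = l' -> is_derive f x l'.
Proof. intros H <-; exact H. Qed.

(* Differentiating the equation at a maximum [s0] of [V] gives
   [H' (s0) >= k (k + 2) V (s0) + f (s0)] for [H s := (2 k + 1) s V s + F s],
   which has the sign of [V1] and vanishes at [s0], also when [s0] is one of
   the singular points. *)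
Lemma turning_max_principle (kap k N : R) (V V1 F f : R -> R) :
  0 < kap -> 0 < k ->
  (forall s, - kap <= s <= kap -> is_derive V s (V1 s)) ->
  (forall s, - kap <= s <= kap -> is_derive F s (f s + (k ^ 2 - 1) * V s)) ->
  (forall s, - kap <= s <= kap ->
     (kap ^ 2 - s ^ 2) * V1 s = (2 * k + 1) * s * V s + F s) ->
  (forall s, - kap <= s <= kap -> - N <= f s) ->
  forall s, - kap <= s <= kap -> V s <= N / (k * (k + 2)).
Proof.
  intros Hkap Hk HV HF Heq Hf s Hs.
  destruct (continuity_ab_maj V (- kap) kap) as [M [HM HMk]]; [lra | |].
  { intros c Hc; apply (is_derive_continuity_pt V c (V1 c)), HV, Hc. }
  apply Rle_trans with (V M); [apply HM, Hs |].
  destruct (Rle_or_lt (V M) (N / (k * (k + 2)))) as [H|H]; [exact H | exfalso].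
  assert (Hkk : 0 < k * (k + 2)) by (apply Rmult_lt_0_compat; lra).
  assert (HN : 0 < k * (k + 2) * V M - N).
  { apply Rmult_lt_compat_r with (r := k * (k + 2)) in H; [| exact Hkk].
    unfold Rdiv in H; rewrite Rmult_assoc, Rinv_l in H by lra; lra. }
  assert (Hr : M < kap -> V1 M <= 0).
  { intros HMl; apply (is_derive_max_right V M kap); [exact HMl | apply HV; lra |].
    intros y Hy; apply HM; lra. }
  assert (Hl : - kap < M -> 0 <= V1 M).
  { intros HMl; apply (is_derive_max_left V (- kap) M); [exact HMl | apply HV; lra |].
    intros y Hy; apply HM; lra. }
  (* At an interior maximum [V1] vanishes. At an endpoint it only has a sign, weakly that of [M],
     but there the factor [kap^2 - M^2] vanishes instead. *)
  assert (HMV : 0 <= M * V1 M /\ (kap ^ 2 - M ^ 2) * V1 M = 0).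
  { destruct (Rlt_dec M kap) as [H1|H1].
    - destruct (Rlt_dec (- kap) M) as [H2|H2].
      + replace (V1 M) with 0 by (specialize (Hr H1); specialize (Hl H2); lra). lra.
      + replace M with (- kap) in * by lra. split; [| ring].
        replace (- kap * V1 (- kap)) with (kap * - V1 (- kap)) by ring.
        apply Rmult_le_pos; lra.
    - replace M with kap in * by lra. split; [| ring].
      apply Rmult_le_pos; [lra | apply Hl; lra]. }
  destruct HMV as [HMV HM0].
  set (H1 := fun s => (2 * k + 1) * s * V s + F s).
  assert (HH0 : H1 M = 0) by (unfold H1; rewrite <- Heq by exact HMk; exact HM0).
  assert (HHd : is_derive H1 M
     ((2 * k + 1) * V M + (2 * k + 1) * M * V1 M + (f M + (k ^ 2 - 1) * V M))).
  { unfold H1; apply @is_derive_plus; [| apply HF, HMk].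
    apply (is_derive_mult (fun s => (2 * k + 1) * s) V M (2 * k + 1) (V1 M));
      [auto_derive; [exact Logic.I | ring] | apply HV, HMk | intros; apply Rmult_comm]. }
  assert (HHp : 0 < (2 * k + 1) * V M + (2 * k + 1) * M * V1 M + (f M + (k ^ 2 - 1) * V M)).
  { assert (0 <= (2 * k + 1) * (M * V1 M)) by (apply Rmult_le_pos; lra).
    specialize (Hf M HMk).
    lra. }
  (* [H1] vanishes at [M] with positive slope, so just to the right the equation makes [V1] positive
     and [V] exceeds its maximum. At [M = kap] the same happens on the left, where [H1 < 0] makes
     [V] decrease towards [kap]. *)
  destruct (Rlt_dec M kap) as [HMl|HMl].
  - destruct (is_derive_pos_right H1 M _ HHd HHp) as [d [Hd Hd1]].
    set (y := Rmin (M + d / 2) ((M + kap) / 2)).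
    assert (y <= M + d / 2) by apply Rmin_l.
    assert (y <= (M + kap) / 2) by apply Rmin_r.
    assert (M < y) by (apply Rmin_glb_lt; lra).
    destruct (MVT_is_derive V V1 M y) as [c [Hc Hc']]; [lra | |].
    { intros c Hc; apply HV; lra. }
    assert (Hc1 : 0 < H1 c) by (rewrite <- HH0; apply Hd1; lra).
    unfold H1 in Hc1; rewrite <- Heq in Hc1 by lra.
    assert (0 < kap ^ 2 - c ^ 2) by nra.
    specialize (HM y). assert (0 < V1 c * (y - M)) by nra. lra.
  - replace M with kap in * by lra.
    destruct (is_derive_pos_left H1 kap _ HHd HHp) as [d [Hd Hd1]].
    set (y := Rmax (kap - d / 2) 0).
    assert (kap - d / 2 <= y) by apply Rmax_l.
    assert (0 <= y) by apply Rmax_r.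
    assert (y < kap) by (apply Rmax_lub_lt; lra).
    destruct (MVT_is_derive V V1 y kap) as [c [Hc Hc']]; [lra | |].
    { intros c Hc; apply HV; lra. }
    assert (Hc1 : H1 c < 0) by (rewrite <- HH0; apply Hd1; lra).
    unfold H1 in Hc1; rewrite <- Heq in Hc1 by lra.
    assert (0 < kap ^ 2 - c ^ 2) by nra.
    specialize (HM y). nra.
Qed.

(** * The bound beyond a turning point *)

Section OutsideTurningPoint.
Context (kap s1 s2 k N : R) (V V1 F f : R -> R).
Context (kap_pos : 0 < kap) (k_pos : 0 < k) (kap_s1 : kap < s1) (s1_s2 : s1 < s2).
Context (HV : forall s, kap <= s <= s1 -> is_derive V s (V1 s)).
Context (HV1 : forall s, kap <= s <= s1 -> continuous V1 s).
Context (HF : forall s, kap <= s <= s1 -> is_derive F s (f s + (k ^ 2 - 1) * V s)).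
Context (Heq : forall s, kap <= s < s2 ->
     (kap ^ 2 - s ^ 2) * V1 s = (2 * k + 1) * s * V s + F s).
Context (Hf : forall s, kap <= s <= s1 -> Rabs (f s) <= N).

(* With [s = kap * cosh tau] the equation becomes
   [V'' + 8 coth tau V' + 15 V = - f] (for [k = 3]); [U] is the factor
   [dV/dtau + k V]. *)
Let U (s : R) : R := sqrt (s ^ 2 - kap ^ 2) * V1 s + k * V s.

(** With [s = kap cosh tau], the quotient [s / sqrt (s^2 - kap^2)] is [coth tau] and [U - k V] is
    [dV/dtau]. For [coth tau = 1] the operator would factor as [(d + k) (d + k + 2)]; the last term
    is what the nonnegative [coth tau - 1] adds. *)
Lemma outside_U_derive s : kap < s <= s1 ->
  exists l, is_derive U s l /\
    sqrt (s ^ 2 - kap ^ 2) * l =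
    - (k + 2) * U s - f s
    - (2 * k + 2) * (s / sqrt (s ^ 2 - kap ^ 2) - 1) * (U s - k * V s).
Proof.
  intros Hs.
  assert (Hp : 0 < s ^ 2 - kap ^ 2) by nra.
  assert (Hq : 0 < sqrt (s ^ 2 - kap ^ 2)) by (apply sqrt_lt_R0, Hp).
  assert (Hqq : sqrt (s ^ 2 - kap ^ 2) * sqrt (s ^ 2 - kap ^ 2) = s ^ 2 - kap ^ 2)
    by (apply sqrt_sqrt; lra).
  set (t := sqrt (s ^ 2 - kap ^ 2)) in *.
  pose (num := fun x => (2 * k + 1) * x * V x + F x).
  assert (Hnum : is_derive num s
     ((2 * k + 1) * V s + (2 * k + 1) * s * V1 s + (f s + (k ^ 2 - 1) * V s))).
  { unfold num; apply @is_derive_plus; [| apply HF; lra].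
    apply (is_derive_mult (fun s => (2 * k + 1) * s) V s (2 * k + 1) (V1 s));
      [auto_derive; [exact Logic.I | ring] | apply HV; lra | intros; apply Rmult_comm]. }
  assert (Ht : is_derive (fun x => sqrt (x ^ 2 - kap ^ 2)) s (s / t)).
  { replace (s / t) with ((2 * s) / (2 * t)) by (field; lra).
    apply is_derive_sqrt; [auto_derive; [exact Logic.I | ring] | exact Hp]. }
  assert (Hn0 : num s = - (t * t) * V1 s).
  { unfold num; rewrite <- Heq by lra. rewrite Hqq. ring. }
  exists ((- ((2 * k + 1) * V s + (2 * k + 1) * s * V1 s + (f s + (k ^ 2 - 1) * V s)) * t
     + num s * (s / t)) / t ^ 2 + k * V1 s).
  split.
  (* [V1] is only continuous, so [U] is differentiated in the form that the equation gives it near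
     [s]; [s2 > s1] provides a neighbourhood also at [s = s1]. *)
  - apply is_derive_ext_loc with (fun x => (- num x) / sqrt (x ^ 2 - kap ^ 2) + k * V x).
    + apply filter_imp with (fun y => kap < y < s2); [| apply open_interval; lra].
      intros y Hy. unfold U, num. rewrite <- Heq by lra.
      assert (Hpy : 0 < y ^ 2 - kap ^ 2) by nra.
      assert (Hqy : 0 < sqrt (y ^ 2 - kap ^ 2)) by (apply sqrt_lt_R0, Hpy).
      assert (Hqqy : sqrt (y ^ 2 - kap ^ 2) * sqrt (y ^ 2 - kap ^ 2) = y ^ 2 - kap ^ 2)
        by (apply sqrt_sqrt; lra).
      replace (kap ^ 2 - y ^ 2) with (- (y ^ 2 - kap ^ 2)) by ring.
      set (t' := sqrt (y ^ 2 - kap ^ 2)) in *. rewrite <- Hqqy.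
      as_R. field. lra.
    + apply @is_derive_plus.
      * eapply is_derive_eq.
        { apply (is_derive_div (fun x => - num x) (fun x => sqrt (x ^ 2 - kap ^ 2))).
          - apply (is_derive_opp num s _ Hnum).
          - exact Ht.
          - fold t; lra. }
        unfold opp; simpl. replace (sqrt (s * (s * 1) - kap * (kap * 1))) with t by (unfold t; f_equal; ring).
        as_R. field. lra.
      * apply (is_derive_scal V s k (V1 s)). apply HV; lra.
  - rewrite Hn0. unfold U. fold t. field. lra.
Qed.

Lemma outside_U_cont s : kap <= s <= s1 -> continuity_pt U s.
Proof.
  intros Hs; apply continuity_pt_filterlim; unfold U.
  apply (continuous_plus (fun s => sqrt (s ^ 2 - kap ^ 2) * V1 s) (fun s => k * V s)).
  - apply (continuous_mult (fun s => sqrt (s ^ 2 - kap ^ 2)) V1); [| apply HV1, Hs].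
    apply continuous_sqrt_comp, @ex_derive_continuous. auto_derive. exact Logic.I.
  - apply (continuous_scal_r k V), (is_derive_cont V s (V1 s)), HV, Hs.
Qed.

(** The bounds [V <= B] and [U <= k B] sustain each other. At [kap] itself [U = k V]. Where [U]
    reached [k B] further out, its derivative would be nonnegative, while [- (k + 2) k B + N] is
    negative and the [coth] term only lowers it, because [U - k V >= 0] there. *)
Lemma outside_U_max B s :
  N < k * (k + 2) * B -> kap <= s <= s1 -> V kap < B ->
  (forall x, kap <= x <= s1 -> V x <= B) ->
  (forall x, kap <= x <= s1 -> U x <= k * B) -> U s < k * B.
Proof.
  intros HB Hs HVk HVB HUB.
  destruct (Rlt_dec (U s) (k * B)) as [H|H]; [exact H | exfalso].
  assert (HUs : U s = k * B) by (specialize (HUB s Hs); lra).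
  assert (Hs' : kap < s).
  { destruct (Req_dec s kap) as [->|Hn]; [exfalso | lra].
    unfold U in HUs. replace (kap ^ 2 - kap ^ 2) with 0 in HUs by ring.
    rewrite sqrt_0 in HUs. nra. }
  destruct (outside_U_derive s) as [l [Hl Hle]]; [lra |].
  assert (Hl0 : 0 <= l).
  { apply (is_derive_max_left U kap s l Hs' Hl).
    intros y Hy; rewrite HUs; apply HUB; lra. }
  assert (Hp : 0 < s ^ 2 - kap ^ 2) by nra.
  assert (Hq : 0 < sqrt (s ^ 2 - kap ^ 2)) by (apply sqrt_lt_R0, Hp).
  assert (Hqs : sqrt (s ^ 2 - kap ^ 2) <= s).
  { rewrite <- (sqrt_pow2 s) at 2 by lra. apply sqrt_le_1_alt. nra. }
  set (t := sqrt (s ^ 2 - kap ^ 2)) in *.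
  assert (Hst : 0 <= s / t - 1).
  { assert (1 <= s / t); [| lra]. apply Rmult_le_reg_r with t; [lra |].
    unfold Rdiv; rewrite Rmult_assoc, Rinv_l; lra. }
  specialize (Hf s Hs). apply Rabs_le_between in Hf.
  assert (0 <= (2 * k + 2) * (s / t - 1) * (U s - k * V s)).
  { apply Rmult_le_pos; [apply Rmult_le_pos; lra |].
    specialize (HVB s Hs). nra. }
  nra.
Qed.

(** Where [V] reached [B], [V1 >= 0] would make [U >= k B], which the strict bound on [U]
    excludes. *)
Lemma outside_V_U_max B s :
  N < k * (k + 2) * B -> kap <= s <= s1 -> V kap < B ->
  (forall x, kap <= x <= s1 -> V x <= B) ->
  (forall x, kap <= x <= s1 -> U x <= k * B) -> V s < B.
Proof.
  intros HB Hs HVk HVB HUB.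
  destruct (Rlt_dec (V s) B) as [H|H]; [exact H | exfalso].
  assert (HVs : V s = B) by (specialize (HVB s Hs); lra).
  assert (Hs' : kap < s) by (destruct (Req_dec s kap) as [->|Hn]; lra).
  assert (Hl0 : 0 <= V1 s).
  { apply (is_derive_max_left V kap s (V1 s) Hs'); [apply HV; lra |].
    intros y Hy; rewrite HVs; apply HVB; lra. }
  pose proof (outside_U_max B s HB Hs HVk HVB HUB) as HU.
  unfold U in HU. rewrite HVs in HU.
  assert (0 <= sqrt (s ^ 2 - kap ^ 2) * V1 s) by (apply Rmult_le_pos; [apply sqrt_pos | lra]).
  lra.
Qed.

End OutsideTurningPoint.

Lemma turning_outside_bound (kap s1 s2 k N B : R) (V V1 F f : R -> R) :
  0 < kap -> 0 < k -> kap < s1 -> s1 < s2 ->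
  (forall s, kap <= s <= s1 -> is_derive V s (V1 s)) ->
  (forall s, kap <= s <= s1 -> continuous V1 s) ->
  (forall s, kap <= s <= s1 -> is_derive F s (f s + (k ^ 2 - 1) * V s)) ->
  (forall s, kap <= s < s2 ->
     (kap ^ 2 - s ^ 2) * V1 s = (2 * k + 1) * s * V s + F s) ->
  (forall s, kap <= s <= s1 -> Rabs (f s) <= N) ->
  N <= k * (k + 2) * B -> Rabs (V kap) <= B ->
  forall s, kap <= s <= s1 -> Rabs (V s) <= B.
Proof.
  intros Hkap Hk Hs1 Hs2 HV HV1 HF Heq Hf HNB HVk.
  assert (Hopp : forall (g : R -> R) s l, is_derive g s l -> is_derive (fun s => - g s) s (- l)).
  { intros g s l Hg; apply (is_derive_opp g s l Hg). }
  set (W := fun s => - V s). set (W1 := fun s => - V1 s).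
  set (G := fun s => - F s). set (g := fun s => - f s).
  assert (HW : forall s, kap <= s <= s1 -> is_derive W s (W1 s)) by (intros; apply Hopp; auto).
  assert (HW1 : forall s, kap <= s <= s1 -> continuous W1 s)
    by (intros; apply (continuous_opp V1); auto).
  assert (HG : forall s, kap <= s <= s1 -> is_derive G s (g s + (k ^ 2 - 1) * W s)).
  { intros s Hs; replace (g s + (k ^ 2 - 1) * W s) with (- (f s + (k ^ 2 - 1) * V s))
      by (unfold g, W; ring). apply Hopp; auto. }
  assert (Heq' : forall s, kap <= s < s2 ->
     (kap ^ 2 - s ^ 2) * W1 s = (2 * k + 1) * s * W s + G s).
  { intros s Hs; specialize (Heq s Hs); unfold W, W1, G; lra. }
  assert (Hg : forall s, kap <= s <= s1 -> Rabs (g s) <= N).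
  { intros s Hs; unfold g; rewrite Rabs_Ropp; auto. }
  set (U := fun (X X1 : R -> R) s => sqrt (s ^ 2 - kap ^ 2) * X1 s + k * X s).
  assert (HcV : forall s, kap <= s <= s1 -> continuity_pt V s)
    by (intros; eapply is_derive_continuity_pt; eauto).
  assert (HcW : forall s, kap <= s <= s1 -> continuity_pt W s)
    by (intros; eapply is_derive_continuity_pt; eauto).
  assert (HcU : forall s, kap <= s <= s1 -> continuity_pt (U V V1) s)
    by (intros; apply (outside_U_cont kap s1 k V V1); auto).
  assert (HcU' : forall s, kap <= s <= s1 -> continuity_pt (U W W1) s)
    by (intros; apply (outside_U_cont kap s1 k W W1); auto).
  destruct (continuity_ab_maj V kap s1) as [v1 [Hv1 Hv1k]]; [lra | exact HcV |].
  destruct (continuity_ab_maj W kap s1) as [v2 [Hv2 Hv2k]]; [lra | exact HcW |].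
  destruct (continuity_ab_maj (U V V1) kap s1) as [u1 [Hu1 Hu1k]]; [lra | exact HcU |].
  destruct (continuity_ab_maj (U W W1) kap s1) as [u2 [Hu2 Hu2k]]; [lra | exact HcU' |].
  (* One level [M] for all four continuous functions, attained by one of them. Were it above [B],
     the two preceding lemmas would put each of the four strictly below it. *)
  set (M := Rmax (Rmax (V v1) (W v2)) (Rmax (U V V1 u1 / k) (U W W1 u2 / k))).
  assert (HM1 : V v1 <= M) by (eapply Rle_trans; [apply Rmax_l | apply Rmax_l]).
  assert (HM2 : W v2 <= M) by (eapply Rle_trans; [apply Rmax_r | apply Rmax_l]).
  assert (Hdiv : forall x, x / k <= M -> x <= k * M).
  { intros x Hx; apply Rmult_le_compat_l with (r := k) in Hx; [| lra].
    replace (k * (x / k)) with x in Hx by (field; lra). exact Hx. }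
  assert (HM3 : U V V1 u1 <= k * M)
    by (apply Hdiv; eapply Rle_trans; [apply Rmax_l | apply Rmax_r]).
  assert (HM4 : U W W1 u2 <= k * M)
    by (apply Hdiv; eapply Rle_trans; [apply Rmax_r | apply Rmax_r]).
  assert (HMB : M <= B).
  { destruct (Rle_or_lt M B) as [H|H]; [exact H | exfalso].
    assert (HNM : N < k * (k + 2) * M) by nra.
    apply Rabs_le_between in HVk.
    assert (HVk1 : V kap < M) by lra. assert (HWk1 : W kap < M) by (unfold W; lra).
    assert (HV' : forall x, kap <= x <= s1 -> V x <= M)
      by (intros x Hx; eapply Rle_trans; [apply Hv1, Hx | exact HM1]).
    assert (HW' : forall x, kap <= x <= s1 -> W x <= M)
      by (intros x Hx; eapply Rle_trans; [apply Hv2, Hx | exact HM2]).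
    assert (HU' : forall x, kap <= x <= s1 -> U V V1 x <= k * M)
      by (intros x Hx; eapply Rle_trans; [apply Hu1, Hx | exact HM3]).
    assert (HUW' : forall x, kap <= x <= s1 -> U W W1 x <= k * M)
      by (intros x Hx; eapply Rle_trans; [apply Hu2, Hx | exact HM4]).
    assert (E1 : V v1 < M) by (apply (outside_V_U_max kap s1 s2 k N V V1 F f); auto).
    assert (E2 : W v2 < M) by (apply (outside_V_U_max kap s1 s2 k N W W1 G g); auto).
    assert (E3 : U V V1 u1 < k * M) by (apply (outside_U_max kap s1 s2 k N V V1 F f); auto).
    assert (E4 : U W W1 u2 < k * M) by (apply (outside_U_max kap s1 s2 k N W W1 G g); auto).
    assert (Hdiv' : forall x, x < k * M -> x / k < M).
    { intros x Hx. apply Rmult_lt_reg_l with k; [lra |].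
      replace (k * (x / k)) with x by (field; lra). exact Hx. }
    apply (Rlt_irrefl M).
    apply Rmax_lub_lt; apply Rmax_lub_lt; auto. }
  intros s Hs; apply Rabs_le; split.
  - specialize (Hv2 s Hs); unfold W in Hv2 at 1; lra.
  - specialize (Hv1 s Hs); lra.
Qed.

(** * Parameter integrals *)

Lemma ex_RInt_cont (f : R -> R) a b :
  a <= b -> (forall w, a <= w <= b -> continuous f w) -> ex_RInt f a b.
Proof.
  intros Hab H; apply (ex_RInt_continuous (V := R_CompleteNormedModule)).
  intros z Hz; rewrite Rmin_left, Rmax_right in Hz by lra; apply H, Hz.
Qed.

Lemma RInt_plus_R (f g : R -> R) a b : ex_RInt f a b -> ex_RInt g a b ->
  RInt (fun x => f x + g x) a b = RInt f a b + RInt g a b.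
Proof. exact (RInt_plus f g a b). Qed.

Lemma RInt_scal_R (f : R -> R) a b c : ex_RInt f a b ->
  RInt (fun x => c * f x) a b = c * RInt f a b.
Proof. exact (RInt_scal f a b c). Qed.

Lemma RInt_close (f g : R -> R) e :
  ex_RInt f 0 1 -> ex_RInt g 0 1 ->
  (forall w, 0 <= w <= 1 -> Rabs (f w - g w) <= e) ->
  Rabs (RInt f 0 1 - RInt g 0 1) <= e.
Proof.
  intros Hf Hg H.
  assert (Hm : RInt f 0 1 - RInt g 0 1 = RInt (fun w => f w - g w) 0 1).
  { symmetry; apply (RInt_minus f g 0 1 Hf Hg). }
  rewrite Hm. replace e with ((1 - 0) * e) by ring.
  apply abs_RInt_le_const; [lra | apply (ex_RInt_minus f g 0 1 Hf Hg) | exact H].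
Qed.

Lemma continuity_2d_section (F : R -> R -> R) s w :
  continuity_2d_pt F s w -> continuous (F s) w.
Proof.
  intros H; apply continuity_pt_filterlim, continuity_pt_locally.
  intros e; destruct (H e) as [d Hd]; exists d; intros y Hy.
  apply Hd; [rewrite Rminus_diag, Rabs_R0; apply cond_pos | exact Hy].
Qed.

Lemma continuity_2d_uniform (F : R -> R -> R) s :
  (forall w, 0 <= w <= 1 -> continuity_2d_pt F s w) ->
  forall e, 0 < e -> exists d, 0 < d /\
    forall s' w, Rabs (s' - s) < d -> 0 <= w <= 1 -> Rabs (F s' w - F s w) < e.
Proof.
  intros H e He.
  destruct (uniform_continuity_2d_1d' F 0 1 s H (mkposreal e He)) as [d Hd].
  exists d; split; [apply cond_pos |].
  intros s' w Hs Hw. apply Rabs_lt_between in Hs.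
  apply (Hd w s w s'); try lra.
  rewrite Rminus_diag, Rabs_R0; apply cond_pos.
Qed.

Lemma RInt_param_continuous (F : R -> R -> R) s r :
  0 < r ->
  (forall s' w, Rabs (s' - s) < r -> 0 <= w <= 1 -> continuity_2d_pt F s' w) ->
  continuous (fun s => RInt (F s) 0 1) s.
Proof.
  intros Hr H.
  assert (Hex : forall s', Rabs (s' - s) < r -> ex_RInt (F s') 0 1).
  { intros s' Hs'; apply ex_RInt_cont; [lra |]; intros w Hw.
    apply continuity_2d_section, H; assumption. }
  assert (Hss : Rabs (s - s) < r) by (rewrite Rminus_diag, Rabs_R0; exact Hr).
  apply continuity_pt_filterlim, continuity_pt_locally; intros e.
  destruct (continuity_2d_uniform F s (fun w => H s w Hss) (e / 2)) as [d [Hd Hd']];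
    [apply is_pos_div_2 |].
  assert (Hm : 0 < Rmin d r) by (apply Rmin_glb_lt; assumption).
  exists (mkposreal _ Hm); intros y Hy.
  assert (Hy' : Rabs (y - s) < Rmin d r) by exact Hy.
  apply Rle_lt_trans with (e / 2); [| pose proof (cond_pos e); lra].
  apply RInt_close; [apply Hex | apply Hex, Hss |].
  - eapply Rlt_le_trans; [exact Hy' | apply Rmin_r].
  - intros w Hw; apply Rlt_le, Hd'; [| exact Hw].
    eapply Rlt_le_trans; [exact Hy' | apply Rmin_l].
Qed.

(** The mean value theorem replaces the difference quotient by [F1] at an intermediate point that
    depends on [w]; continuity of [F1] along the whole segment over [s] makes the error uniform in
    [w]. *)
Lemma RInt_param_derive (F F1 : R -> R -> R) s r :
  0 < r ->
  (forall s' w, Rabs (s' - s) < r -> 0 <= w <= 1 ->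
     is_derive (fun x => F x w) s' (F1 s' w)) ->
  (forall s' w, Rabs (s' - s) < r -> 0 <= w <= 1 -> continuous (F s') w) ->
  (forall w, 0 <= w <= 1 -> continuity_2d_pt F1 s w) ->
  is_derive (fun s => RInt (F s) 0 1) s (RInt (F1 s) 0 1).
Proof.
  intros Hr Hd Hc Hc1.
  assert (Hex : forall s', Rabs (s' - s) < r -> ex_RInt (F s') 0 1).
  { intros s' Hs'; apply ex_RInt_cont; [lra |]; intros w Hw. apply Hc; assumption. }
  assert (Hex1 : ex_RInt (F1 s) 0 1).
  { apply ex_RInt_cont; [lra |]; intros w Hw. apply continuity_2d_section, Hc1, Hw. }
  assert (Hss : Rabs (s - s) < r) by (rewrite Rminus_diag, Rabs_R0; exact Hr).
  apply is_derive_Reals; intros e He.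
  destruct (continuity_2d_uniform F1 s Hc1 (e / 2)) as [d [Hd0 Hd']]; [lra |].
  assert (Hm : 0 < Rmin d r) by (apply Rmin_glb_lt; assumption).
  exists (mkposreal _ Hm); intros h Hh0 Hh.
  assert (Hh1 : Rabs h < d) by (eapply Rlt_le_trans; [exact Hh | apply Rmin_l]).
  assert (Hh2 : Rabs h < r) by (eapply Rlt_le_trans; [exact Hh | apply Rmin_r]).
  assert (Hsh : Rabs (s + h - s) < r) by (replace (s + h - s) with h by ring; exact Hh2).
  assert (Hquot : RInt (fun w => (F (s + h) w - F s w) / h) 0 1 =
                  (RInt (F (s + h)) 0 1 - RInt (F s) 0 1) / h).
  { transitivity (RInt (fun w => scal (/ h) (minus (F (s + h) w) (F s w))) 0 1).
    - apply RInt_ext; intros w _; unfold scal, minus, plus, opp; simpl; unfold mult; simpl.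
      field; exact Hh0.
    - rewrite (RInt_scal (fun w => minus (F (s + h) w) (F s w))).
      + rewrite (RInt_minus (F (s + h)) (F s)) by (apply Hex; assumption).
        unfold scal, minus, plus, opp; simpl; unfold mult; simpl. field; exact Hh0.
      + apply (ex_RInt_minus (F (s + h)) (F s)); apply Hex; assumption. }
  rewrite <- Hquot.
  apply Rle_lt_trans with (e / 2); [| lra].
  apply RInt_close; [| exact Hex1 |].
  - apply ex_RInt_ext with (fun w => scal (/ h) (minus (F (s + h) w) (F s w))).
    + intros w _; unfold scal, minus, plus, opp; simpl; unfold mult; simpl.
      field; exact Hh0.
    + apply (ex_RInt_scal (fun w => minus (F (s + h) w) (F s w))).
      apply (ex_RInt_minus (F (s + h)) (F s)); apply Hex; assumption.
  - intros w Hw.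
    assert (Hmv : exists c, F (s + h) w - F s w = F1 c w * h /\ Rabs (c - s) < Rabs h).
    { destruct (Rlt_dec 0 h) as [Hp|Hn].
      - destruct (MVT_is_derive (fun x => F x w) (fun x => F1 x w) s (s + h)) as [c [Hc' Hcc]];
          [lra | |].
        { intros c Hcc; apply Hd; [| exact Hw]. apply Rle_lt_trans with (Rabs h); [| exact Hh2].
          rewrite !Rabs_right by lra; lra. }
        exists c; split; [rewrite Hc'; ring | rewrite !Rabs_right by lra; lra].
      - destruct (MVT_is_derive (fun x => F x w) (fun x => F1 x w) (s + h) s) as [c [Hc' Hcc]];
          [lra | |].
        { intros c Hcc; apply Hd; [| exact Hw]. apply Rle_lt_trans with (Rabs h); [| exact Hh2].
          rewrite !Rabs_left1 by lra; lra. }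
        exists c; split; [replace (F (s + h) w - F s w) with (- (F s w - F (s + h) w)) by ring;
          rewrite Hc'; ring | rewrite !Rabs_left by lra; lra]. }
    destruct Hmv as [c [Hc' Hcc]]. rewrite Hc'.
    replace (F1 c w * h / h) with (F1 c w) by (field; exact Hh0).
    apply Rlt_le, Hd'; [lra | exact Hw].
Qed.

Lemma continuous_2d_fst (f : R -> R) s w :
  continuous f s -> continuity_2d_pt (fun u _ => f u) s w.
Proof.
  intros H; apply (continuity_1d_2d_pt_comp f (fun u _ => u)).
  - apply continuity_pt_filterlim, H.
  - apply continuity_2d_pt_id1.
Qed.

Lemma continuous_2d_snd (f : R -> R) s w :
  continuous f w -> continuity_2d_pt (fun _ v => f v) s w.
Proof.
  intros H; apply (continuity_1d_2d_pt_comp f (fun _ v => v)).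
  - apply continuity_pt_filterlim, H.
  - apply continuity_2d_pt_id2.
Qed.

(** A weighted average of [f] over the segment from [a] to [s]. Differentiation in [s] only
    multiplies the weight by [theta], so quotients that look singular at [s = a] inherit the full
    smoothness of [f]. *)
Definition dilated (omega theta : R -> R) (a : R) (f : R -> R) (s : R) : R :=
  RInt (fun w => omega w * f (a + (s - a) * theta w)) 0 1.

Definition ivl (lo hi : R) (_ : unit) (s : R) : Prop := lo < s < hi.

Lemma open_ivl lo hi : open_dom (ivl lo hi).
Proof. intros i x Hx; apply open_interval, Hx. Qed.

Section Dilated.
Context (theta : R -> R) (a lo hi : R).
Context (Hth : forall w, continuous theta w).
Context (Hth01 : forall w, 0 <= w <= 1 -> 0 <= theta w <= 1).
Context (Ha : lo < a < hi).

Lemma dilated_in s w : lo < s < hi -> 0 <= w <= 1 -> lo < a + (s - a) * theta w < hi.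
Proof.
  intros Hs Hw; specialize (Hth01 w Hw).
  assert (0 <= (a - lo) * (1 - theta w)) by (apply Rmult_le_pos; lra).
  assert (0 <= (hi - a) * (1 - theta w)) by (apply Rmult_le_pos; lra).
  destruct (Req_dec (theta w) 0) as [Hz|Hz]; [rewrite Hz in *; lra |].
  assert (0 < (s - lo) * theta w) by (apply Rmult_lt_0_compat; lra).
  assert (0 < (hi - s) * theta w) by (apply Rmult_lt_0_compat; lra).
  lra.
Qed.

Lemma dilated_2d (omega f : R -> R) s w :
  (forall w, continuous omega w) -> (forall x, lo < x < hi -> continuous f x) ->
  lo < s < hi -> 0 <= w <= 1 ->
  continuity_2d_pt (fun s w => omega w * f (a + (s - a) * theta w)) s w.
Proof.
  intros Ho Hf Hs Hw.
  apply continuity_2d_pt_mult.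
  - apply (continuous_2d_snd omega), Ho.
  - apply (continuity_1d_2d_pt_comp f (fun s w => a + (s - a) * theta w)).
    + apply continuity_pt_filterlim, Hf, dilated_in; auto.
    + apply continuity_2d_pt_plus; [apply continuity_2d_pt_const |].
      apply continuity_2d_pt_mult; [| apply (continuous_2d_snd theta), Hth].
      apply continuity_2d_pt_minus; [apply continuity_2d_pt_id1 | apply continuity_2d_pt_const].
Qed.

Lemma near_ivl s : lo < s < hi -> exists r, 0 < r /\
  forall s', Rabs (s' - s) < r -> lo < s' < hi.
Proof.
  intros Hs; exists (Rmin (s - lo) (hi - s)); split; [apply Rmin_glb_lt; lra |].
  intros s' H.
  assert (Rmin (s - lo) (hi - s) <= s - lo) by apply Rmin_l.
  assert (Rmin (s - lo) (hi - s) <= hi - s) by apply Rmin_r.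
  apply Rabs_def2 in H; lra.
Qed.

Lemma dilated_continuous (omega f : R -> R) s :
  (forall w, continuous omega w) -> (forall x, lo < x < hi -> continuous f x) ->
  lo < s < hi -> continuous (dilated omega theta a f) s.
Proof.
  intros Ho Hf Hs; destruct (near_ivl s Hs) as [r [Hr Hr']].
  apply (RInt_param_continuous (fun s w => omega w * f (a + (s - a) * theta w)) s r Hr).
  intros s' w Hs' Hw; apply dilated_2d; auto.
Qed.

Lemma dilated_derive (omega f f1 : R -> R) s :
  (forall w, continuous omega w) ->
  (forall x, lo < x < hi -> is_derive f x (f1 x)) ->
  (forall x, lo < x < hi -> continuous f1 x) -> lo < s < hi ->
  is_derive (dilated omega theta a f) s
    (dilated (fun w => omega w * theta w) theta a f1 s).
Proof.
  intros Ho Hf Hf1 Hs; destruct (near_ivl s Hs) as [r [Hr Hr']].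
  apply (RInt_param_derive (fun s w => omega w * f (a + (s - a) * theta w))
    (fun s w => omega w * theta w * f1 (a + (s - a) * theta w)) s r Hr).
  - intros s' w Hs' Hw.
    replace (omega w * theta w * f1 (a + (s' - a) * theta w))
      with (omega w * (theta w * f1 (a + (s' - a) * theta w))) by ring.
    apply (is_derive_scal (fun x => f (a + (x - a) * theta w))).
    apply (is_derive_comp f (fun x => a + (x - a) * theta w)).
    + apply Hf, dilated_in; auto.
    + auto_derive; [exact Logic.I | ring].
  - intros s' w Hs' Hw; apply (continuity_2d_section
      (fun s w => omega w * f (a + (s - a) * theta w))), dilated_2d; auto.
    intros x Hx; apply (is_derive_cont f x (f1 x)), Hf, Hx.
  - intros w Hw; apply (dilated_2d (fun w => omega w * theta w)); auto.
    intros x; apply (continuous_mult omega theta); auto.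
Qed.

Lemma dilated_bound (omega f : R -> R) K :
  (forall w, continuous omega w) -> (forall x, lo < x < hi -> continuous f x) ->
  (forall x, lo < x < hi -> Rabs (f x) <= K) ->
  exists K', forall s, lo < s < hi -> Rabs (dilated omega theta a f s) <= K'.
Proof.
  intros Ho Hf HK.
  destruct (bounded_continuity omega 0 1) as [M HM]; [intros x _; apply Ho |].
  exists ((1 - 0) * (M * K)); intros s Hs. apply abs_RInt_le_const; [lra | |].
  - apply (ex_RInt_cont (fun w => omega w * f (a + (s - a) * theta w))); [lra |].
    intros w Hw.
    apply (continuity_2d_section (fun s w => omega w * f (a + (s - a) * theta w))),
      dilated_2d; auto.
  - intros w Hw; rewrite Rabs_mult; apply Rmult_le_compat; try apply Rabs_pos.
    + apply Rlt_le, (HM w Hw).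
    + apply HK, dilated_in; auto.
Qed.

Lemma dilated_UC n (omega f : R -> R) :
  (forall w, continuous omega w) -> UC (ivl lo hi) n (fun _ => f) ->
  UC (ivl lo hi) n (fun _ => dilated omega theta a f).
Proof.
  revert omega f; induction n as [|n IH]; intros omega f Ho HU;
    destruct (UC_bound _ _ _ HU) as [K [_ HK]];
    pose proof (UC_cont _ _ _ HU) as Hc;
    (split; [| split]).
  1,4: destruct (dilated_bound omega f K Ho (fun x => Hc tt x) (fun x => HK tt x)) as [K' HK'];
       exists K'; intros [] s Hs; apply HK', Hs.
  1,3: intros [] s Hs; apply dilated_continuous; auto; intros x Hx; apply (Hc tt x Hx).
  - exact Logic.I.
  - destruct HU as [_ [_ [f1 [Hd Hf1]]]].
    pose proof (UC_cont _ _ _ Hf1) as Hc1.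
    exists (fun _ => dilated (fun w => omega w * theta w) theta a (f1 tt)); split.
    + intros [] s Hs; apply dilated_derive; [exact Ho | | | exact Hs];
        intros x Hx; [apply (Hd tt x Hx) | apply (Hc1 tt x Hx)].
    + apply IH.
      * intros w; apply (continuous_mult omega theta); auto.
      * apply (UC_reindex (fun _ => tt) _ _ _ Hf1).
Qed.

End Dilated.

(* Integrating [d/dw (Om w * f (a + (s - a) theta w))]. *)
Lemma dilated_parts (Om om omega theta theta1 : R -> R) a lo hi (f f1 : R -> R) s :
  (forall w, continuous theta w) ->
  (forall w, 0 <= w <= 1 -> 0 <= theta w <= 1) -> lo < a < hi ->
  (forall w, is_derive Om w (om w)) -> (forall w, continuous om w) ->
  (forall w, is_derive theta w (theta1 w)) -> (forall w, continuous theta1 w) ->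
  (forall w, Om w * theta1 w = omega w * theta w) ->
  (forall w, continuous omega w) ->
  Om 0 = 0 -> Om 1 = 1 -> theta 1 = 1 ->
  (forall x, lo < x < hi -> is_derive f x (f1 x)) ->
  (forall x, lo < x < hi -> continuous f1 x) -> lo < s < hi ->
  (s - a) * dilated (fun w => omega w * theta w) theta a f1 s
  = f s - dilated om theta a f s.
Proof.
  intros Hth Hth01 Ha HOm Hom Hth1 Hcth1 Hrel Hoc H0 H1 Ht1 Hf Hf1 Hs.
  assert (Hin : forall w, 0 <= w <= 1 -> lo < a + (s - a) * theta w < hi)
    by (intros w Hw; apply (dilated_in theta a lo hi); auto).
  assert (Hcf : forall x, lo < x < hi -> continuous f x)
    by (intros x Hx; apply (is_derive_cont f x (f1 x)), Hf, Hx).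
  pose (G := fun w => Om w * f (a + (s - a) * theta w)).
  pose (g := fun w => om w * f (a + (s - a) * theta w) +
                      (s - a) * (omega w * theta w * f1 (a + (s - a) * theta w))).
  assert (Hc1 : forall w, 0 <= w <= 1 -> continuous (fun w => om w * f (a + (s - a) * theta w)) w).
  { intros w Hw; apply (continuity_2d_section (fun s w => om w * f (a + (s - a) * theta w))).
    apply (dilated_2d theta a lo hi); auto. }
  assert (Hc2 : forall w, 0 <= w <= 1 ->
     continuous (fun w => omega w * theta w * f1 (a + (s - a) * theta w)) w).
  { intros w Hw; apply (continuity_2d_section
      (fun s w => omega w * theta w * f1 (a + (s - a) * theta w))).
    apply (dilated_2d theta a lo hi Hth Hth01 Ha (fun w => omega w * theta w)); auto.
    intros x; apply (continuous_mult omega theta); auto. }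
  assert (HI : is_RInt g 0 1 (G 1 - G 0)).
  { apply (is_RInt_derive G g).
    - intros w Hw; rewrite Rmin_left, Rmax_right in Hw by lra.
      eapply is_derive_eq.
      + apply (is_derive_mult Om (fun w => f (a + (s - a) * theta w)) w (om w)
          (((s - a) * theta1 w) * f1 (a + (s - a) * theta w))); [apply HOm | |
          intros; apply Rmult_comm].
        apply (is_derive_comp f (fun w => a + (s - a) * theta w)); [apply Hf, Hin, Hw |].
        eapply is_derive_eq.
        * apply (is_derive_plus (fun _ => a) (fun w => (s - a) * theta w)).
          -- apply @is_derive_const.
          -- apply (is_derive_scal theta); apply Hth1.
        * rewrite Rplus_0_l. reflexivity.
      + unfold g, plus, mult; simpl.
        replace (Om w * ((s - a) * theta1 w * f1 (a + (s - a) * theta w)))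
          with ((s - a) * (Om w * theta1 w * f1 (a + (s - a) * theta w))) by ring.
        rewrite Hrel. reflexivity.
    - intros w Hw; rewrite Rmin_left, Rmax_right in Hw by lra.
      apply (continuous_plus (fun w => om w * f (a + (s - a) * theta w))); [apply Hc1, Hw |].
      apply (continuous_scal_r (s - a)
        (fun w => omega w * theta w * f1 (a + (s - a) * theta w))), Hc2, Hw. }
  assert (HE1 : ex_RInt (fun w => om w * f (a + (s - a) * theta w)) 0 1).
  { apply (ex_RInt_cont (fun w => om w * f (a + (s - a) * theta w))); [lra |].
    intros w Hw; apply Hc1, Hw. }
  assert (HE2 : ex_RInt (fun w => omega w * theta w * f1 (a + (s - a) * theta w)) 0 1).
  { apply (ex_RInt_cont (fun w => omega w * theta w * f1 (a + (s - a) * theta w))); [lra |].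
    intros w Hw; apply Hc2, Hw. }
  apply (is_RInt_unique (V := R_CompleteNormedModule) g) in HI.
  assert (HS : RInt g 0 1 = dilated om theta a f s +
     (s - a) * dilated (fun w => omega w * theta w) theta a f1 s).
  { unfold g, dilated.
    rewrite <- (RInt_scal_R _ 0 1 (s - a) HE2).
    apply (RInt_plus_R (fun w => om w * f (a + (s - a) * theta w)) _ 0 1 HE1).
    apply (ex_RInt_scal _ _ _ (s - a) HE2). }
  unfold G in HI. rewrite H0, H1, Ht1 in HI.
  replace (a + (s - a) * 1) with s in HI by ring. lra.
Qed.

(** * The singular equation for Y *)

Definition turning_avg (kap : R) (f : R -> R) (s : R) : R :=
  dilated (fun w => 2 * w ^ 2) (fun w => w ^ 2) kap (fun x => sqrt (x + kap) * f x) s.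

Definition pow32 (x : R) : R := x * sqrt x.

(* The solution of [(kap^2 - s^2) Y' = 3 s Y + f] that is regular at [s = kap]: the
   average is [int_kap^s sqrt (x + kap) sqrt (x - kap) f dx / (s - kap)^(3/2)] after
   the substitution [x = kap + (s - kap) w^2]. *)
Definition Yright (kap : R) (f : R -> R) (s : R) : R :=
  - turning_avg kap f s / pow32 (s + kap).

Lemma pow32_pos x : 0 < x -> 0 < pow32 x.
Proof. intros H; apply Rmult_lt_0_compat; [exact H | apply sqrt_lt_R0, H]. Qed.

Lemma is_derive_pow32 x : 0 < x -> is_derive pow32 x (3 / 2 * sqrt x).
Proof.
  intros Hx; assert (Hq : 0 < sqrt x) by (apply sqrt_lt_R0, Hx).
  unfold pow32; auto_derive; [exact Hx |].
  pose proof (sqrt_sqrt x (Rlt_le _ _ Hx)) as Hxx. revert Hq Hxx.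
  generalize (sqrt x); intros t Hq <-. field; lra.
Qed.

Lemma continuous_sq2 w : continuous (fun w => 2 * w ^ 2) w.
Proof. apply @ex_derive_continuous; auto_derive; exact Logic.I. Qed.

Lemma continuous_sq w : continuous (fun w => w ^ 2) w.
Proof. apply @ex_derive_continuous; auto_derive; exact Logic.I. Qed.

Lemma sq_01 w : 0 <= w <= 1 -> 0 <= w ^ 2 <= 1.
Proof. intros H; split; nra. Qed.

Lemma avg_point kap s w : 0 < kap -> - kap < s -> 0 <= w <= 1 ->
  - kap < kap + (s - kap) * w ^ 2.
Proof.
  intros Hk Hs Hw; pose proof (sq_01 w Hw) as Hw2.
  assert (0 <= (s + kap) * w ^ 2) by (apply Rmult_le_pos; lra).
  destruct (Req_dec (w ^ 2) 1) as [H1|H1]; [rewrite H1 in *; lra |].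
  assert (0 < kap * (1 - w ^ 2)) by (apply Rmult_lt_0_compat; lra). lra.
Qed.

Section RightTurningPoint.
Context (kap S : R) (Hkap : 0 < kap) (HS : kap < S).

Lemma weight_UC lo n f : - kap < lo ->
  UC (ivl lo S) n (fun _ => f) ->
  UC (ivl lo S) n (fun _ x => sqrt (x + kap) * f x).
Proof.
  intros Hlo Hf; apply UC_mult; [| exact Hf].
  apply UC_sqrt with (lo + kap); [apply open_ivl | lra | |].
  - intros i x [Hx _]; lra.
  - apply (UC_plus _ _ (fun _ x => x) (fun _ _ => kap)); [| apply UC_cst].
    apply UC_id with (Rabs lo + Rabs S). intros i x [Hx1 Hx2].
    apply Rabs_le. pose proof (Rle_abs lo); pose proof (Rle_abs S).
    pose proof (Rle_abs (- lo)); pose proof (Rle_abs (- S)). rewrite Rabs_Ropp in *.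
    lra.
Qed.

Lemma turning_avg_UC lo n f : - kap < lo < kap ->
  UC (ivl lo S) n (fun _ => f) -> UC (ivl lo S) n (fun _ => turning_avg kap f).
Proof.
  intros Hlo Hf; unfold turning_avg.
  apply (dilated_UC (fun w => w ^ 2) kap lo S continuous_sq sq_01);
    [lra | exact continuous_sq2 |].
  apply weight_UC; [lra | exact Hf].
Qed.

(** [lo] keeps away from the other turning point, where [sqrt (x + kap)] is singular. These bounds
    depend on [kap]; they only provide the differentiability that the maximum principle
    presupposes. *)
Lemma Yright_UC lo n f : - kap < lo < kap ->
  UC (ivl lo S) n (fun _ => f) -> UC (ivl lo S) n (fun _ => Yright kap f).
Proof.
  intros Hlo Hf; unfold Yright, Rdiv.
  assert (Hid : UC (ivl lo S) n (fun _ x => x + kap)).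
  { apply (UC_plus _ _ (fun _ x => x) (fun _ _ => kap)); [| apply UC_cst].
    apply UC_id with (kap + S). intros i x [Hx1 Hx2]. apply Rabs_le; lra. }
  assert (Hlow : forall (i : unit) x, ivl lo S i x -> lo + kap <= x + kap)
    by (intros i x [Hx _]; lra).
  apply (UC_mult _ _ (fun _ s => - turning_avg kap f s) (fun _ s => / pow32 (s + kap))).
  - apply UC_opp; [apply open_ivl | apply turning_avg_UC; assumption].
  - apply UC_inv with ((lo + kap) * sqrt (lo + kap)); [apply open_ivl | | |].
    + apply pow32_pos; lra.
    + intros i x Hx; specialize (Hlow i x Hx). apply Rmult_le_compat; try lra.
      * apply sqrt_pos.
      * apply sqrt_le_1_alt; lra.
    + apply UC_mult; [exact Hid |].
      apply UC_sqrt with (lo + kap); [apply open_ivl | lra | exact Hlow | exact Hid].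
Qed.

Lemma turning_avg_derive lo f : - kap < lo < kap ->
  UC (ivl lo S) 1 (fun _ => f) -> forall s, lo < s < S ->
  exists l, is_derive (turning_avg kap f) s l /\
    (s - kap) * l = sqrt (s + kap) * f s - 3 / 2 * turning_avg kap f s.
Proof.
  intros Hlo Hf s Hs.
  pose proof (weight_UC lo 1 f (proj1 Hlo) Hf) as HU.
  destruct (UC_Derive _ _ _ (open_ivl lo S) HU) as [Hd HU1].
  pose proof (UC_cont _ _ _ HU1) as Hc1.
  set (phi := fun x => sqrt (x + kap) * f x) in *.
  exists (dilated (fun w => 2 * w ^ 2 * w ^ 2) (fun w => w ^ 2) kap (Derive phi) s); split.
  - assert (Ha : lo < kap < S) by lra.
    exact (dilated_derive (fun w => w ^ 2) kap lo S continuous_sq sq_01 Ha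
      (fun w => 2 * w ^ 2) phi (Derive phi) s continuous_sq2
      (fun x Hx => Hd tt x Hx) (fun x Hx => Hc1 tt x Hx) Hs).
  (* The boundary factor [w^3] has derivative [3 w^2], which is [3 / 2] of the averaging weight
     [2 w^2]. *)
  - rewrite (dilated_parts (fun w => w ^ 3) (fun w => 3 * w ^ 2) (fun w => 2 * w ^ 2)
      (fun w => w ^ 2) (fun w => 2 * w) kap lo S phi (Derive phi) s).
    + unfold turning_avg, dilated; fold phi. f_equal.
      rewrite <- RInt_scal_R.
      * apply RInt_ext; intros w _.
        as_R. unfold phi. field.
      * apply ex_RInt_cont; [lra |]. intros w Hw.
        apply (continuity_2d_section (fun s w => 2 * w ^ 2 * phi (kap + (s - kap) * w ^ 2))).
        apply (dilated_2d (fun w => w ^ 2) kap lo S continuous_sq sq_01);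
          [lra | exact continuous_sq2 | | exact Hs | exact Hw].
        intros x Hx; apply (UC_cont _ _ _ HU tt x Hx).
    + exact continuous_sq.
    + exact sq_01.
    + lra.
    + intros w; auto_derive; [exact Logic.I | ring].
    + intros w; apply @ex_derive_continuous; auto_derive; exact Logic.I.
    + intros w; auto_derive; [exact Logic.I | ring].
    + intros w; apply @ex_derive_continuous; auto_derive; exact Logic.I.
    + intros w; ring.
    + exact continuous_sq2.
    + ring.
    + ring.
    + ring.
    + intros x Hx; apply (Hd tt x Hx).
    + intros x Hx; apply (Hc1 tt x Hx).
    + exact Hs.
Qed.

Lemma Yright_derive lo f : - kap < lo < kap ->
  UC (ivl lo S) 1 (fun _ => f) -> forall s, lo < s < S ->
  exists l, is_derive (Yright kap f) s l /\
    (kap ^ 2 - s ^ 2) * l = 3 * s * Yright kap f s + f s.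
Proof.
  intros Hlo Hf s Hs.
  destruct (turning_avg_derive lo f Hlo Hf s Hs) as [l [Hl Hle]].
  assert (Hp : 0 < s + kap) by lra.
  assert (Hq : 0 < sqrt (s + kap)) by (apply sqrt_lt_R0, Hp).
  assert (Hqq : sqrt (s + kap) * sqrt (s + kap) = s + kap) by (apply sqrt_sqrt; lra).
  eexists; split.
  - apply (is_derive_div (fun s => - turning_avg kap f s) (fun s => pow32 (s + kap))).
    + apply (is_derive_opp (turning_avg kap f) s l Hl).
    + apply (is_derive_comp pow32 (fun s => s + kap)); [apply is_derive_pow32, Hp |].
      auto_derive; [exact Logic.I | reflexivity].
    + apply Rgt_not_eq, pow32_pos, Hp.
  - unfold Yright, scal, opp, pow32; simpl; unfold mult; simpl.
    assert (Hs2 : kap * (kap * 1) - s * (s * 1) = - (s - kap) * (s + kap)) by ring.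
    rewrite Hs2. revert Hq Hqq Hle.
    generalize (sqrt (s + kap)) (turning_avg kap f s) (f s); intros t J y Hq Hqq Hle.
    rewrite <- Hqq. assert (Hst : s = t * t - kap) by lra.
    transitivity (((s - kap) * l) / t - 3 / 2 * (s - kap) * J / (t * t * t)).
    + clear - Hq; field; lra.
    + rewrite Hle, Hst. clear - Hq; field; lra.
Qed.

End RightTurningPoint.

Definition refl (f : R -> R) (s : R) : R := f (- s).

(** The substitution [x = kap (1 - w^2)] shows this to be the mean of [m] over [[- kap, kap]] for
    the weight [sqrt (kap^2 - x^2)]: the one value of [c] for which the solutions regular at [kap]
    and at [- kap] coincide. *)
Definition mean_weight (kap : R) (m : R -> R) : R :=
  (turning_avg kap m 0 + turning_avg kap (refl m) 0) / (2 * turning_avg kap (fun _ => 1) 0).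

(** If [Y] solves the equation for [n], then [- Y (- s)] solves it for [refl n]. Each branch is
    regular at its own turning point; they are glued halfway between the two. *)
Definition Ysol (kap : R) (n : R -> R) (s : R) : R :=
  if Rlt_dec s 0 then - Yright kap (refl n) (- s) else Yright kap n s.

Lemma UC_refl S n f : UC (ivl (- S) S) n (fun _ => f) -> UC (ivl (- S) S) n (fun _ => refl f).
Proof.
  intros Hf; apply (UC_comp (ivl (- S) S) (ivl (- S) S) n (fun _ => f) (fun _ s => - s)).
  - intros i x [H1 H2]; split; lra.
  - exact Hf.
  - apply UC_opp; [apply open_ivl |]. apply UC_id with S.
    intros i x [H1 H2]; apply Rabs_le; lra.
Qed.

Lemma is_derive_refl f s l : is_derive f (- s) l -> is_derive (fun s => f (- s)) s (- l).
Proof.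
  intros H; eapply is_derive_eq.
  - apply (is_derive_comp f (fun s => - s) s l (-1) H). auto_derive; [exact Logic.I | ring].
  - unfold scal; simpl; unfold mult; simpl; ring.
Qed.

Section SymmetricInterval.
Context (kap S : R) (Hkap : 0 < kap) (HS : kap < S).

Lemma UC_right lo n f : - kap < lo ->
  UC (ivl (- S) S) n (fun _ => f) -> UC (ivl lo S) n (fun _ => f).
Proof. intros Hlo; apply UC_sub; intros i x [H1 H2]; split; lra. Qed.

Lemma turning_avg_ex (f : R -> R) s : (forall x, - S < x < S -> continuous f x) -> - kap < s < S ->
  ex_RInt (fun w => 2 * w ^ 2 *
    (sqrt (kap + (s - kap) * w ^ 2 + kap) * f (kap + (s - kap) * w ^ 2))) 0 1.
Proof.
  intros Hf Hs; apply ex_RInt_cont; [lra |]; intros w Hw.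
  pose (lo := (- kap + Rmin s 0) / 2).
  assert (Hm1 : Rmin s 0 <= s) by apply Rmin_l.
  assert (Hm2 : Rmin s 0 <= 0) by apply Rmin_r.
  assert (Hm3 : - kap < Rmin s 0) by (apply Rmin_glb_lt; lra).
  assert (Ha : lo < kap < S) by (unfold lo; lra).
  assert (Hs' : lo < s < S) by (unfold lo; lra).
  apply (continuity_2d_section (fun s w => 2 * w ^ 2 *
    (fun x => sqrt (x + kap) * f x) (kap + (s - kap) * w ^ 2))).
  refine (dilated_2d (fun w => w ^ 2) kap lo S continuous_sq sq_01 Ha
    (fun w => 2 * w ^ 2) (fun x => sqrt (x + kap) * f x) s w continuous_sq2 _ Hs' Hw).
  intros x Hx; apply (continuous_mult (fun x => sqrt (x + kap)) f).
  - apply continuous_sqrt_comp, @ex_derive_continuous; auto_derive; exact Logic.I.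
  - apply Hf; unfold lo in Hx; lra.
Qed.

Lemma turning_avg_le (f g : R -> R) s :
  (forall x, - S < x < S -> continuous f x) -> (forall x, - S < x < S -> continuous g x) ->
  (forall x, - S < x < S -> f x <= g x) -> - kap < s < S ->
  turning_avg kap f s <= turning_avg kap g s.
Proof.
  intros Hf Hg Hfg Hs; unfold turning_avg, dilated.
  apply RInt_le; [lra | apply turning_avg_ex; assumption | apply turning_avg_ex; assumption |].
  intros w Hw.
  apply Rmult_le_compat_l; [nra |]. apply Rmult_le_compat_l; [apply sqrt_pos |].
  apply Hfg. assert (Hw' : 0 <= w <= 1) by lra.
  pose proof (dilated_in (fun w => w ^ 2) kap ((- kap + Rmin s 0) / 2) S sq_01) as H.
  assert (Hm1 : Rmin s 0 <= s) by apply Rmin_l.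
  assert (Hm2 : Rmin s 0 <= 0) by apply Rmin_r.
  assert (Hm3 : - kap < Rmin s 0) by (apply Rmin_glb_lt; lra).
  specialize (H ltac:(lra) s w ltac:(lra) Hw'). lra.
Qed.

Lemma turning_avg_minus (f : R -> R) c s :
  (forall x, - S < x < S -> continuous f x) -> - kap < s < S ->
  turning_avg kap (fun x => f x - c) s
  = turning_avg kap f s - c * turning_avg kap (fun _ => 1) s.
Proof.
  intros Hf Hs; unfold turning_avg, dilated.
  pose proof (turning_avg_ex f s Hf Hs) as E1.
  pose proof (turning_avg_ex (fun _ => 1) s (fun x _ => continuous_const 1 x) Hs) as E2.
  match goal with |- _ = ?A - c * ?B => replace (A - c * B) with (A + - c * B) by ring end.
  rewrite <- (RInt_scal_R _ 0 1 (- c) E2).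
  rewrite <- RInt_plus_R; [| exact E1 | apply (ex_RInt_scal _ _ _ (- c) E2)].
  apply RInt_ext; intros w _.
  as_R. ring.
Qed.

Lemma turning_avg_scal_one c s : - kap < s < S ->
  turning_avg kap (fun _ => c) s = c * turning_avg kap (fun _ => 1) s.
Proof.
  intros Hs; unfold turning_avg, dilated.
  pose proof (turning_avg_ex (fun _ => 1) s (fun x _ => continuous_const 1 x) Hs) as E2.
  rewrite <- (RInt_scal_R _ 0 1 c E2). apply RInt_ext; intros w _.
  as_R. ring.
Qed.

Lemma turning_avg_one_pos s : - kap < s < S -> 0 < turning_avg kap (fun _ => 1) s.
Proof.
  intros Hs; unfold turning_avg, dilated. apply RInt_gt_0; [lra | |].
  - intros w Hw. apply Rmult_lt_0_compat; [nra |].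
    rewrite Rmult_1_r. apply sqrt_lt_R0. pose proof (avg_point kap s w Hkap). lra.
  - intros w Hw. apply (continuous_mult (fun w => 2 * w ^ 2)); [apply continuous_sq2 |].
    apply (continuous_mult (fun w => sqrt (kap + (s - kap) * w ^ 2 + kap))
      (fun _ => 1)); [| apply continuous_const].
    apply continuous_sqrt_comp, @ex_derive_continuous; auto_derive; exact Logic.I.
Qed.

Context (m : R -> R) (Hm : UC (ivl (- S) S) 3 (fun _ => m)).

Let c : R := mean_weight kap m.
Let n (s : R) : R := m s - c.

Lemma m_cont x : - S < x < S -> continuous m x.
Proof. intros Hx; apply (UC_cont _ _ _ Hm tt x Hx). Qed.

Lemma refl_m_cont x : - S < x < S -> continuous (refl m) x.
Proof. intros Hx; apply (UC_cont _ _ _ (UC_refl S 3 m Hm) tt x Hx). Qed.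

Lemma n_UC : UC (ivl (- S) S) 3 (fun _ => n).
Proof.
  apply (UC_minus _ _ (fun _ => m) (fun _ _ => c)); [apply open_ivl | exact Hm | apply UC_cst].
Qed.

Lemma mean_weight_ge m0 : (forall x, - S < x < S -> m0 <= m x) -> m0 <= c.
Proof.
  intros H; unfold c, mean_weight.
  assert (H0 : - kap < 0 < S) by lra.
  pose proof (turning_avg_one_pos 0 H0) as Hp.
  assert (H1 : turning_avg kap (fun _ => m0) 0 <= turning_avg kap m 0).
  { apply turning_avg_le; [intros; apply continuous_const | apply m_cont | exact H | exact H0]. }
  assert (H2 : turning_avg kap (fun _ => m0) 0 <= turning_avg kap (refl m) 0).
  { apply turning_avg_le; [intros; apply continuous_const | apply refl_m_cont | | exact H0].
    intros x Hx; apply H; lra. }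
  rewrite turning_avg_scal_one in H1, H2 by exact H0.
  apply Rmult_le_reg_r with (2 * turning_avg kap (fun _ => 1) 0); [lra |].
  unfold Rdiv; rewrite Rmult_assoc, Rinv_l by lra. lra.
Qed.

Lemma mean_weight_le m1 : (forall x, - S < x < S -> m x <= m1) -> c <= m1.
Proof.
  intros H; unfold c, mean_weight.
  assert (H0 : - kap < 0 < S) by lra.
  pose proof (turning_avg_one_pos 0 H0) as Hp.
  assert (H1 : turning_avg kap m 0 <= turning_avg kap (fun _ => m1) 0).
  { apply turning_avg_le; [apply m_cont | intros; apply continuous_const | exact H | exact H0]. }
  assert (H2 : turning_avg kap (refl m) 0 <= turning_avg kap (fun _ => m1) 0).
  { apply turning_avg_le; [apply refl_m_cont | intros; apply continuous_const | | exact H0].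
    intros x Hx; apply H; lra. }
  rewrite turning_avg_scal_one in H1, H2 by exact H0.
  apply Rmult_le_reg_r with (2 * turning_avg kap (fun _ => 1) 0); [lra |].
  unfold Rdiv; rewrite Rmult_assoc, Rinv_l by lra. lra.
Qed.

Lemma Yright_agree_0 : Yright kap n 0 = - Yright kap (refl n) 0.
Proof.
  unfold Yright. assert (H0 : - kap < 0 < S) by lra.
  assert (HJ : turning_avg kap n 0 + turning_avg kap (refl n) 0 = 0).
  { unfold n, refl. rewrite turning_avg_minus by (exact m_cont || exact H0).
    rewrite (turning_avg_minus (refl m)) by (exact refl_m_cont || exact H0).
    unfold c, mean_weight. field. apply Rgt_not_eq, turning_avg_one_pos, H0. }
  replace (turning_avg kap n 0) with (- turning_avg kap (refl n) 0) by lra.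
  unfold Rdiv; ring.
Qed.

Lemma Yright_ode f s : UC (ivl (- S) S) 3 (fun _ => f) -> - kap < s < S ->
  exists l, is_derive (Yright kap f) s l /\
    (kap ^ 2 - s ^ 2) * l = 3 * s * Yright kap f s + f s.
Proof.
  intros Hf Hs.
  assert (Hm1 : Rmin s 0 <= s) by apply Rmin_l.
  assert (Hm2 : Rmin s 0 <= 0) by apply Rmin_r.
  assert (Hm3 : - kap < Rmin s 0) by (apply Rmin_glb_lt; lra).
  apply (Yright_derive kap S HS ((- kap + Rmin s 0) / 2)); [lra | | lra].
  apply UC_right; [lra |]. apply (UC_le _ 3); [lia | exact Hf].
Qed.

(* Both sides solve the same singular equation, whose homogeneous solutions are
   the multiples of [(kap^2 - s^2)^(-3/2)]; [mean_weight] makes them agree at 0. *)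
Lemma Yright_agree s : - kap < s < kap -> Yright kap n s = - Yright kap (refl n) (- s).
Proof.
  intros Hs.
  pose (D := fun s => Yright kap n s - - Yright kap (refl n) (- s)).
  pose (G := fun s => pow32 (kap ^ 2 - s ^ 2) * D s).
  assert (HG : forall x, - kap < x < kap -> is_derive G x 0).
  { intros x Hx.
    destruct (Yright_ode n x n_UC) as [l [Hl Hle]]; [lra |].
    destruct (Yright_ode (refl n) (- x) (UC_refl S 3 n n_UC)) as [l' [Hl' Hle']]; [lra |].
    assert (Hp : 0 < kap ^ 2 - x ^ 2) by nra.
    eapply is_derive_eq.
    - apply (is_derive_mult (fun s => pow32 (kap ^ 2 - s ^ 2))
        (fun s => Yright kap n s - - Yright kap (refl n) (- s))); [| |intros; apply Rmult_comm].
      + apply (is_derive_comp pow32 (fun s => kap ^ 2 - s ^ 2)); [apply is_derive_pow32, Hp |].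
        auto_derive; [exact Logic.I | reflexivity].
      + apply (is_derive_minus (Yright kap n) (fun s => - Yright kap (refl n) (- s)));
          [exact Hl |].
        apply (is_derive_opp (fun s => Yright kap (refl n) (- s))), is_derive_refl, Hl'.
    - unfold plus, mult, scal, minus, plus, opp, pow32; simpl; unfold mult; simpl.
      replace (kap * (kap * 1) - x * (x * 1)) with (kap ^ 2 - x ^ 2) by ring.
      unfold refl in Hle' at 2. rewrite Ropp_involutive in Hle'.
      set (t := sqrt (kap ^ 2 - x ^ 2)) in *.
      transitivity (t * ((kap ^ 2 - x ^ 2) * l - ((kap ^ 2 - (- x) ^ 2) * l')
        - 3 * x * (Yright kap n x - - Yright kap (refl n) (- x)))).
      + field.
      + rewrite Hle, Hle'. ring. }
  assert (HG0 : G 0 = 0).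
  { unfold G, D. rewrite Ropp_0, Yright_agree_0. ring. }
  assert (HGs : G s = 0).
  { rewrite <- HG0. destruct (Rtotal_order s 0) as [H|[->|H]]; [| reflexivity |].
    - destruct (MVT_is_derive G (fun _ => 0) s 0 H) as [x [Hx _]];
        [intros; apply HG; lra | lra].
    - destruct (MVT_is_derive G (fun _ => 0) 0 s H) as [x [Hx _]];
        [intros; apply HG; lra | lra]. }
  apply Rmult_integral in HGs. destruct HGs as [H|H].
  - exfalso. assert (Hp : 0 < kap ^ 2 - s ^ 2) by nra.
    pose proof (pow32_pos _ Hp). lra.
  - unfold D in H. lra.
Qed.

Lemma Ysol_right s : - kap < s -> Ysol kap n s = Yright kap n s.
Proof.
  intros Hs; unfold Ysol; destruct (Rlt_dec s 0) as [H|H]; [| reflexivity].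
  symmetry; apply Yright_agree; lra.
Qed.

Lemma Ysol_left s : s < kap -> Ysol kap n s = - Yright kap (refl n) (- s).
Proof.
  intros Hs; unfold Ysol; destruct (Rlt_dec s 0) as [H|H]; [reflexivity |].
  apply Yright_agree; lra.
Qed.

(** The branches agree on all of [(- kap, kap)], so two overlapping open intervals, each avoiding
    the bad turning point of its branch, cover everything including the gluing point. *)
Lemma Ysol_UC : UC (ivl (- S) S) 3 (fun _ => Ysol kap n).
Proof.
  apply (UC_sub (fun i x => ivl (- kap / 2) S i x \/ ivl (- S) (kap / 2) i x)).
  { intros i x [H1 H2]. destruct (Rlt_dec x 0) as [H|H]; [right | left]; split; lra. }
  apply UC_union; try apply open_ivl.
  - apply UC_ext with (fun _ => Yright kap n); [apply open_ivl | |].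
    + intros i x [H1 H2]; symmetry; apply Ysol_right; lra.
    + apply Yright_UC; [exact Hkap | exact HS | lra |]. apply UC_right; [lra | exact n_UC].
  - apply UC_ext with (fun _ s => - Yright kap (refl n) (- s)); [apply open_ivl | |].
    + intros i x [H1 H2]; symmetry; apply Ysol_left; lra.
    + apply (UC_opp _ _ (fun _ s => Yright kap (refl n) (- s))); [apply open_ivl |].
      apply (UC_comp (ivl (- S) (kap / 2)) (ivl (- kap / 2) S) 3
        (fun _ => Yright kap (refl n)) (fun _ s => - s)).
      * intros i x [H1 H2]; split; lra.
      * apply Yright_UC; [exact Hkap | exact HS | lra |].
        apply UC_right; [lra | apply UC_refl, n_UC].
      * apply UC_opp; [apply open_ivl |]. apply UC_id with S.
        intros i x [H1 H2]; apply Rabs_le; lra.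
Qed.

Lemma Ysol_ode s : - S < s < S -> exists l, is_derive (Ysol kap n) s l /\
    (kap ^ 2 - s ^ 2) * l = 3 * s * Ysol kap n s + n s.
Proof.
  intros Hs. destruct (Rlt_dec s 0) as [H|H].
  - destruct (Yright_ode (refl n) (- s) (UC_refl S 3 n n_UC)) as [l [Hl Hle]]; [lra |].
    unfold refl in Hle at 2. rewrite Ropp_involutive in Hle.
    exists l; split.
    + apply is_derive_ext_loc with (fun s => - Yright kap (refl n) (- s)).
      * apply filter_imp with (fun y => s - 1 < y < kap); [| apply open_interval; lra].
        intros y Hy; symmetry; apply Ysol_left; lra.
      * eapply is_derive_eq.
        -- apply (is_derive_opp (fun s => Yright kap (refl n) (- s))), is_derive_refl, Hl.
        -- unfold opp; simpl; ring.
    + rewrite Ysol_left by lra. replace (s ^ 2) with ((- s) ^ 2) by ring. rewrite Hle. ring.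
  - destruct (Yright_ode n s n_UC) as [l [Hl Hle]]; [lra |].
    exists l; split.
    + apply is_derive_ext_loc with (Yright kap n); [| exact Hl].
      apply filter_imp with (fun y => - kap < y < s + 1); [| apply open_interval; lra].
      intros y Hy; symmetry; apply Ysol_right; lra.
    + rewrite Ysol_right by lra. exact Hle.
Qed.

(** The quotient on the right is the one that [Bq_ge] compares with [Bq] at the edge of
    admissibility. A positive lower bound [m0] of [m] thus keeps [Y / c] a fixed proportion below
    what [Bq] can reach. *)
Lemma Ysol_upper m0 s : (forall x, - S < x < S -> m0 <= m x) -> - kap < s < S ->
  Ysol kap n s <= (c - m0) * (turning_avg kap (fun _ => 1) s / pow32 (s + kap)).
Proof.
  intros Hm0 Hs. rewrite Ysol_right by lra.
  assert (Hp : 0 < pow32 (s + kap)) by (apply pow32_pos; lra).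
  replace ((c - m0) * (turning_avg kap (fun _ => 1) s / pow32 (s + kap)))
    with (- ((m0 - c) * turning_avg kap (fun _ => 1) s) / pow32 (s + kap)) by (field; lra).
  apply Rmult_le_compat_r; [apply Rlt_le, Rinv_0_lt_compat, Hp |].
  apply Ropp_le_contravar. rewrite <- turning_avg_scal_one by exact Hs.
  apply turning_avg_le; [intros; apply continuous_const | | | exact Hs].
  - intros x Hx; apply (UC_cont _ _ _ n_UC tt x Hx).
  - intros x Hx; unfold n; specialize (Hm0 x Hx); lra.
Qed.

Lemma Ysol_lower m0 s : (forall x, - S < x < S -> m0 <= m x) -> - S < s < kap ->
  - Ysol kap n s <= (c - m0) * (turning_avg kap (fun _ => 1) (- s) / pow32 (- s + kap)).
Proof.
  intros Hm0 Hs. rewrite Ysol_left by lra. rewrite Ropp_involutive.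
  assert (Hs' : - kap < - s < S) by lra.
  assert (Hp : 0 < pow32 (- s + kap)) by (apply pow32_pos; lra).
  replace ((c - m0) * (turning_avg kap (fun _ => 1) (- s) / pow32 (- s + kap)))
    with (- ((m0 - c) * turning_avg kap (fun _ => 1) (- s)) / pow32 (- s + kap)) by (field; lra).
  apply Rmult_le_compat_r; [apply Rlt_le, Rinv_0_lt_compat, Hp |].
  apply Ropp_le_contravar. rewrite <- turning_avg_scal_one by exact Hs'.
  apply turning_avg_le; [intros; apply continuous_const | | | exact Hs'].
  - intros x Hx; apply (UC_cont _ _ _ (UC_refl S 3 n n_UC) tt x Hx).
  - intros x Hx; unfold n, refl. assert (Hx' : - S < - x < S) by lra.
    specialize (Hm0 (- x) Hx'); lra.
Qed.

End SymmetricInterval.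

(** To be applied with [k = 1, 2, 3] to [Y] and its first two derivatives; what matters is that the
    bound is free of [kap]. The value at a turning point, bounded from inside, starts the estimate
    outside, on the left after reflection. *)
Lemma turning_bound (kap S k N : R) (V V1 F f : R -> R) :
  0 < kap -> kap < S -> 0 < k ->
  (forall s, - S < s < S -> is_derive V s (V1 s)) ->
  (forall s, - S < s < S -> continuous V1 s) ->
  (forall s, - S < s < S -> is_derive F s (f s + (k ^ 2 - 1) * V s)) ->
  (forall s, - S < s < S -> (kap ^ 2 - s ^ 2) * V1 s = (2 * k + 1) * s * V s + F s) ->
  (forall s, - S < s < S -> Rabs (f s) <= N) ->
  forall s, - S < s < S -> Rabs (V s) <= N / (k * (k + 2)).
Proof.
  intros Hkap HS Hk HV HV1 HF Heq Hf.
  assert (Hin : forall s, - kap <= s <= kap -> Rabs (V s) <= N / (k * (k + 2))).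
  { intros s Hs; apply Rabs_le; split.
    - assert (H : - V s <= N / (k * (k + 2))); [| lra].
      apply (turning_max_principle kap k N (fun s => - V s) (fun s => - V1 s)
        (fun s => - F s) (fun s => - f s)); try assumption.
      + intros x Hx; apply (is_derive_opp V), HV; lra.
      + intros x Hx; eapply is_derive_eq; [apply (is_derive_opp F), HF; lra |].
        unfold opp; simpl; ring.
      + intros x Hx; assert (Hx' : - S < x < S) by lra. specialize (Heq x Hx'); lra.
      + intros x Hx; assert (Hx' : - S < x < S) by lra. specialize (Hf x Hx').
        apply Rabs_le_between in Hf; lra.
    - apply (turning_max_principle kap k N V V1 F f); try assumption;
        intros x Hx; assert (Hx' : - S < x < S) by lra; auto.
      specialize (Hf x Hx'). apply Rabs_le_between in Hf; lra. }
  assert (HN : N <= k * (k + 2) * (N / (k * (k + 2)))) by (apply Req_le; field; lra).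
  intros s Hs. destruct (Rle_dec s (- kap)) as [H1|H1]; [| destruct (Rle_dec s kap) as [H2|H2]].
  - destruct (Req_dec s (- kap)) as [->|Hne]; [apply Hin; lra |].
    replace s with (- - s) by ring.
    apply (turning_outside_bound kap (- s) S k N (N / (k * (k + 2)))
      (fun s => V (- s)) (fun s => - V1 (- s)) (fun s => - F (- s)) (fun s => f (- s)));
      try lra; try assumption.
    + intros x Hx; apply is_derive_refl, HV; lra.
    + intros x Hx; apply (continuous_opp (fun s => V1 (- s))).
      apply (continuous_comp Ropp V1).
      * apply @ex_derive_continuous; auto_derive; exact Logic.I.
      * apply HV1; lra.
    + intros x Hx; eapply is_derive_eq.
      * apply (is_derive_opp (fun s => F (- s))), is_derive_refl, HF; lra.
      * unfold opp; simpl; ring.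
    + intros x Hx.
      assert (Hx' : - S < - x < S) by lra. specialize (Heq (- x) Hx'). lra.
    + intros x Hx; apply Hf; lra.
    + apply Hin; lra.
  - apply Hin; lra.
  - apply (turning_outside_bound kap s S k N (N / (k * (k + 2))) V V1 F f);
      try lra; try assumption; try (intros x Hx; auto with real; fail).
    + intros x Hx; apply HV; lra.
    + intros x Hx; apply HV1; lra.
    + intros x Hx; apply HF; lra.
    + intros x Hx; apply Heq; lra.
    + intros x Hx; apply Hf; lra.
    + apply Hin; lra.
Qed.

(** The product rule puts an extra [2 s V1] on the right, so the coefficient (here the whole [k])
    runs through 3, 5, 7, which are [2 k + 1] for the [k = 1, 2, 3] of [turning_bound]: every
    derivative obeys an equation of the same form. *)
Lemma turning_differentiate (kap S k : R) (V V1 V2 F F1 : R -> R) :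
  (forall s, - S < s < S -> is_derive V s (V1 s)) ->
  (forall s, - S < s < S -> is_derive V1 s (V2 s)) ->
  (forall s, - S < s < S -> is_derive F s (F1 s)) ->
  (forall s, - S < s < S -> (kap ^ 2 - s ^ 2) * V1 s = k * s * V s + F s) ->
  forall s, - S < s < S -> (kap ^ 2 - s ^ 2) * V2 s = (k + 2) * s * V1 s + (F1 s + k * V s).
Proof.
  intros HV HV1 HF Heq s Hs.
  assert (H1 : is_derive (fun s => (kap ^ 2 - s ^ 2) * V1 s) s
     (- (2 * s) * V1 s + (kap ^ 2 - s ^ 2) * V2 s)).
  { apply (is_derive_mult (fun s => kap ^ 2 - s ^ 2) V1); [| apply HV1, Hs |
      intros; apply Rmult_comm].
    auto_derive; [exact Logic.I | ring]. }
  assert (H2 : is_derive (fun s => (kap ^ 2 - s ^ 2) * V1 s) s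
     (k * V s + k * s * V1 s + F1 s)).
  { apply is_derive_ext_loc with (fun s => k * s * V s + F s).
    - apply filter_imp with (fun y => - S < y < S); [| apply open_interval, Hs].
      intros y Hy; symmetry; apply Heq, Hy.
    - apply (is_derive_plus (fun s => k * s * V s) F); [| apply HF, Hs].
      apply (is_derive_mult (fun s => k * s) V); [| apply HV, Hs | intros; apply Rmult_comm].
      auto_derive; [exact Logic.I | ring]. }
  apply is_derive_unique in H1. apply is_derive_unique in H2. lra.
Qed.

(** * Bounds on [Y] that do not depend on [kap] *)

Section YBounds.
Context (kap S : R) (Hkap : 0 < kap) (HS : kap < S).
Context (m m1 m2 m3 : R -> R) (N1 N2 N3 : R).
Context (Hm : UC (ivl (- S) S) 3 (fun _ => m)).
Context (Hd1 : forall s, - S < s < S -> is_derive m s (m1 s)).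
Context (Hd2 : forall s, - S < s < S -> is_derive m1 s (m2 s)).
Context (Hd3 : forall s, - S < s < S -> is_derive m2 s (m3 s)).
Context (HN1 : forall s, - S < s < S -> Rabs (m1 s) <= N1).
Context (HN2 : forall s, - S < s < S -> Rabs (m2 s) <= N2).
Context (HN3 : forall s, - S < s < S -> Rabs (m3 s) <= N3).

Let Y : R -> R := Ysol kap (fun s => m s - mean_weight kap m).

Lemma Y_chain : exists Z V W : R -> R,
  (forall s, - S < s < S -> is_derive Y s (Z s)) /\
  (forall s, - S < s < S -> is_derive Z s (V s)) /\
  (forall s, - S < s < S -> is_derive V s (W s)) /\
  (forall s, - S < s < S -> continuous W s).
Proof.
  destruct (Ysol_UC kap S Hkap HS m Hm) as [_ [_ [Z [HZ [_ [_ [V [HV [_ [_ [W [HW HcW]]]]]]]]]]]].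
  exists (Z tt), (V tt), (W tt).
  split; [| split; [| split]]; intros s Hs.
  - apply (HZ tt s Hs).
  - apply (HV tt s Hs).
  - apply (HW tt s Hs).
  - apply (proj1 (proj2 HcW) tt s Hs).
Qed.

(** The right-hand sides for [Y], [Z], [V] are [n], [m1 + 3 Y] and [m2 + 8 Z]. The factors 0, 3, 8
    are [k^2 - 1], as the maximum principle expects, and the denominators 3, 8, 15 are [k (k + 2)].
    One derivative is lost: two orders of [Y] are controlled by three of [m]. *)
Lemma Y_bounds : exists Z V : R -> R,
  (forall s, - S < s < S -> is_derive Y s (Z s)) /\
  (forall s, - S < s < S -> is_derive Z s (V s)) /\
  (forall s, - S < s < S -> continuous V s) /\
  (forall s, - S < s < S ->
     (kap ^ 2 - s ^ 2) * Z s = 3 * s * Y s + (m s - mean_weight kap m)) /\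
  (forall s, - S < s < S -> Rabs (Y s) <= N1 / 3) /\
  (forall s, - S < s < S -> Rabs (Z s) <= N2 / 8) /\
  (forall s, - S < s < S -> Rabs (V s) <= N3 / 15).
Proof.
  destruct Y_chain as [Z [V [W [HZ [HV [HW HcW]]]]]].
  pose (n := fun s => m s - mean_weight kap m).
  assert (E1 : forall s, - S < s < S -> (kap ^ 2 - s ^ 2) * Z s = 3 * s * Y s + n s).
  { intros s Hs. destruct (Ysol_ode kap S Hkap HS m Hm s Hs) as [l [Hl Hle]].
    replace (Z s) with l; [exact Hle |].
    transitivity (Derive Y s); [symmetry |]; apply is_derive_unique; [exact Hl | apply HZ, Hs]. }
  assert (Hn : forall s, - S < s < S -> is_derive n s (m1 s)).
  { intros s Hs; eapply is_derive_eq.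
    - apply (is_derive_minus m (fun _ => mean_weight kap m)); [apply Hd1, Hs |].
      apply @is_derive_const.
    - unfold minus, plus, opp, zero; simpl; ring. }
  assert (E2 : forall s, - S < s < S ->
     (kap ^ 2 - s ^ 2) * V s = (3 + 2) * s * Z s + (m1 s + 3 * Y s))
    by (apply (turning_differentiate kap S 3 Y Z V n m1); assumption).
  assert (Hn2 : forall s, - S < s < S -> is_derive (fun s => m1 s + 3 * Y s) s (m2 s + 3 * Z s)).
  { intros s Hs; apply (is_derive_plus m1 (fun s => 3 * Y s)); [apply Hd2, Hs |].
    apply (is_derive_scal Y), HZ, Hs. }
  assert (E3 : forall s, - S < s < S ->
     (kap ^ 2 - s ^ 2) * W s = (3 + 2 + 2) * s * V s + (m2 s + 3 * Z s + (3 + 2) * Z s))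
    by (apply (turning_differentiate kap S (3 + 2) Z V W (fun s => m1 s + 3 * Y s)
         (fun s => m2 s + 3 * Z s)); assumption).
  assert (Hn3 : forall s, - S < s < S ->
     is_derive (fun s => m2 s + 8 * Z s) s (m3 s + 8 * V s)).
  { intros s Hs; apply (is_derive_plus m2 (fun s => 8 * Z s)); [apply Hd3, Hs |].
    apply (is_derive_scal Z), HV, Hs. }
  exists Z, V. split; [exact HZ | split; [exact HV | split; [| split; [exact E1 |]]]].
  { intros s Hs; apply (is_derive_cont V s (W s)), HW, Hs. }
  split; [| split]; intros s Hs.
  - replace (N1 / 3) with (N1 / (1 * (1 + 2))) by (f_equal; ring).
    apply (turning_bound kap S 1 N1 Y Z n m1); try assumption; try lra.
    + intros x Hx; apply (is_derive_cont Z x (V x)), HV, Hx.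
    + intros x Hx; eapply is_derive_eq; [apply Hn, Hx | as_R; ring].
    + intros x Hx; rewrite E1 by exact Hx; ring.
  - replace (N2 / 8) with (N2 / (2 * (2 + 2))) by (f_equal; ring).
    apply (turning_bound kap S 2 N2 Z V (fun s => m1 s + 3 * Y s) m2); try assumption; try lra.
    + intros x Hx; apply (is_derive_cont V x (W x)), HW, Hx.
    + intros x Hx; eapply is_derive_eq; [apply Hn2, Hx | as_R; ring].
    + intros x Hx; rewrite E2 by exact Hx; ring.
  - replace (N3 / 15) with (N3 / (3 * (3 + 2))) by (f_equal; ring).
    apply (turning_bound kap S 3 N3 V W (fun s => m2 s + 8 * Z s) m3); try assumption; try lra.
    + intros x Hx; eapply is_derive_eq; [apply Hn3, Hx | as_R; ring].
    + intros x Hx; rewrite E3 by exact Hx; ring.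
Qed.

(* [(kap^2 - s^2)^(3/2) Y] is a primitive of [sqrt (kap^2 - s^2) (m - c)]
   vanishing at both turning points. *)
Lemma sqrt_disc_integral :
  RInt (fun s => sqrt (kap ^ 2 - s ^ 2) * (m s - mean_weight kap m)) (- kap) kap = 0.
Proof.
  destruct Y_bounds as [Z [V [HZ [HV [_ [E1 _]]]]]].
  pose (n := fun s => m s - mean_weight kap m).
  pose (h := fun s => sqrt (kap ^ 2 - s ^ 2) * n s).
  pose (G := fun s => pow32 (kap ^ 2 - s ^ 2) * Y s).
  assert (Hch : forall x, - S < x < S -> continuous h x).
  { intros x Hx; apply (continuous_mult (fun s => sqrt (kap ^ 2 - s ^ 2)) n).
    - apply continuous_sqrt_comp, @ex_derive_continuous; auto_derive; exact Logic.I.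
    - apply (continuous_minus m (fun _ => mean_weight kap m)); [| apply continuous_const].
      apply (is_derive_cont m x (m1 x)), Hd1, Hx. }
  assert (Hex : forall x, - kap <= x <= kap -> ex_RInt h (- kap) x).
  { intros x Hx; apply ex_RInt_cont; [lra |]; intros w Hw; apply Hch; lra. }
  pose (H := fun s => G s - RInt h (- kap) s).
  assert (HHd : forall x, - kap < x < kap -> is_derive H x 0).
  { intros x Hx. assert (Hp : 0 < kap ^ 2 - x ^ 2) by nra.
    eapply is_derive_eq.
    - apply (is_derive_minus G (fun s => RInt h (- kap) s)).
      + unfold G; apply (is_derive_mult (fun s => pow32 (kap ^ 2 - s ^ 2)) Y);
          [| apply HZ; lra | intros; apply Rmult_comm].
        apply (is_derive_comp pow32 (fun s => kap ^ 2 - s ^ 2)); [apply is_derive_pow32, Hp |].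
        auto_derive; [exact Logic.I | reflexivity].
      + apply (is_derive_RInt h (fun s => RInt h (- kap) s) (- kap)).
        * apply filter_imp with (fun y => - kap < y < kap); [| apply open_interval, Hx].
          intros y Hy; apply (RInt_correct (V := R_CompleteNormedModule) h), Hex; lra.
        * apply Hch; lra.
    - unfold minus, plus, opp, mult, scal, pow32, h; simpl; unfold mult; simpl.
      replace (kap * (kap * 1) - x * (x * 1)) with (kap ^ 2 - x ^ 2) by ring.
      set (t := sqrt (kap ^ 2 - x ^ 2)).
      transitivity (t * ((kap ^ 2 - x ^ 2) * Z x - 3 * x * Y x - n x)); [field |].
      rewrite E1 by lra. unfold n; ring. }
  assert (HHc : forall x, - kap <= x <= kap -> continuity_pt H x).
  { intros x Hx; apply continuity_pt_filterlim.
    apply (continuous_minus G (fun s => RInt h (- kap) s)).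
    - apply (continuous_mult (fun s => pow32 (kap ^ 2 - s ^ 2)) Y).
      + apply (continuous_mult (fun s => kap ^ 2 - s ^ 2)
          (fun s => sqrt (kap ^ 2 - s ^ 2))).
        * apply @ex_derive_continuous; auto_derive; exact Logic.I.
        * apply continuous_sqrt_comp, @ex_derive_continuous; auto_derive; exact Logic.I.
      + apply (is_derive_cont Y x (Z x)), HZ; lra.
    - apply (is_derive_cont _ x (h x)). apply (is_derive_RInt h (fun s => RInt h (- kap) s) (- kap)).
      + apply filter_imp with (fun y => - S < y < S); [| apply open_interval; lra].
        intros y Hy; apply (RInt_correct (V := R_CompleteNormedModule) h).
        apply (ex_RInt_continuous (V := R_CompleteNormedModule)).
        intros z Hz; apply Hch. unfold Rmin, Rmax in Hz. destruct (Rle_dec (- kap) y); lra.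
      + apply Hch; lra. }
  destruct (MVT_gen H (- kap) kap (fun _ => 0)) as [x [_ Hx]].
  - intros x; rewrite Rmin_left, Rmax_right by lra; apply HHd.
  - intros x; rewrite Rmin_left, Rmax_right by lra; apply HHc.
  - unfold H, G, pow32 in Hx. rewrite RInt_point in Hx.
    unfold zero in Hx; simpl in Hx. unfold h, n in *. lra.
Qed.

End YBounds.

Lemma half_disc_integral kap : 0 < kap ->
  RInt (fun s => sqrt (kap ^ 2 - s ^ 2)) (- kap) kap = PI * kap ^ 2 / 2.
Proof.
  intros Hk.
  pose proof PI_RGT_0 as HPI.
  assert (Hmm : - (PI / 2) <= PI / 2) by lra.
  transitivity (RInt (fun t => scal (kap * cos t) (sqrt (kap ^ 2 - (kap * sin t) ^ 2)))
     (- (PI / 2)) (PI / 2)).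
  - symmetry.
    rewrite (RInt_comp (fun s => sqrt (kap ^ 2 - s ^ 2)) (fun t => kap * sin t)
      (fun t => kap * cos t)).
    + rewrite sin_neg, sin_PI2. f_equal; ring.
    + intros x _; apply continuous_sqrt_comp, @ex_derive_continuous; auto_derive; exact Logic.I.
    + intros x _; split; [auto_derive; [exact Logic.I | ring] |].
      apply @ex_derive_continuous; auto_derive; exact Logic.I.
  - transitivity (RInt (fun t => kap ^ 2 * (cos t) ^ 2) (- (PI / 2)) (PI / 2)).
    + apply RInt_ext; intros x Hx. rewrite Rmin_left, Rmax_right in Hx by exact Hmm.
      assert (Hc : 0 <= cos x) by (apply cos_ge_0; lra).
      replace (kap ^ 2 - (kap * sin x) ^ 2) with ((kap * cos x) ^ 2).
      * rewrite sqrt_pow2 by (apply Rmult_le_pos; lra).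
        unfold scal; simpl; unfold mult; simpl; ring.
      * pose proof (sin2_cos2 x) as H; unfold Rsqr in H. nra.
    + apply (is_RInt_unique (V := R_CompleteNormedModule)).
      replace (PI * kap ^ 2 / 2) with
        (kap ^ 2 * (PI / 2 + sin (PI / 2) * cos (PI / 2)) / 2 -
         kap ^ 2 * (- (PI / 2) + sin (- (PI / 2)) * cos (- (PI / 2))) / 2)
        by (rewrite sin_neg, cos_neg, sin_PI2, cos_PI2; field).
      apply (is_RInt_derive (fun t => kap ^ 2 * (t + sin t * cos t) / 2)
         (fun t => kap ^ 2 * (cos t) ^ 2)).
      * intros x _; auto_derive; [exact Logic.I |].
        pose proof (sin2_cos2 x) as H; unfold Rsqr in H. nra.
      * intros x _; apply @ex_derive_continuous; auto_derive; exact Logic.I.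
Qed.

(** * The implicit equation for q *)

(* For [z = s + (kap^2 - s^2) q], [rho kap s q] is the quotient of
   [kap^2 - z^2] by [kap^2 - s^2]; in this form it has no singularity. *)
Definition rho (kap s t : R) : R := (1 - s * t) ^ 2 - kap ^ 2 * t ^ 2.

(* The integral of [sqrt (rho kap s)] over [[0, q]]. Langer's equation
   [c^2 (kap^2 - z^2) z'^2 = (kap^2 - s^2) m^2] for [z = s + (kap^2 - s^2) q] amounts
   to [Bq kap s q = Y / c], where [(kap^2 - s^2) Y' = 3 s Y + m - c]. *)
Definition Bq (kap s q : R) : R := RInt (fun v => q * sqrt (rho kap s (q * v))) 0 1.

(** For [z = s + (kap^2 - s^2) q], the differences [kap - z] and [kap + z] are [kap - s] and
    [kap + s] times these two factors of [rho]. Keeping both above [eta] places [z] on the same side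
    of each turning point as [s]. The conditions are linear in [q], so the admissible values form a
    convex set. *)
Definition adm (kap eta s q : R) : Prop :=
  eta <= 1 - (kap + s) * q /\ eta <= 1 + (kap - s) * q.

Lemma rho_factor kap s t : rho kap s t = (1 - (kap + s) * t) * (1 + (kap - s) * t).
Proof. unfold rho; ring. Qed.

Lemma adm_scale kap eta s q v : eta <= 1 -> adm kap eta s q -> 0 <= v <= 1 ->
  adm kap eta s (q * v).
Proof.
  intros He [H1 H2] Hv; split.
  - assert (0 <= (1 - (kap + s) * q - eta) * v) by (apply Rmult_le_pos; lra).
    assert (0 <= (1 - eta) * (1 - v)) by (apply Rmult_le_pos; lra). lra.
  - assert (0 <= (1 + (kap - s) * q - eta) * v) by (apply Rmult_le_pos; lra).
    assert (0 <= (1 - eta) * (1 - v)) by (apply Rmult_le_pos; lra). lra.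
Qed.

Lemma adm_rho kap eta s q : 0 <= eta -> adm kap eta s q -> eta ^ 2 <= rho kap s q.
Proof.
  intros He [H1 H2]. rewrite rho_factor. simpl; rewrite Rmult_1_r.
  apply Rmult_le_compat; assumption.
Qed.

Lemma adm_sqrt_rho kap eta s q : 0 <= eta -> adm kap eta s q -> eta <= sqrt (rho kap s q).
Proof.
  intros He Ha. rewrite <- (sqrt_pow2 eta He). apply sqrt_le_1_alt, adm_rho; assumption.
Qed.

Lemma rho_2d kap (s q : R -> R -> R) x v :
  continuity_2d_pt s x v -> continuity_2d_pt q x v ->
  continuity_2d_pt (fun x v => rho kap (s x v) (q x v)) x v.
Proof.
  intros Hs Hq; unfold rho; simpl.
  assert (H : continuity_2d_pt (fun x v => 1 - s x v * q x v) x v).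
  { apply continuity_2d_pt_minus; [apply continuity_2d_pt_const |].
    apply continuity_2d_pt_mult; assumption. }
  apply continuity_2d_pt_minus.
  - apply continuity_2d_pt_mult; [exact H |].
    apply continuity_2d_pt_mult; [exact H | apply continuity_2d_pt_const].
  - apply continuity_2d_pt_mult; [apply continuity_2d_pt_const |].
    apply continuity_2d_pt_mult; [exact Hq |].
    apply continuity_2d_pt_mult; [exact Hq | apply continuity_2d_pt_const].
Qed.

Lemma sqrt_2d (f : R -> R -> R) x v : continuity_2d_pt f x v ->
  continuity_2d_pt (fun x v => sqrt (f x v)) x v.
Proof.
  intros H; apply (continuity_1d_2d_pt_comp sqrt f); [| exact H].
  apply continuity_pt_filterlim, continuous_sqrt.
Qed.

Lemma sqrt_rho_cont kap s x : continuous (fun t => sqrt (rho kap s t)) x.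
Proof.
  apply continuous_sqrt_comp. unfold rho. apply @ex_derive_continuous.
  auto_derive; exact Logic.I.
Qed.

Lemma Bq_cont kap s : continuity (Bq kap s).
Proof.
  intros q; apply continuity_pt_filterlim.
  apply (RInt_param_continuous (fun q v => q * sqrt (rho kap s (q * v))) q 1); [lra |].
  intros q' v _ _. apply continuity_2d_pt_mult; [apply continuity_2d_pt_id1 |].
  apply sqrt_2d, (rho_2d kap (fun _ _ => s) (fun q v => q * v)).
  - apply continuity_2d_pt_const.
  - apply continuity_2d_pt_mult; [apply continuity_2d_pt_id1 | apply continuity_2d_pt_id2].
Qed.

Lemma Bq_RInt kap s q : Bq kap s q = RInt (fun t => sqrt (rho kap s t)) 0 q.
Proof.
  transitivity (RInt (fun v => scal q ((fun t => sqrt (rho kap s t)) (q * v + 0))) 0 1).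
  - apply RInt_ext; intros v _. rewrite Rplus_0_r. reflexivity.
  - etransitivity.
    + apply (RInt_comp_lin (V := R_CompleteNormedModule) (fun t => sqrt (rho kap s t)) q 0 0 1).
      apply (ex_RInt_continuous (V := R_CompleteNormedModule)). intros z _. apply sqrt_rho_cont.
    + f_equal; ring.
Qed.

Lemma Bq_opp kap s q : Bq kap s (- q) = - Bq kap (- s) q.
Proof.
  unfold Bq.
  assert (Hex : ex_RInt (fun v => q * sqrt (rho kap (- s) (q * v))) 0 1).
  { apply ex_RInt_cont; [lra |]; intros w _.
    apply (continuity_2d_section (fun q v => q * sqrt (rho kap (- s) (q * v)))).
    apply continuity_2d_pt_mult; [apply continuity_2d_pt_id1 |].
    apply sqrt_2d, (rho_2d kap (fun _ _ => - s) (fun q v => q * v)).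
    - apply continuity_2d_pt_const.
    - apply continuity_2d_pt_mult; [apply continuity_2d_pt_id1 | apply continuity_2d_pt_id2]. }
  transitivity ((- 1) * RInt (fun v => q * sqrt (rho kap (- s) (q * v))) 0 1); [| ring].
  rewrite <- (RInt_scal_R _ 0 1 (-1) Hex). apply RInt_ext; intros v _.
  as_R. replace (rho kap s (- q * v)) with (rho kap (- s) (q * v)) by (unfold rho; ring). ring.
Qed.

Lemma adm_opp kap eta s q : adm kap eta (- s) q -> adm kap eta s (- q).
Proof. intros [H1 H2]; split; lra. Qed.

(* [wroot kap s w] interpolates between [sqrt (2 kap)] and [sqrt (s + kap)]. *)
Definition wroot (kap s w : R) : R := sqrt (kap + (s - kap) * w ^ 2 + kap).

Lemma wroot_cont kap s w : continuous (fun w => 2 * w ^ 2 * wroot kap s w) w.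
Proof.
  apply (continuous_mult (fun w => 2 * w ^ 2)); [apply continuous_sq2 |].
  apply continuous_sqrt_comp, @ex_derive_continuous; auto_derive; exact Logic.I.
Qed.

Lemma wroot_ex kap s a b : ex_RInt (fun w => 2 * w ^ 2 * wroot kap s w) a b.
Proof.
  apply (ex_RInt_continuous (V := R_CompleteNormedModule)); intros w _; apply wroot_cont.
Qed.

Lemma turning_avg_one kap s : turning_avg kap (fun _ => 1) s = RInt (fun w => 2 * w ^ 2 * wroot kap s w) 0 1.
Proof.
  unfold turning_avg, dilated, wroot. apply RInt_ext; intros w _. as_R. ring.
Qed.

Lemma RInt_poly (f F : R -> R) a b :
  (forall x, is_derive F x (f x)) -> (forall x, continuous f x) ->
  RInt f a b = F b - F a.
Proof.
  intros HF Hc; apply (is_RInt_unique (V := R_CompleteNormedModule)).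
  apply (is_RInt_derive F f); intros; auto.
Qed.

(** The square of [wroot] is [2 kap (1 - w^2) + (s + kap) w^2]. So [wroot] is at most [sqrt M2], for
    the larger end value [M2], and at least [1 - w^2] or [w] times it, according to which end is
    larger. This gives [2/3 e^3] above and [4/15] below, whose ratio is the constant [5/2]. *)
Lemma wroot_head kap s e : 0 < kap -> - kap < s -> 0 <= e <= 1 ->
  RInt (fun w => 2 * w ^ 2 * wroot kap s w) 0 e
  <= 5 / 2 * e ^ 3 * RInt (fun w => 2 * w ^ 2 * wroot kap s w) 0 1.
Proof.
  intros Hk Hs He.
  set (M2 := Rmax (2 * kap) (s + kap)).
  assert (HM1 : 2 * kap <= M2) by apply Rmax_l.
  assert (HM2 : s + kap <= M2) by apply Rmax_r.
  assert (HM : 0 < sqrt M2) by (apply sqrt_lt_R0; lra).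
  assert (Hup : RInt (fun w => 2 * w ^ 2 * wroot kap s w) 0 e <= 2 / 3 * e ^ 3 * sqrt M2).
  { replace (2 / 3 * e ^ 3 * sqrt M2) with (RInt (fun w => 2 * w ^ 2 * sqrt M2) 0 e).
    - apply RInt_le; [lra | apply wroot_ex | |].
      + apply (ex_RInt_continuous (V := R_CompleteNormedModule)); intros w _.
        apply @ex_derive_continuous; auto_derive; exact Logic.I.
      + intros w Hw. apply Rmult_le_compat_l; [nra |]. apply sqrt_le_1_alt.
        assert (Hw2 : 0 <= w ^ 2 <= 1) by (apply sq_01; lra). nra.
    - rewrite (RInt_poly _ (fun w => 2 / 3 * w ^ 3 * sqrt M2)).
      + simpl; field.
      + intros x; auto_derive; [exact Logic.I | field].
      + intros x; apply @ex_derive_continuous; auto_derive; exact Logic.I. }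
  assert (Hlow : 4 / 15 * sqrt M2 <= RInt (fun w => 2 * w ^ 2 * wroot kap s w) 0 1).
  { destruct (Rle_dec (s + kap) (2 * kap)) as [Hc|Hc].
    - assert (HMe : M2 = 2 * kap) by (apply Rmax_left; exact Hc).
      replace (4 / 15 * sqrt M2) with (RInt (fun w => 2 * w ^ 2 * (sqrt M2 * (1 - w ^ 2))) 0 1).
      + apply RInt_le; [lra | | apply wroot_ex |].
        * apply (ex_RInt_continuous (V := R_CompleteNormedModule)); intros w _.
          apply @ex_derive_continuous; auto_derive; exact Logic.I.
        * intros w Hw. apply Rmult_le_compat_l; [nra |].
          assert (Hw2 : 0 <= w ^ 2 <= 1) by (apply sq_01; lra).
          rewrite <- (sqrt_pow2 (1 - w ^ 2)) by lra. rewrite <- sqrt_mult_alt by lra.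
          apply sqrt_le_1_alt. rewrite HMe.
          assert (0 <= kap * ((1 - w ^ 2) * w ^ 2))
            by (apply Rmult_le_pos; [lra | apply Rmult_le_pos; lra]).
          assert (0 <= (s + kap) * w ^ 2) by (apply Rmult_le_pos; lra).
          lra.
      + rewrite (RInt_poly _ (fun w => sqrt M2 * (2 / 3 * w ^ 3 - 2 / 5 * w ^ 5))).
        * simpl; field.
        * intros x; auto_derive; [exact Logic.I | field].
        * intros x; apply @ex_derive_continuous; auto_derive; exact Logic.I.
    - assert (HMe : M2 = s + kap) by (apply Rmax_right; lra).
      apply Rle_trans with (1 / 2 * sqrt M2); [lra |].
      replace (1 / 2 * sqrt M2) with (RInt (fun w => 2 * w ^ 2 * (sqrt M2 * w)) 0 1).
      + apply RInt_le; [lra | | apply wroot_ex |].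
        * apply (ex_RInt_continuous (V := R_CompleteNormedModule)); intros w _.
          apply @ex_derive_continuous; auto_derive; exact Logic.I.
        * intros w Hw. apply Rmult_le_compat_l; [nra |].
          rewrite <- (sqrt_pow2 w) at 1 by lra. rewrite <- sqrt_mult_alt by lra.
          apply sqrt_le_1_alt. rewrite HMe. assert (Hw2 : 0 <= w ^ 2 <= 1) by (apply sq_01; lra).
          assert (0 <= kap * (1 - w ^ 2)) by (apply Rmult_le_pos; lra). lra.
      + rewrite (RInt_poly _ (fun w => sqrt M2 * (1 / 2 * w ^ 4))).
        * simpl; field.
        * intros x; auto_derive; [exact Logic.I | field].
        * intros x; apply @ex_derive_continuous; auto_derive; exact Logic.I. }
  assert (He3 : 0 <= e ^ 3) by (apply pow_le; lra).
  assert (e ^ 3 * (4 / 15 * sqrt M2) <= e ^ 3 * RInt (fun w => 2 * w ^ 2 * wroot kap s w) 0 1)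
    by (apply Rmult_le_compat_l; assumption).
  lra.
Qed.

(* The substitution [t = (1 - w^2) / (kap + s)]. *)
Lemma Bq_max kap s e : 0 < kap -> - kap < s -> 0 <= e <= 1 ->
  Bq kap s ((1 - e ^ 2) / (kap + s))
  = RInt (fun w => 2 * w ^ 2 * wroot kap s w) e 1 / pow32 (s + kap).
Proof.
  intros Hk Hs He. rewrite Bq_RInt.
  assert (HA : 0 < s + kap) by lra.
  assert (Hq : 0 < sqrt (s + kap)) by (apply sqrt_lt_R0, HA).
  transitivity (RInt (fun w => scal (- (2 * w) / (kap + s))
     ((fun t => sqrt (rho kap s t)) ((1 - w ^ 2) / (kap + s)))) 1 e).
  - rewrite (RInt_comp (fun t => sqrt (rho kap s t)) (fun w => (1 - w ^ 2) / (kap + s))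
      (fun w => - (2 * w) / (kap + s))).
    + f_equal; field; lra.
    + intros; apply sqrt_rho_cont.
    + intros x _; split; [auto_derive; [exact Logic.I | field; lra] |].
      apply @ex_derive_continuous; auto_derive; exact Logic.I.
  - rewrite <- opp_RInt_swap by (apply (ex_RInt_continuous (V := R_CompleteNormedModule));
      intros z _; apply (continuous_mult (fun w => - (2 * w) / (kap + s))
        (fun w => sqrt (rho kap s ((1 - w ^ 2) / (kap + s)))));
      [apply @ex_derive_continuous; auto_derive; exact Logic.I |
       apply continuous_sqrt_comp; unfold rho; apply @ex_derive_continuous;
       auto_derive; exact Logic.I]).
    match goal with |- _ = ?X / ?Y => replace (X / Y) with (/ Y * X) by (unfold Rdiv; ring) end.
    rewrite <- RInt_scal_R by apply wroot_ex.
    transitivity (RInt (fun w => opp (scal (- (2 * w) / (kap + s))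
      (sqrt (rho kap s ((1 - w ^ 2) / (kap + s)))))) e 1).
    { symmetry; apply (RInt_opp (V := R_CompleteNormedModule)).
      apply (ex_RInt_continuous (V := R_CompleteNormedModule));
      intros z _; apply (continuous_mult (fun w => - (2 * w) / (kap + s))
        (fun w => sqrt (rho kap s ((1 - w ^ 2) / (kap + s)))));
      [apply @ex_derive_continuous; auto_derive; exact Logic.I |
       apply continuous_sqrt_comp; unfold rho; apply @ex_derive_continuous;
       auto_derive; exact Logic.I]. }
    apply RInt_ext; intros w Hw. rewrite Rmin_left, Rmax_right in Hw by lra.
    unfold opp, scal; simpl; unfold mult; simpl. as_R.
    assert (Hr : sqrt (rho kap s ((1 - w * (w * 1)) / (kap + s)))
       = w * wroot kap s w / sqrt (s + kap)).
    { unfold wroot. rewrite <- (sqrt_pow2 w) at 3 by lra.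
      rewrite <- sqrt_mult_alt by apply pow2_ge_0. rewrite <- sqrt_div_alt by lra.
      f_equal. unfold rho. field. lra. }
    rewrite Hr. unfold pow32.
    field. split; [lra | lra].
Qed.

(** At this [q] the integral of [Bq_max] misses only the part over [[0, sqrt eta]], which by
    [wroot_head] is at most the proportion [5/2 eta^(3/2) <= 5/2 eta = mu] of the whole. *)
Lemma Bq_ge kap s mu eta : 0 < kap -> - kap < s -> 0 < mu <= 1 -> eta = 2 / 5 * mu ->
  (1 - mu) * (turning_avg kap (fun _ => 1) s / pow32 (s + kap))
  <= Bq kap s ((1 - eta) / (kap + s)).
Proof.
  intros Hk Hs Hmu Heta.
  assert (He : 0 <= sqrt eta <= 1).
  { split; [apply sqrt_pos |]. rewrite <- sqrt_1. apply sqrt_le_1_alt; lra. }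
  assert (Hee : sqrt eta ^ 2 = eta) by (apply pow2_sqrt; lra).
  replace ((1 - eta) / (kap + s)) with ((1 - sqrt eta ^ 2) / (kap + s)) by (rewrite Hee; reflexivity).
  rewrite Bq_max by assumption. rewrite turning_avg_one.
  assert (Hp : 0 < pow32 (s + kap)) by (apply pow32_pos; lra).
  unfold Rdiv at 1. rewrite <- Rmult_assoc.
  apply Rmult_le_compat_r; [apply Rlt_le, Rinv_0_lt_compat, Hp |].
  pose proof (wroot_head kap s (sqrt eta) Hk Hs He) as Hh.
  pose proof (RInt_Chasles (V := R_CompleteNormedModule) (fun w => 2 * w ^ 2 * wroot kap s w) 0
    (sqrt eta) 1 (wroot_ex kap s _ _) (wroot_ex kap s _ _)) as Hch.
  unfold plus in Hch; simpl in Hch.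
  assert (Hpos : 0 <= RInt (fun w => 2 * w ^ 2 * wroot kap s w) 0 1).
  { apply RInt_ge_0; [lra | apply wroot_ex |]. intros w Hw.
    apply Rmult_le_pos; [nra | apply sqrt_pos]. }
  assert (He3 : sqrt eta ^ 3 <= eta).
  { nra. }
  assert (5 / 2 * sqrt eta ^ 3 * RInt (fun w => 2 * w ^ 2 * wroot kap s w) 0 1
     <= mu * RInt (fun w => 2 * w ^ 2 * wroot kap s w) 0 1)
    by (apply Rmult_le_compat_r; lra).
  simpl in *. lra.
Qed.

Lemma q_exists_pos kap s mu eta y :
  0 < kap -> 0 < mu <= 1 -> eta = 2 / 5 * mu -> 0 <= y ->
  (- kap < s -> y <= (1 - mu) * (turning_avg kap (fun _ => 1) s / pow32 (s + kap))) ->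
  exists q, adm kap eta s q /\ Bq kap s q = y.
Proof.
  intros Hk Hmu Heta Hy HU.
  assert (Hq1 : exists q1, 0 <= q1 /\ adm kap eta s q1 /\ y <= Bq kap s q1).
  { destruct (Rlt_dec (- kap) s) as [Hs|Hs].
    (* The largest admissible value, at which the first factor of [rho] has shrunk to [eta]. *)
    - exists ((1 - eta) / (kap + s)).
      assert (Hq : 0 <= (1 - eta) / (kap + s))
        by (apply Rmult_le_pos; [lra | apply Rlt_le, Rinv_0_lt_compat; lra]).
      assert (He : (kap + s) * ((1 - eta) / (kap + s)) = 1 - eta) by (field; lra).
      split; [exact Hq | split; [split |]].
      + lra.
      + assert (0 <= 2 * kap * ((1 - eta) / (kap + s))) by (apply Rmult_le_pos; lra). lra.
      + eapply Rle_trans; [apply HU, Hs | apply Bq_ge; assumption].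
    (* For [s <= - kap] a nonnegative [q] is not limited: both factors of [rho] are at least 1, so
       [Bq kap s y >= y]. *)
    - exists y. split; [exact Hy | split; [split |]].
      + assert (0 <= - (kap + s) * y) by (apply Rmult_le_pos; lra). lra.
      + assert (0 <= (kap - s) * y) by (apply Rmult_le_pos; lra). lra.
      + replace y with (RInt (fun _ => y) 0 1) at 1
          by (rewrite RInt_const; unfold scal; simpl; unfold mult; simpl; ring).
        apply RInt_le; [lra | apply ex_RInt_const | |].
        * apply ex_RInt_cont; [lra |]; intros w _.
          apply (continuity_2d_section (fun q v => q * sqrt (rho kap s (q * v)))).
          apply continuity_2d_pt_mult; [apply continuity_2d_pt_id1 |].
          apply sqrt_2d, (rho_2d kap (fun _ _ => s) (fun q v => q * v)).
          -- apply continuity_2d_pt_const.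
          -- apply continuity_2d_pt_mult; [apply continuity_2d_pt_id1 | apply continuity_2d_pt_id2].
        * intros v Hv. rewrite <- (Rmult_1_r y) at 1. apply Rmult_le_compat_l; [exact Hy |].
          apply (adm_sqrt_rho kap 1 s (y * v)); [lra |]. 
          assert (0 <= y * v) by (apply Rmult_le_pos; lra). split.
          -- assert (0 <= - (kap + s) * (y * v)) by (apply Rmult_le_pos; lra). lra.
          -- assert (0 <= (kap - s) * (y * v)) by (apply Rmult_le_pos; lra). lra. }
  destruct Hq1 as [q1 [Hq1 [Ha Hy1]]].
  assert (H0 : Bq kap s 0 = 0).
  { rewrite Bq_RInt, RInt_point. reflexivity. }
  destruct (IVT_gen (Bq kap s) 0 q1 y (Bq_cont kap s)) as [q [Hq Hqy]].
  { rewrite H0. split.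
    - eapply Rle_trans; [apply Rmin_l | exact Hy].
    - eapply Rle_trans; [exact Hy1 | apply Rmax_r]. }
  rewrite Rmin_left, Rmax_right in Hq by exact Hq1.
  exists q; split; [| exact Hqy].
  destruct (Req_dec q1 0) as [Hz|Hz].
  - replace q with q1 by lra. exact Ha.
  - replace q with (q1 * (q / q1)) by (field; exact Hz).
    apply adm_scale; [lra | exact Ha |]. split.
    + apply Rmult_le_pos; [lra | apply Rlt_le, Rinv_0_lt_compat; lra].
    + apply Rmult_le_reg_r with q1; [lra |]. unfold Rdiv; rewrite Rmult_assoc, Rinv_l; lra.
Qed.

Lemma q_exists kap s mu eta y :
  0 < kap -> 0 < mu <= 1 -> eta = 2 / 5 * mu ->
  (- kap < s -> y <= (1 - mu) * (turning_avg kap (fun _ => 1) s / pow32 (s + kap))) ->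
  (s < kap -> - y <= (1 - mu) * (turning_avg kap (fun _ => 1) (- s) / pow32 (- s + kap))) ->
  exists q, adm kap eta s q /\ Bq kap s q = y.
Proof.
  intros Hk Hmu Heta HU HL. destruct (Rle_dec 0 y) as [Hy|Hy].
  - apply (q_exists_pos kap s mu eta y); assumption.
  - destruct (q_exists_pos kap (- s) mu eta (- y)) as [q [Ha Hq]]; try assumption; [lra | |].
    + intros Hs; apply HL; lra.
    + exists (- q); split; [apply adm_opp, Ha |]. rewrite Bq_opp, Hq. ring.
Qed.

(** Where [D] vanishes, [g] need only be continuous. This is Caratheodory's form of the derivative;
    it serves for the functions defined implicitly in [q_derive] and [morse_coordinate]. *)
Lemma is_derive_mult_zero (D g : R -> R) x d :
  is_derive D x d -> D x = 0 -> continuous g x -> is_derive (fun y => D y * g y) x (d * g x).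
Proof.
  intros HD H0 Hg. apply is_derive_Reals in HD. apply is_derive_Reals.
  intros e He.
  assert (Hcg : continuity_pt g x) by (apply continuity_pt_filterlim, Hg).
  rewrite continuity_pt_locally in Hcg.
  pose proof (Rabs_pos d) as Hdp. pose proof (Rabs_pos (g x)) as Hgp.
  assert (He1 : 0 < Rmin 1 (e / 2 / (Rabs d + 1))).
  { apply Rmin_glb_lt; [lra |]. apply Rmult_lt_0_compat; [lra | apply Rinv_0_lt_compat; lra]. }
  destruct (Hcg (mkposreal _ He1)) as [r1 Hr1]; simpl in Hr1.
  assert (He2 : 0 < e / 2 / (Rabs (g x) + 1)).
  { apply Rmult_lt_0_compat; [lra | apply Rinv_0_lt_compat; lra]. }
  destruct (HD _ He2) as [r2 Hr2].
  assert (Hr : 0 < Rmin r1 r2) by (apply Rmin_glb_lt; apply cond_pos).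
  exists (mkposreal _ Hr); intros h Hh0 Hh; simpl in Hh.
  assert (Hh1 : Rabs h < r1) by (eapply Rlt_le_trans; [exact Hh | apply Rmin_l]).
  assert (Hh2 : Rabs h < r2) by (eapply Rlt_le_trans; [exact Hh | apply Rmin_r]).
  specialize (Hr2 h Hh0 Hh2). rewrite H0 in *.
  assert (Hb : Rabs (g (x + h) - g x) < Rmin 1 (e / 2 / (Rabs d + 1))).
  { apply Hr1. unfold ball; simpl. unfold AbsRing_ball, abs, minus, plus, opp; simpl.
    replace (x + h + - x) with h by ring. exact Hh1. }
  assert (Hb1 : Rabs (g (x + h) - g x) < 1) by (eapply Rlt_le_trans; [exact Hb | apply Rmin_l]).
  assert (Hb2 : Rabs (g (x + h) - g x) < e / 2 / (Rabs d + 1))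
    by (eapply Rlt_le_trans; [exact Hb | apply Rmin_r]).
  assert (Hgh : Rabs (g (x + h)) <= Rabs (g x) + 1).
  { replace (g (x + h)) with (g x + (g (x + h) - g x)) by ring.
    eapply Rle_trans; [apply Rabs_triang | lra]. }
  replace ((D (x + h) * g (x + h) - 0 * g x) / h - d * g x)
    with (((D (x + h) - 0) / h - d) * g (x + h) + d * (g (x + h) - g x)) by (field; exact Hh0).
  eapply Rle_lt_trans; [apply Rabs_triang |]. rewrite !Rabs_mult.
  assert (A1 : Rabs ((D (x + h) - 0) / h - d) * Rabs (g (x + h))
     <= e / 2 / (Rabs (g x) + 1) * (Rabs (g x) + 1)).
  { apply Rmult_le_compat; try apply Rabs_pos; lra. }
  assert (A2 : Rabs d * Rabs (g (x + h) - g x) <= Rabs d * (e / 2 / (Rabs d + 1))).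
  { apply Rmult_le_compat_l; lra. }
  assert (A3 : e / 2 / (Rabs (g x) + 1) * (Rabs (g x) + 1) = e / 2) by (field; lra).
  assert (A4 : Rabs d * (e / 2 / (Rabs d + 1)) < e / 2).
  { apply Rmult_lt_reg_r with (Rabs d + 1); [lra |].
    replace (Rabs d * (e / 2 / (Rabs d + 1)) * (Rabs d + 1)) with (Rabs d * (e / 2)) by (field; lra).
    nra. }
  lra.
Qed.

(** * Implicit differentiation of the equation for [q] *)

Definition beta (kap s t : R) : R := - (t * (1 - s * t)) / sqrt (rho kap s t).

(** The partial derivative of [Bq] in [s], obtained under the integral from [beta], that of
    [sqrt (rho kap s t)]. *)
Definition Bs (kap s q : R) : R := RInt (fun v => q * beta kap s (q * v)) 0 1.

Lemma adm_slack kap eta s s' q : adm kap eta s q -> Rabs (s' - s) * Rabs q <= eta / 2 ->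
  adm kap (eta / 2) s' q.
Proof.
  intros [H1 H2] H. rewrite <- Rabs_mult in H. apply Rabs_le_between in H. split; lra.
Qed.

Lemma adm_weaken kap eta eta' s q : eta' <= eta -> adm kap eta s q -> adm kap eta' s q.
Proof. intros H [H1 H2]; split; lra. Qed.

Lemma adm_convex kap eta s q0 q1 v : adm kap eta s q0 -> adm kap eta s q1 -> 0 <= v <= 1 ->
  adm kap eta s (q0 + (q1 - q0) * v).
Proof.
  intros [H1 H2] [H3 H4] Hv; split.
  - assert (0 <= (1 - (kap + s) * q0 - eta) * (1 - v)) by (apply Rmult_le_pos; lra).
    assert (0 <= (1 - (kap + s) * q1 - eta) * v) by (apply Rmult_le_pos; lra). lra.
  - assert (0 <= (1 + (kap - s) * q0 - eta) * (1 - v)) by (apply Rmult_le_pos; lra).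
    assert (0 <= (1 + (kap - s) * q1 - eta) * v) by (apply Rmult_le_pos; lra). lra.
Qed.

Lemma adm_rho_pos kap eta s q : 0 < eta -> adm kap eta s q -> 0 < rho kap s q.
Proof.
  intros He Ha. pose proof (adm_rho kap eta s q (Rlt_le _ _ He) Ha). nra.
Qed.

Lemma adm_near kap eta s q : 0 < eta -> adm kap eta s q ->
  exists r, 0 < r /\ forall s', Rabs (s' - s) < r -> adm kap (eta / 2) s' q.
Proof.
  intros He Ha. pose proof (Rabs_pos q) as Hq.
  exists (eta / 2 / (Rabs q + 1)). split.
  - apply Rmult_lt_0_compat; [lra | apply Rinv_0_lt_compat; lra].
  - intros s' Hs. apply adm_slack with s; [exact Ha |].
    apply Rle_trans with (eta / 2 / (Rabs q + 1) * Rabs q).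
    + apply Rmult_le_compat_r; lra.
    + apply Rmult_le_reg_r with (Rabs q + 1); [lra |].
      replace (eta / 2 / (Rabs q + 1) * Rabs q * (Rabs q + 1)) with (eta / 2 * Rabs q)
        by (field; lra). nra.
Qed.

Lemma beta_2d kap (s q : R -> R -> R) x v :
  continuity_2d_pt s x v -> continuity_2d_pt q x v -> 0 < rho kap (s x v) (q x v) ->
  continuity_2d_pt (fun x v => beta kap (s x v) (q x v)) x v.
Proof.
  intros Hs Hq Hp; unfold beta, Rdiv.
  apply continuity_2d_pt_mult.
  - apply continuity_2d_pt_opp, continuity_2d_pt_mult; [exact Hq |].
    apply continuity_2d_pt_minus; [apply continuity_2d_pt_const |].
    apply continuity_2d_pt_mult; assumption.
  - apply continuity_2d_pt_inv; [apply sqrt_2d, rho_2d; assumption |].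
    apply Rgt_not_eq, sqrt_lt_R0, Hp.
Qed.

Lemma sqrt_rho_derive kap s t : 0 < rho kap s t ->
  is_derive (fun s => sqrt (rho kap s t)) s (beta kap s t).
Proof.
  intros Hp. assert (0 < sqrt (rho kap s t)) by (apply sqrt_lt_R0, Hp).
  replace (beta kap s t) with ((- (2 * t * (1 - s * t))) / (2 * sqrt (rho kap s t)))
    by (unfold beta; field; lra).
  apply (is_derive_sqrt (fun s => rho kap s t)); [unfold rho; auto_derive; [exact Logic.I | ring] | exact Hp].
Qed.

Lemma Bq_derive_s kap eta s q : 0 < eta <= 1 -> adm kap eta s q ->
  is_derive (fun s => Bq kap s q) s (Bs kap s q).
Proof.
  intros He Ha. destruct (adm_near kap eta s q (proj1 He) Ha) as [r [Hr Hr']].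
  assert (Hpos : forall s' v, Rabs (s' - s) < r -> 0 <= v <= 1 -> 0 < rho kap s' (q * v)).
  { intros s' v Hs Hv. apply adm_rho_pos with (eta / 2); [lra |].
    apply adm_scale; [lra | apply Hr', Hs | exact Hv]. }
  apply (RInt_param_derive (fun s v => q * sqrt (rho kap s (q * v)))
    (fun s v => q * beta kap s (q * v)) s r Hr).
  - intros s' v Hs Hv. apply (is_derive_scal (fun s => sqrt (rho kap s (q * v)))).
    apply sqrt_rho_derive, Hpos; assumption.
  - intros s' v Hs Hv.
    apply (continuity_2d_section (fun q v => q * sqrt (rho kap s' (q * v)))).
    apply continuity_2d_pt_mult; [apply continuity_2d_pt_id1 |].
    apply sqrt_2d, (rho_2d kap (fun _ _ => s') (fun q v => q * v)).
    + apply continuity_2d_pt_const.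
    + apply continuity_2d_pt_mult; [apply continuity_2d_pt_id1 | apply continuity_2d_pt_id2].
  - intros v Hv. apply continuity_2d_pt_mult; [apply continuity_2d_pt_const |].
    apply (beta_2d kap (fun s _ => s) (fun _ v => q * v)).
    + apply continuity_2d_pt_id1.
    + apply continuity_2d_pt_mult; [apply continuity_2d_pt_const | apply continuity_2d_pt_id2].
    + apply Hpos; [rewrite Rminus_diag, Rabs_R0; exact Hr | exact Hv].
Qed.

Lemma sqrt_rho_seg_ex kap s q0 q1 : ex_RInt (fun v => sqrt (rho kap s (q0 + (q1 - q0) * v))) 0 1.
Proof.
  apply ex_RInt_cont; [lra |]; intros w _.
  apply continuous_sqrt_comp. unfold rho. apply @ex_derive_continuous.
  auto_derive; exact Logic.I.
Qed.

Lemma Bq_diff kap s q0 q1 : Bq kap s q1 - Bq kap s q0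
  = (q1 - q0) * RInt (fun v => sqrt (rho kap s (q0 + (q1 - q0) * v))) 0 1.
Proof.
  rewrite !Bq_RInt.
  assert (Hex : forall a b, ex_RInt (fun t => sqrt (rho kap s t)) a b).
  { intros a b; apply (ex_RInt_continuous (V := R_CompleteNormedModule)); intros z _.
    apply sqrt_rho_cont. }
  pose proof (RInt_Chasles (V := R_CompleteNormedModule) _ 0 q0 q1 (Hex _ _) (Hex _ _)) as Hc.
  unfold plus in Hc; simpl in Hc.
  pose proof (RInt_comp_lin (V := R_CompleteNormedModule) (fun t => sqrt (rho kap s t))
    (q1 - q0) q0 0 1 (Hex _ _)) as Hl.
  replace ((q1 - q0) * 0 + q0) with q0 in Hl by ring.
  replace ((q1 - q0) * 1 + q0) with q1 in Hl by ring.
  rewrite <- Hl in Hc. rewrite <- Hc.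
  rewrite <- RInt_scal_R by apply sqrt_rho_seg_ex.
  match goal with |- ?A + ?B - ?A = ?D => transitivity B; [as_R; ring |] end.
  apply RInt_ext; intros v _. as_R.
  rewrite (Rplus_comm ((q1 - q0) * v)). reflexivity.
Qed.

(** By convexity the whole segment is admissible, and there [sqrt rho >= eta]. So [Bq kap s]
    increases with slope at least [eta], which yields the bound on [q], its continuity and its
    derivative. *)
Lemma seg_ge kap eta s q0 q1 : 0 < eta -> adm kap eta s q0 -> adm kap eta s q1 ->
  eta <= RInt (fun v => sqrt (rho kap s (q0 + (q1 - q0) * v))) 0 1.
Proof.
  intros He H0 H1.
  replace eta with (RInt (fun _ => eta) 0 1) at 1
    by (rewrite RInt_const; unfold scal; simpl; unfold mult; simpl; ring).
  apply RInt_le; [lra | apply ex_RInt_const | apply sqrt_rho_seg_ex |].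
  intros v Hv. apply adm_sqrt_rho; [lra |]. apply adm_convex; [exact H0 | exact H1 | lra].
Qed.

Section ImplicitFunction.
Context (kap eta S : R) (Heta : 0 < eta <= 1).
Context (q Yh Yh1 : R -> R).
Context (Hadm : forall s, - S < s < S -> adm kap eta s (q s)).
Context (HB : forall s, - S < s < S -> Bq kap s (q s) = Yh s).
Context (HY : forall s, - S < s < S -> is_derive Yh s (Yh1 s)).

Lemma q_bound s : - S < s < S -> eta * Rabs (q s) <= Rabs (Yh s).
Proof.
  intros Hs. assert (H0 : adm kap eta s 0) by (split; lra).
  pose proof (seg_ge kap eta s 0 (q s) (proj1 Heta) H0 (Hadm s Hs)) as Hge.
  pose proof (Bq_diff kap s 0 (q s)) as Hd.
  assert (HB0 : Bq kap s 0 = 0) by (rewrite Bq_RInt, RInt_point; reflexivity).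
  rewrite HB0, HB in Hd by exact Hs. rewrite !Rminus_0_r in Hd. rewrite Hd, Rabs_mult.
  rewrite Rminus_0_r in Hge. rewrite Rmult_comm. apply Rmult_le_compat_l; [apply Rabs_pos |].
  eapply Rle_trans; [exact Hge | apply Rle_abs].
Qed.

(** An exact form of the implicit function theorem: the left side is differentiable in [s], and the
    mean of [sqrt rho] on the right is bounded below. Halving [eta] keeps the fixed value [q s0]
    admissible for [s] near [s0]. *)
Lemma q_diff s0 : - S < s0 < S -> exists r, 0 < r /\ forall s, Rabs (s - s0) < r ->
  - S < s < S /\ adm kap (eta / 2) s (q s0) /\ adm kap (eta / 2) s (q s) /\
  Yh s - Bq kap s (q s0)
  = (q s - q s0) * RInt (fun v => sqrt (rho kap s (q s0 + (q s - q s0) * v))) 0 1.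
Proof.
  intros Hs0. destruct (adm_near kap eta s0 (q s0) (proj1 Heta) (Hadm s0 Hs0)) as [r [Hr Hr']].
  destruct (near_ivl (- S) S s0 Hs0) as [r2 [Hr2 Hr2']].
  exists (Rmin r r2); split; [apply Rmin_glb_lt; assumption |].
  intros s Hs.
  assert (Hs1 : Rabs (s - s0) < r) by (eapply Rlt_le_trans; [exact Hs | apply Rmin_l]).
  assert (Hs2 : Rabs (s - s0) < r2) by (eapply Rlt_le_trans; [exact Hs | apply Rmin_r]).
  specialize (Hr2' s Hs2). split; [exact Hr2' |]. split; [apply Hr', Hs1 |].
  split; [apply adm_weaken with eta; [lra | apply Hadm, Hr2'] |].
  rewrite <- HB by exact Hr2'. apply Bq_diff.
Qed.

Lemma q_cont s0 : - S < s0 < S -> continuous q s0.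
Proof.
  intros Hs0. destruct (q_diff s0 Hs0) as [r [Hr H]].
  assert (Hc : continuity_pt (fun s => Yh s - Bq kap s (q s0)) s0).
  { apply continuity_pt_filterlim, (continuous_minus Yh (fun s => Bq kap s (q s0))).
    - apply (is_derive_cont Yh s0 (Yh1 s0)), HY, Hs0.
    - apply (is_derive_cont _ s0 (Bs kap s0 (q s0))), (Bq_derive_s kap eta); auto. }
  rewrite continuity_pt_locally in Hc.
  apply continuity_pt_filterlim, continuity_pt_locally; intros e.
  assert (He : 0 < eta / 2 * e) by (apply Rmult_lt_0_compat; [lra | apply cond_pos]).
  destruct (Hc (mkposreal _ He)) as [d Hd]; simpl in Hd.
  assert (Hm : 0 < Rmin d r) by (apply Rmin_glb_lt; [apply cond_pos | exact Hr]).
  exists (mkposreal _ Hm). intros s Hs.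
  assert (Hs' : Rabs (s - s0) < Rmin d r) by exact Hs.
  assert (Hs1 : Rabs (s - s0) < d) by (eapply Rlt_le_trans; [exact Hs' | apply Rmin_l]).
  assert (Hs2 : Rabs (s - s0) < r) by (eapply Rlt_le_trans; [exact Hs' | apply Rmin_r]).
  specialize (Hd s Hs1). rewrite HB, Rminus_diag, Rminus_0_r in Hd by exact Hs0.
  destruct (H s Hs2) as [Hss [Ha0 [Ha1 Heq]]]. rewrite Heq, Rabs_mult in Hd.
  assert (He2 : 0 < eta / 2) by lra.
  pose proof (seg_ge kap (eta / 2) s (q s0) (q s) He2 Ha0 Ha1) as Hge.
  rewrite (Rabs_right (RInt _ _ _)) in Hd by lra.
  apply Rmult_lt_reg_l with (eta / 2); [lra |].
  eapply Rle_lt_trans; [| exact Hd]. rewrite Rmult_comm.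
  apply Rmult_le_compat_l; [apply Rabs_pos | exact Hge].
Qed.

Lemma q_derive s0 : - S < s0 < S ->
  is_derive q s0 ((Yh1 s0 - Bs kap s0 (q s0)) * / sqrt (rho kap s0 (q s0))).
Proof.
  intros Hs0. destruct (q_diff s0 Hs0) as [r [Hr H]].
  set (th := fun s => RInt (fun v => sqrt (rho kap s (q s0 + (q s - q s0) * v))) 0 1).
  assert (He2 : 0 < eta / 2) by lra.
  assert (Hth : forall s, Rabs (s - s0) < r -> eta / 2 <= th s).
  { intros s Hs. destruct (H s Hs) as [Hss [Ha0 [Ha1 Heq]]].
    apply seg_ge; assumption. }
  assert (Hss : Rabs (s0 - s0) < r) by (rewrite Rminus_diag, Rabs_R0; exact Hr).
  assert (Hth0 : th s0 = sqrt (rho kap s0 (q s0))).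
  { transitivity (RInt (fun _ => sqrt (rho kap s0 (q s0))) 0 1).
    - apply RInt_ext; intros v _. do 2 f_equal. ring.
    - rewrite RInt_const; unfold scal; simpl; unfold mult; simpl; ring. }
  assert (Hcth : continuous th s0).
  { apply (RInt_param_continuous (fun s v => sqrt (rho kap s (q s0 + (q s - q s0) * v))) s0 r Hr).
    intros s v Hs Hv. destruct (H s Hs) as [Hs1 _].
    apply sqrt_2d, (rho_2d kap (fun s _ => s) (fun s v => q s0 + (q s - q s0) * v)).
    - apply continuity_2d_pt_id1.
    - apply continuity_2d_pt_plus; [apply continuity_2d_pt_const |].
      apply continuity_2d_pt_mult; [| apply continuity_2d_pt_id2].
      apply continuity_2d_pt_minus; [| apply continuity_2d_pt_const].
      apply (continuous_2d_fst q), q_cont, Hs1. }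
  (* The numerator is differentiable and vanishes at [s0], while [th] is only known to be
     continuous: the situation of [is_derive_mult_zero]. *)
  apply is_derive_ext_loc with (fun s => (Yh s - Bq kap s (q s0)) * / th s + q s0).
  { exists (mkposreal r Hr). intros s Hs. assert (Hs' : Rabs (s - s0) < r) by exact Hs.
    destruct (H s Hs') as [_ [_ [_ Heq]]]. specialize (Hth s Hs'). fold (th s) in Heq.
    rewrite Heq. as_R. field. lra. }
  eapply is_derive_eq.
  - apply (is_derive_plus (fun s => (Yh s - Bq kap s (q s0)) * / th s) (fun _ => q s0));
      [| apply @is_derive_const].
    apply (is_derive_mult_zero (fun s => Yh s - Bq kap s (q s0)) (fun s => / th s)).
    + apply (is_derive_minus Yh (fun s => Bq kap s (q s0))); [apply HY, Hs0 |].
      apply (Bq_derive_s kap eta); auto.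
    + rewrite HB by exact Hs0. ring.
    + apply (continuous_comp th Rinv); [exact Hcth |].
      apply continuous_Rinv. specialize (Hth s0 Hss). lra.
  - unfold plus, minus, plus, opp, zero; simpl. rewrite Hth0. as_R. ring.
Qed.

End ImplicitFunction.

(* Integrating [d/dv (sqrt rho (1 - 2 s q v))] over [[0, 1]]. *)
Lemma Bs_identity kap eta s q : 0 < eta <= 1 -> adm kap eta s q ->
  (kap ^ 2 - s ^ 2) * Bs kap s q
  = 3 * s * Bq kap s q + sqrt (rho kap s q) * (1 - 2 * s * q) - 1.
Proof.
  intros He Ha.
  assert (Hpos : forall v, 0 <= v <= 1 -> 0 < rho kap s (q * v)).
  { intros v Hv. apply adm_rho_pos with eta; [lra |]. apply adm_scale; [lra | exact Ha | exact Hv]. }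
  assert (Hcb : forall v, 0 <= v <= 1 -> continuous (fun v => q * beta kap s (q * v)) v).
  { intros v Hv. apply (continuity_2d_section (fun s v => q * beta kap s (q * v))).
    apply continuity_2d_pt_mult; [apply continuity_2d_pt_const |].
    apply (beta_2d kap (fun s _ => s) (fun _ v => q * v)).
    - apply continuity_2d_pt_id1.
    - apply continuity_2d_pt_mult; [apply continuity_2d_pt_const | apply continuity_2d_pt_id2].
    - apply Hpos, Hv. }
  assert (Hcr : forall v, continuous (fun v => q * sqrt (rho kap s (q * v))) v).
  { intros v. apply (continuous_scal_r q (fun v => sqrt (rho kap s (q * v)))).
    apply continuous_sqrt_comp. unfold rho. apply @ex_derive_continuous.
    auto_derive; exact Logic.I. }
  assert (E1 : ex_RInt (fun v => q * beta kap s (q * v)) 0 1) by (apply ex_RInt_cont; [lra | auto]).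
  assert (E2 : ex_RInt (fun v => q * sqrt (rho kap s (q * v))) 0 1)
    by (apply ex_RInt_cont; [lra | auto]).
  pose (G := fun v => sqrt (rho kap s (q * v)) * (1 - 2 * s * (q * v))).
  pose (g := fun v => (kap ^ 2 - s ^ 2) * (q * beta kap s (q * v))
                      + - (3 * s) * (q * sqrt (rho kap s (q * v)))).
  assert (HI : is_RInt g 0 1 (G 1 - G 0)).
  { apply (is_RInt_derive G g); intros v Hv; rewrite Rmin_left, Rmax_right in Hv by lra.
    - specialize (Hpos v Hv).
      assert (Hq : 0 < sqrt (rho kap s (q * v))) by (apply sqrt_lt_R0, Hpos).
      assert (Hqq : sqrt (rho kap s (q * v)) * sqrt (rho kap s (q * v)) = rho kap s (q * v))
        by (apply sqrt_sqrt; lra).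
      eapply is_derive_eq.
      + apply (is_derive_mult (fun v => sqrt (rho kap s (q * v))) (fun v => 1 - 2 * s * (q * v)) v
          ((- (2 * s * q) * (1 - s * (q * v)) - 2 * kap ^ 2 * q * (q * v))
             / (2 * sqrt (rho kap s (q * v)))) (- (2 * s * q))).
        * apply (is_derive_sqrt (fun v => rho kap s (q * v))); [| exact Hpos].
          unfold rho; auto_derive; [exact Logic.I | ring].
        * auto_derive; [exact Logic.I | ring].
        * intros; apply Rmult_comm.
      + unfold g, beta, plus, mult; simpl. set (t := sqrt (rho kap s (q * v))) in *.
        unfold rho in Hqq. as_R.
        apply Rmult_eq_reg_r with t; [| lra].
        transitivity ((- (2 * s * q) * (1 - s * (q * v)) - 2 * kap ^ 2 * q * (q * v)) / 2
          * (1 - 2 * s * (q * v)) - 2 * s * q * (t * t)); [field; lra |].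
        transitivity ((kap ^ 2 - s ^ 2) * (q * (- (q * v * (1 - s * (q * v)))))
          - 3 * s * q * (t * t)); [rewrite Hqq; field | field; lra].
    - apply (continuous_plus (fun v => (kap ^ 2 - s ^ 2) * (q * beta kap s (q * v)))).
      + apply (continuous_scal_r (kap ^ 2 - s ^ 2) (fun v => q * beta kap s (q * v))), Hcb, Hv.
      + apply (continuous_scal_r (- (3 * s)) (fun v => q * sqrt (rho kap s (q * v)))), Hcr. }
  apply (is_RInt_unique (V := R_CompleteNormedModule) g) in HI.
  rewrite (RInt_plus_R (fun v => (kap ^ 2 - s ^ 2) * (q * beta kap s (q * v)))
    (fun v => - (3 * s) * (q * sqrt (rho kap s (q * v))))) in HI
    by (apply (ex_RInt_scal (V := R_NormedModule)); assumption).
  rewrite (RInt_scal_R _ 0 1 _ E1), (RInt_scal_R _ 0 1 _ E2) in HI.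
  fold (Bs kap s q) in HI. fold (Bq kap s q) in HI. unfold G in HI.
  rewrite Rmult_1_r, Rmult_0_r in HI.
  replace (rho kap s 0) with 1 in HI by (unfold rho; ring). rewrite sqrt_1 in HI. lra.
Qed.

(** * Langer's variable *)

Definition kdom (km S kap s : R) : Prop := 0 < kap <= km /\ - S < s < S.

Lemma open_kdom km S : open_dom (kdom km S).
Proof.
  intros kap x [Hk Hx]. apply filter_imp with (fun y => - S < y < S).
  - intros y Hy; split; assumption.
  - apply open_interval, Hx.
Qed.

Section LangerFamily.
Context (km S m0 : R) (Hkm : km < S) (Hm0 : 0 < m0).
Context (m : R -> R -> R) (Hm : UC (kdom km S) 3 m).
Context (Hlow : forall kap s, kdom km S kap s -> m0 <= m kap s).

Let D := kdom km S.
Let c (kap : R) : R := mean_weight kap (m kap).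
Let Y (kap : R) : R -> R := Ysol kap (fun s => m kap s - c kap).
Let Yh (kap s : R) : R := Y kap s * / c kap.

Lemma m_section kap : 0 < kap <= km -> UC (ivl (- S) S) 3 (fun _ => m kap).
Proof.
  intros Hk. apply (UC_sub (fun (_ : unit) s => D kap s)).
  - intros i x Hx; split; [exact Hk | exact Hx].
  - apply (UC_reindex (fun _ : unit => kap) D 3 m Hm).
Qed.

Lemma c_ge kap : 0 < kap <= km -> m0 <= c kap.
Proof.
  intros Hk. apply (mean_weight_ge kap S); try lra; [apply m_section, Hk |].
  intros x Hx; apply Hlow; split; assumption.
Qed.

Lemma c_le : exists K, m0 <= K /\ forall kap, 0 < kap <= km -> c kap <= K.
Proof.
  destruct (UC_bound _ _ _ Hm) as [K [HK HbK]]. exists (Rmax m0 K). split; [apply Rmax_l |].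
  intros kap Hk. apply Rle_trans with K; [| apply Rmax_r].
  apply (mean_weight_le kap S); try lra; [apply m_section, Hk |].
  intros x Hx. eapply Rle_trans; [apply Rle_abs | apply HbK; split; assumption].
Qed.

Lemma Y_UC : UC D 2 Y /\
  forall kap s, D kap s -> is_derive (Y kap) s (Derive (Y kap) s) /\
    (kap ^ 2 - s ^ 2) * Derive (Y kap) s = 3 * s * Y kap s + (m kap s - c kap).
Proof.
  destruct (UC_deriv _ _ _ Hm) as [m1 [Hd1 HU1]].
  destruct (UC_deriv _ _ _ HU1) as [m2 [Hd2 HU2]].
  destruct (UC_deriv _ _ _ HU2) as [m3 [Hd3 HU3]].
  destruct (UC_bound _ _ _ HU1) as [N1 [HN1 Hb1]].
  destruct (UC_bound _ _ _ HU2) as [N2 [HN2 Hb2]].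
  destruct (UC_bound _ _ _ HU3) as [N3 [HN3 Hb3]].
  assert (HYb : forall kap, 0 < kap <= km -> exists Z V : R -> R,
    (forall s, - S < s < S -> is_derive (Y kap) s (Z s)) /\
    (forall s, - S < s < S -> is_derive Z s (V s)) /\
    (forall s, - S < s < S -> continuous V s) /\
    (forall s, - S < s < S ->
       (kap ^ 2 - s ^ 2) * Z s = 3 * s * Y kap s + (m kap s - c kap)) /\
    (forall s, - S < s < S -> Rabs (Y kap s) <= N1 / 3) /\
    (forall s, - S < s < S -> Rabs (Z s) <= N2 / 8) /\
    (forall s, - S < s < S -> Rabs (V s) <= N3 / 15)).
  { intros kap Hk. assert (Hk0 : 0 < kap) by lra. assert (HkS : kap < S) by lra.
    apply (Y_bounds kap S Hk0 HkS (m kap) (m1 kap) (m2 kap) (m3 kap) N1 N2 N3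
      (m_section kap Hk)).
    - intros s Hs; apply Hd1; split; assumption.
    - intros s Hs; apply Hd2; split; assumption.
    - intros s Hs; apply Hd3; split; assumption.
    - intros s Hs; apply Hb1; split; assumption.
    - intros s Hs; apply Hb2; split; assumption.
    - intros s Hs; apply Hb3; split; assumption. }
  assert (HZD : forall kap (Z : R -> R), (forall s, - S < s < S -> is_derive (Y kap) s (Z s)) ->
     forall s, - S < s < S -> Derive (Y kap) s = Z s).
  { intros kap Z HZ s Hs. apply is_derive_unique, HZ, Hs. }
  assert (HVD : forall kap (Z V : R -> R), (forall s, - S < s < S -> is_derive (Y kap) s (Z s)) ->
     (forall s, - S < s < S -> is_derive Z s (V s)) ->
     forall s, - S < s < S -> is_derive (Derive (Y kap)) s (V s)).
  { intros kap Z V HZ HV s Hs. apply is_derive_ext_loc with Z; [| apply HV, Hs].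
    apply filter_imp with (fun y => - S < y < S); [| apply open_interval, Hs].
    intros y Hy; symmetry; apply HZD; assumption. }
  split.
  - split; [| split].
    + exists (N1 / 3). intros kap s [Hk Hs].
      destruct (HYb kap Hk) as [Z [V [HZ [HV [HcV [E [B1 [B2 B3]]]]]]]]. apply B1, Hs.
    + intros kap s [Hk Hs].
      destruct (HYb kap Hk) as [Z [V [HZ [HV [HcV [E [B1 [B2 B3]]]]]]]].
      apply (is_derive_cont _ _ (Z s)), HZ, Hs.
    + exists (fun kap => Derive (Y kap)). split; [| split; [| split]].
      * intros kap s [Hk Hs].
        destruct (HYb kap Hk) as [Z [V [HZ [HV [HcV [E [B1 [B2 B3]]]]]]]].
        rewrite (HZD kap Z HZ s Hs). apply HZ, Hs.
      * exists (N2 / 8). intros kap s [Hk Hs].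
        destruct (HYb kap Hk) as [Z [V [HZ [HV [HcV [E [B1 [B2 B3]]]]]]]].
        rewrite (HZD kap Z HZ s Hs). apply B2, Hs.
      * intros kap s [Hk Hs].
        destruct (HYb kap Hk) as [Z [V [HZ [HV [HcV [E [B1 [B2 B3]]]]]]]].
        apply (is_derive_cont _ _ (V s)), (HVD kap Z V HZ HV s Hs).
      * exists (fun kap => Derive (Derive (Y kap))). split; [| split; [| split; [| exact Logic.I]]].
        -- intros kap s [Hk Hs].
           destruct (HYb kap Hk) as [Z [V [HZ [HV [HcV [E [B1 [B2 B3]]]]]]]].
           apply Derive_correct. exists (V s). apply (HVD kap Z V HZ HV s Hs).
        -- exists (N3 / 15). intros kap s [Hk Hs].
           destruct (HYb kap Hk) as [Z [V [HZ [HV [HcV [E [B1 [B2 B3]]]]]]]].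
           rewrite (is_derive_unique _ _ _ (HVD kap Z V HZ HV s Hs)). apply B3, Hs.
        -- intros kap s [Hk Hs].
           destruct (HYb kap Hk) as [Z [V [HZ [HV [HcV [E [B1 [B2 B3]]]]]]]].
           apply continuous_ext_loc with V; [| apply HcV, Hs].
           apply filter_imp with (fun y => - S < y < S); [| apply open_interval, Hs].
           intros y Hy; symmetry. apply is_derive_unique, (HVD kap Z V HZ HV y Hy).
  - intros kap s [Hk Hs].
    destruct (HYb kap Hk) as [Z [V [HZ [HV [HcV [E [B1 [B2 B3]]]]]]]].
    rewrite (HZD kap Z HZ s Hs). split; [apply HZ, Hs | apply E, Hs].
Qed.

Lemma invc_UC n : UC D n (fun kap _ => / c kap).
Proof.
  apply (UC_const D n (fun kap => / c kap) (/ m0)). intros kap s [Hk Hs].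
  pose proof (c_ge kap Hk). rewrite Rabs_right.
  - apply Rinv_le_contravar; assumption.
  - apply Rle_ge, Rlt_le, Rinv_0_lt_compat; lra.
Qed.

Lemma kap_UC n : UC D n (fun kap _ => kap).
Proof.
  apply (UC_const D n (fun kap => kap) km). intros kap s [Hk Hs]. apply Rabs_le; lra.
Qed.

Lemma s_UC n : UC D n (fun _ s => s).
Proof. apply UC_id with S. intros kap s [Hk Hs]. apply Rabs_le; lra. Qed.

Lemma Yh_UC : UC D 2 Yh.
Proof. apply (UC_mult D 2 Y (fun kap _ => / c kap)); [apply Y_UC | apply invc_UC]. Qed.

Definition solves_q (eta : R) (q : R -> R -> R) : Prop :=
  forall kap s, D kap s -> adm kap eta s (q kap s) /\ Bq kap s (q kap s) = Yh kap s.

Lemma q_family : exists eta q, 0 < eta <= 1 /\ solves_q eta q.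
Proof.
  destruct c_le as [K [HK HcK]].
  (* [mu] is at most [m0 / c kap] for every [kap]; it turns the estimates on [Y] into the proportion
     [1 - mu] that [q_exists] asks for. *)
  set (mu := m0 / K).
  assert (Hmu : 0 < mu <= 1).
  { unfold mu; split; [apply Rmult_lt_0_compat; [lra | apply Rinv_0_lt_compat; lra] |].
    apply Rmult_le_reg_r with K; [lra |]. unfold Rdiv; rewrite Rmult_assoc, Rinv_l; lra. }
  assert (Hex : forall kap s, D kap s ->
     exists q, adm kap (2 / 5 * mu) s q /\ Bq kap s q = Yh kap s).
  { intros kap s [Hk Hs]. pose proof (c_ge kap Hk) as Hc0. pose proof (HcK kap Hk) as HcK'.
    assert (Hk0 : 0 < kap) by lra. assert (HkS : kap < S) by lra.
    assert (Hmc : mu <= m0 / c kap).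
    { apply Rmult_le_compat_l; [lra |]. apply Rinv_le_contravar; lra. }
    assert (Hkey : forall y X, 0 <= X -> y <= (c kap - m0) * X -> y * / c kap <= (1 - mu) * X).
    { intros y X HX Hy. apply Rle_trans with ((1 - m0 / c kap) * X).
      - replace ((1 - m0 / c kap) * X) with ((c kap - m0) * X * / c kap) by (field; lra).
        apply Rmult_le_compat_r; [apply Rlt_le, Rinv_0_lt_compat; lra | exact Hy].
      - apply Rmult_le_compat_r; lra. }
    assert (HX : forall x, - kap < x < S ->
       0 <= turning_avg kap (fun _ => 1) x / pow32 (x + kap)).
    { intros x Hx. apply Rmult_le_pos.
      - apply Rlt_le, (turning_avg_one_pos kap S Hk0); exact Hx.
      - apply Rlt_le, Rinv_0_lt_compat, pow32_pos; lra. }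
    apply (q_exists kap s mu (2 / 5 * mu)); [lra | exact Hmu | reflexivity | |].
    - intros Hs'. apply Hkey; [apply HX; lra |].
      apply (Ysol_upper kap S Hk0 HkS (m kap) (m_section kap Hk)); [| lra].
      intros x Hx; apply Hlow; split; assumption.
    - intros Hs'. unfold Yh. rewrite Ropp_mult_distr_l. apply Hkey; [apply HX; lra |].
      apply (Ysol_lower kap S Hk0 HkS (m kap) (m_section kap Hk)); [| lra].
      intros x Hx; apply Hlow; split; assumption. }
  (* [q] is chosen pointwise; its regularity in [s] will follow from the equation and
     admissibility. *)
  exists (2 / 5 * mu),
    (fun kap s => epsilon (inhabits 0)
      (fun q => adm kap (2 / 5 * mu) s q /\ Bq kap s q = Yh kap s)).
  split; [lra |]. intros kap s Hks.
  apply (epsilon_spec (inhabits 0)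
    (fun q => adm kap (2 / 5 * mu) s q /\ Bq kap s q = Yh kap s)), Hex, Hks.
Qed.

(** * Uniform regularity of [q] and of Langer's variable *)

Context (eta : R) (q : R -> R -> R) (Heta : 0 < eta <= 1) (Hq : solves_q eta q).

Let Yh1 (kap s : R) : R := Derive (Y kap) s * / c kap.

Lemma Yh_derive kap s : D kap s -> is_derive (Yh kap) s (Yh1 kap s).
Proof.
  intros Hks. unfold Yh, Yh1.
  apply is_derive_ext with (fun s => / c kap * Y kap s); [intros; as_R; ring |].
  eapply is_derive_eq; [apply (is_derive_scal (Y kap)), Y_UC, Hks | as_R; ring].
Qed.

Lemma Yh1_UC : UC D 1 Yh1.
Proof.
  apply (UC_mult D 1 (fun kap => Derive (Y kap)) (fun kap _ => / c kap)); [| apply invc_UC].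
  apply (UC_Derive D 1 Y); [apply open_kdom | apply Y_UC].
Qed.

Let p (kap s : R) : R :=
  (Yh1 kap s - Bs kap s (q kap s)) * / sqrt (rho kap s (q kap s)).

Lemma q_family_derive kap s : D kap s -> is_derive (q kap) s (p kap s).
Proof.
  intros [Hk Hs]. apply (q_derive kap eta S Heta (q kap) (Yh kap) (Yh1 kap)); [| | | exact Hs].
  - intros x Hx; apply Hq; split; assumption.
  - intros x Hx; apply Hq; split; assumption.
  - intros x Hx; apply Yh_derive; split; assumption.
Qed.

Lemma q_UC0 : UC D 0 q.
Proof.
  destruct (UC_bound _ _ _ Yh_UC) as [K [HK HbK]].
  split; [| split; [| exact Logic.I]].
  - exists (K / eta). intros kap s Hks. pose proof Hks as [Hk Hs].
    apply Rmult_le_reg_l with eta; [lra |]. replace (eta * (K / eta)) with K by (field; lra).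
    eapply Rle_trans; [| apply (HbK kap s Hks)].
    apply (q_bound kap eta S Heta (q kap) (Yh kap)); [| | exact Hs];
      intros x Hx; apply Hq; split; assumption.
  - intros kap s Hks. apply (is_derive_cont (q kap) s (p kap s)), q_family_derive, Hks.
Qed.

Lemma rho_UC {I : Type} (E : I -> R -> Prop) n (kp : I -> R -> R) (t : I -> R -> R) :
  open_dom E -> UC E n kp -> UC E n (fun _ s => s) -> UC E n t ->
  UC E n (fun i s => rho (kp i s) s (t i s)).
Proof.
  intros Ho Hk Hid Ht.
  assert (H1 : UC E n (fun i s => 1 - s * t i s)).
  { apply (UC_minus E n (fun _ _ => 1) (fun i s => s * t i s)); [exact Ho | apply UC_cst |].
    apply UC_mult; assumption. }
  apply (UC_minus E n (fun i s => (1 - s * t i s) * ((1 - s * t i s) * 1))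
    (fun i s => kp i s * (kp i s * 1) * (t i s * (t i s * 1)))); [exact Ho | |].
  - apply UC_mult; [exact H1 |]. apply UC_mult; [exact H1 | apply UC_cst].
  - apply UC_mult; (apply UC_mult; [assumption |]; apply UC_mult; [assumption | apply UC_cst]).
Qed.

Lemma inv_sqrt_rho_UC {I : Type} (E : I -> R -> Prop) n (kp : I -> R) (t : I -> R -> R) :
  open_dom E -> UC E n (fun i _ => kp i) -> UC E n (fun _ s => s) -> UC E n t ->
  (forall i s, E i s -> adm (kp i) eta s (t i s)) ->
  UC E n (fun i s => / sqrt (rho (kp i) s (t i s))).
Proof.
  intros Ho Hk Hid Ht Ha.
  apply UC_inv with eta; [exact Ho | lra | |].
  - intros i s Hs; apply adm_sqrt_rho; [lra | apply Ha, Hs].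
  - apply UC_sqrt with (eta ^ 2); [exact Ho | nra | |].
    + intros i s Hs; apply adm_rho; [lra | apply Ha, Hs].
    + apply (rho_UC E n (fun i _ => kp i)); assumption.
Qed.

Let D2 (i : R * R) (s : R) : Prop := D (fst i) s /\ 0 <= snd i <= 1.

Lemma open_D2 : open_dom D2.
Proof.
  intros i x [Hx Hv]. apply filter_imp with (D (fst i)); [| apply open_kdom, Hx].
  intros y Hy; split; assumption.
Qed.

Lemma D2_UC n F : UC D n F -> UC D2 n (fun i => F (fst i)).
Proof.
  intros HF. apply (UC_sub (fun i => D (fst i))); [intros i x [H _]; exact H |].
  apply (UC_reindex fst D n F HF).
Qed.

Lemma v_UC n : UC D2 n (fun i _ => snd i).
Proof. apply (UC_const D2 n snd 1). intros i x [_ Hv]. apply Rabs_le; lra. Qed.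

Lemma qv_UC n : UC D n q -> UC D2 n (fun i s => q (fst i) s * snd i).
Proof.
  intros H. apply (UC_mult D2 n (fun i => q (fst i)) (fun i _ => snd i));
    [apply D2_UC, H | apply v_UC].
Qed.

Lemma qv_adm i s : D2 i s -> adm (fst i) eta s (q (fst i) s * snd i).
Proof.
  intros [Hs Hv]. apply adm_scale; [lra | apply Hq, Hs | exact Hv].
Qed.

Let num (i : R * R) (s : R) : R :=
  - (q (fst i) s * (q (fst i) s * snd i * (1 - s * (q (fst i) s * snd i)))).
Let den (i : R * R) (s : R) : R := / sqrt (rho (fst i) s (q (fst i) s * snd i)).

Lemma num_UC n : UC D n q -> UC D2 n num.
Proof.
  intros H. apply UC_opp; [apply open_D2 |].
  apply (UC_mult D2 n (fun i => q (fst i))); [apply D2_UC, H |].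
  apply UC_mult; [apply qv_UC, H |].
  apply (UC_minus D2 n (fun _ _ => 1)); [apply open_D2 | apply UC_cst |].
  apply (UC_mult D2 n (fun _ s => s)); [apply (D2_UC n (fun _ s => s)), s_UC | apply qv_UC, H].
Qed.

Lemma den_UC n : UC D n q -> UC D2 n den.
Proof.
  intros H. apply (inv_sqrt_rho_UC D2 n fst).
  - apply open_D2.
  - apply (D2_UC n (fun kap _ => kap)), kap_UC.
  - apply (D2_UC n (fun _ s => s)), s_UC.
  - apply qv_UC, H.
  - apply qv_adm.
Qed.

Lemma Bs_num_den kap s : Bs kap s (q kap s) = RInt (fun v => num (kap, v) s * den (kap, v) s) 0 1.
Proof.
  apply RInt_ext; intros v _. unfold beta, num, den, Rdiv; simpl. as_R. ring.
Qed.

Lemma q_cont_at kap s : D kap s -> continuous (q kap) s.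
Proof. intros H; apply (UC_cont _ _ _ q_UC0 kap s H). Qed.

Lemma s_2d (s v : R) : continuity_2d_pt (fun s _ => s) s v.
Proof. apply continuity_2d_pt_id1. Qed.

Lemma qv_2d kap s v : D kap s -> continuity_2d_pt (fun s v => q kap s * v) s v.
Proof.
  intros H. apply continuity_2d_pt_mult; [| apply continuity_2d_pt_id2].
  apply (continuous_2d_fst (q kap)), q_cont_at, H.
Qed.

Lemma num_2d kap s v : D kap s -> continuity_2d_pt (fun s v => num (kap, v) s) s v.
Proof.
  intros H. unfold num; simpl. apply continuity_2d_pt_opp.
  apply continuity_2d_pt_mult; [apply (continuous_2d_fst (q kap)), q_cont_at, H |].
  apply continuity_2d_pt_mult; [apply qv_2d, H |].
  apply continuity_2d_pt_minus; [apply continuity_2d_pt_const |].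
  apply continuity_2d_pt_mult; [apply continuity_2d_pt_id1 | apply qv_2d, H].
Qed.

Lemma rho_qv_pos kap s v : D kap s -> 0 <= v <= 1 -> 0 < rho kap s (q kap s * v).
Proof.
  intros H Hv. apply (adm_rho_pos kap eta); [lra |]. apply (qv_adm (kap, v)). split; assumption.
Qed.

Lemma sqrt_rho_qv_pos kap s v : D kap s -> 0 <= v <= 1 -> 0 < sqrt (rho kap s (q kap s * v)).
Proof. intros H Hv. apply sqrt_lt_R0, rho_qv_pos; assumption. Qed.

Lemma den_2d kap s v : D kap s -> 0 <= v <= 1 ->
  continuity_2d_pt (fun s v => den (kap, v) s) s v.
Proof.
  intros H Hv. unfold den. apply continuity_2d_pt_inv.
  - apply sqrt_2d, (rho_2d kap (fun s _ => s) (fun s v => q kap s * v)); [apply s_2d | apply qv_2d, H].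
  - apply Rgt_not_eq, sqrt_rho_qv_pos; assumption.
Qed.

Lemma near_D kap s : D kap s -> exists r, 0 < r /\ forall s', Rabs (s' - s) < r -> D kap s'.
Proof.
  intros [Hk Hs]. destruct (near_ivl (- S) S s Hs) as [r [Hr H]].
  exists r; split; [exact Hr |]. intros s' Hs'; split; [exact Hk | apply H, Hs'].
Qed.

(* A uniform bound on the integrand over [(kap, v)] bounds the integral. *)
Lemma RInt_family_bound (F : R * R -> R -> R) : UC D2 0 F ->
  (forall kap s v, D kap s -> 0 <= v <= 1 -> continuity_2d_pt (fun s v => F (kap, v) s) s v) ->
  exists K, forall kap s, D kap s -> Rabs (RInt (fun v => F (kap, v) s) 0 1) <= K.
Proof.
  intros HF H2. destruct (UC_bound _ _ _ HF) as [K [HK HbK]]. exists ((1 - 0) * K).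
  intros kap s Hs. apply abs_RInt_le_const; [lra | |].
  - apply ex_RInt_cont; [lra |]; intros w Hw.
    apply (continuity_2d_section (fun s v => F (kap, v) s)), H2; assumption.
  - intros v Hv. apply (HbK (kap, v) s). split; assumption.
Qed.

Lemma RInt_family_cont (F : R * R -> R -> R) kap s :
  (forall kap s v, D kap s -> 0 <= v <= 1 -> continuity_2d_pt (fun s v => F (kap, v) s) s v) ->
  D kap s -> continuous (fun s => RInt (fun v => F (kap, v) s) 0 1) s.
Proof.
  intros H2 Hs. destruct (near_D kap s Hs) as [r [Hr Hr']].
  apply (RInt_param_continuous (fun s v => F (kap, v) s) s r Hr).
  intros s' v Hs' Hv. apply H2; auto.
Qed.

Let Fb (i : R * R) (s : R) : R := num i s * den i s.

Lemma Fb_2d kap s v : D kap s -> 0 <= v <= 1 -> continuity_2d_pt (fun s v => Fb (kap, v) s) s v.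
Proof.
  intros H Hv. apply continuity_2d_pt_mult; [apply num_2d, H | apply den_2d; assumption].
Qed.

Lemma Fb_UC0 : UC D2 0 Fb.
Proof. apply UC_mult; [apply num_UC, q_UC0 | apply den_UC, q_UC0]. Qed.

Lemma inv_sqrt_rho_q_UC n : UC D n q -> UC D n (fun kap s => / sqrt (rho kap s (q kap s))).
Proof.
  intros H. apply (inv_sqrt_rho_UC D n (fun kap => kap)).
  - apply open_kdom.
  - apply kap_UC.
  - apply s_UC.
  - exact H.
  - intros kap s Hs; apply Hq, Hs.
Qed.

Let Bsq (kap s : R) : R := RInt (fun v => Fb (kap, v) s) 0 1.

Lemma Bsq_UC0 : UC D 0 Bsq.
Proof.
  split; [| split; [| exact Logic.I]].
  - apply (RInt_family_bound Fb Fb_UC0 Fb_2d).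
  - intros kap s Hs. apply (RInt_family_cont Fb kap s Fb_2d Hs).
Qed.

Lemma p_UC n : UC D n q -> (n <= 1)%nat -> UC D n Bsq -> UC D n p.
Proof.
  intros H Hn HB.
  apply (UC_mult D n (fun kap s => Yh1 kap s - Bs kap s (q kap s))); [| apply inv_sqrt_rho_q_UC, H].
  apply (UC_minus D n Yh1); [apply open_kdom | apply (UC_le D 1); [exact Hn | apply Yh1_UC] |].
  apply UC_ext with Bsq; [apply open_kdom | | exact HB].
  intros kap s Hs. symmetry. apply Bs_num_den.
Qed.

Lemma q_UC_S n : UC D n p -> UC D (Datatypes.S n) q.
Proof.
  intros Hp. destruct q_UC0 as [Hb [Hc _]]. split; [exact Hb | split; [exact Hc |]].
  exists p. split; [exact q_family_derive | exact Hp].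
Qed.

Lemma p_UC0 : UC D 0 p.
Proof. apply p_UC; [apply q_UC0 | lia | apply Bsq_UC0]. Qed.

Let num1 (i : R * R) (s : R) : R :=
  - (p (fst i) s * (q (fst i) s * snd i * (1 - s * (q (fst i) s * snd i)))
     + q (fst i) s * (p (fst i) s * snd i * (1 - s * (q (fst i) s * snd i))
        + q (fst i) s * snd i * (0 - (q (fst i) s * snd i + s * (p (fst i) s * snd i))))).
Let rho1 (i : R * R) (s : R) : R :=
  2 * (1 - s * (q (fst i) s * snd i)) * (0 - (q (fst i) s * snd i + s * (p (fst i) s * snd i)))
  - 2 * (fst i * fst i) * (q (fst i) s * snd i) * (p (fst i) s * snd i).
Let Fb1 (i : R * R) (s : R) : R :=
  num1 i s * den i s + num i s * (0 - 1 / 2 * rho1 i s * (den i s * (den i s * den i s))).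

Lemma Fb_derive kap s v : D kap s -> 0 <= v <= 1 ->
  is_derive (fun s => Fb (kap, v) s) s (Fb1 (kap, v) s).
Proof.
  intros Hs Hv. pose proof (q_family_derive kap s Hs) as Hqd.
  pose proof (rho_qv_pos kap s v Hs Hv) as Hr. pose proof (sqrt_rho_qv_pos kap s v Hs Hv) as Hsr.
  assert (Hqv : is_derive (fun s => q kap s * v) s (p kap s * v)).
  { apply is_derive_ext with (fun s => v * q kap s); [intros; as_R; ring |].
    eapply is_derive_eq; [apply (is_derive_scal (q kap)), Hqd | as_R; ring]. }
  assert (Hsq : is_derive (fun s => 1 - s * (q kap s * v)) s
     (0 - (q kap s * v + s * (p kap s * v)))).
  { apply (is_derive_minus (fun _ => 1)); [apply @is_derive_const |].
    eapply is_derive_eq.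
    - apply (is_derive_mult (fun s => s) (fun s => q kap s * v)); [apply @is_derive_id | exact Hqv |
        intros; apply Rmult_comm].
    - unfold plus, mult, one; simpl. as_R. ring. }
  assert (Hnum : is_derive (fun s => num (kap, v) s) s (num1 (kap, v) s)).
  {
    apply (is_derive_opp (fun s => q kap s * (q kap s * v * (1 - s * (q kap s * v))))).
    apply (is_derive_mult (q kap) (fun s => q kap s * v * (1 - s * (q kap s * v))));
      [exact Hqd | | intros; apply Rmult_comm].
    apply (is_derive_mult (fun s => q kap s * v) (fun s => 1 - s * (q kap s * v)));
      [exact Hqv | exact Hsq | intros; apply Rmult_comm]. }
  assert (Hrho : is_derive (fun s => rho kap s (q kap s * v)) s (rho1 (kap, v) s)).
  {
    apply (is_derive_minus (fun s => (1 - s * (q kap s * v)) ^ 2)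
      (fun s => kap ^ 2 * (q kap s * v) ^ 2)).
    - eapply is_derive_eq.
      + apply (is_derive_pow (fun s => 1 - s * (q kap s * v)) 2); exact Hsq.
      + simpl; as_R; ring.
    - eapply is_derive_eq.
      + apply (is_derive_scal (fun s => (q kap s * v) ^ 2)).
        apply (is_derive_pow (fun s => q kap s * v) 2); exact Hqv.
      + simpl; as_R; ring. }
  apply (is_derive_mult (fun s => num (kap, v) s) (fun s => den (kap, v) s));
    [exact Hnum | | intros; apply Rmult_comm].
  eapply is_derive_eq.
  - apply (is_derive_inv (fun s => sqrt (rho kap s (q kap s * v)))).
    + apply is_derive_sqrt; [exact Hrho | exact Hr].
    + lra.
  - unfold den; simpl. as_R. field. lra.
Qed.

Lemma num1_UC0 : UC D2 0 num1.
Proof.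
  pose proof (D2_UC 0 q q_UC0) as Uq. pose proof (D2_UC 0 p p_UC0) as Up.
  pose proof (v_UC 0) as Uv. pose proof (qv_UC 0 q_UC0) as Uqv.
  assert (Us : UC D2 0 (fun _ s => s)) by apply (D2_UC 0 (fun _ s => s)), s_UC.
  assert (Upv : UC D2 0 (fun i s => p (fst i) s * snd i))
    by (apply (UC_mult D2 0 (fun i => p (fst i)) (fun i _ => snd i)); assumption).
  assert (U1 : UC D2 0 (fun i s => 1 - s * (q (fst i) s * snd i))).
  { apply (UC_minus D2 0 (fun _ _ => 1)); [apply open_D2 | apply UC_cst |].
    apply (UC_mult D2 0 (fun _ s => s)); assumption. }
  assert (U2 : UC D2 0 (fun i s => 0 - (q (fst i) s * snd i + s * (p (fst i) s * snd i)))).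
  { apply (UC_minus D2 0 (fun _ _ => 0)); [apply open_D2 | apply UC_cst |].
    apply UC_plus; [exact Uqv |]. apply (UC_mult D2 0 (fun _ s => s)); assumption. }
  apply UC_opp; [apply open_D2 |]. apply UC_plus.
  - apply (UC_mult D2 0 (fun i => p (fst i))); [exact Up |]. apply UC_mult; assumption.
  - apply (UC_mult D2 0 (fun i => q (fst i))); [exact Uq |].
    apply UC_plus; apply UC_mult; assumption.
Qed.

Lemma rho1_UC0 : UC D2 0 rho1.
Proof.
  pose proof (D2_UC 0 p p_UC0) as Up.
  pose proof (v_UC 0) as Uv. pose proof (qv_UC 0 q_UC0) as Uqv.
  assert (Us : UC D2 0 (fun _ s => s)) by apply (D2_UC 0 (fun _ s => s)), s_UC.
  assert (Uk : UC D2 0 (fun i _ => fst i)) by apply (D2_UC 0 (fun kap _ => kap)), kap_UC.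
  assert (Upv : UC D2 0 (fun i s => p (fst i) s * snd i))
    by (apply (UC_mult D2 0 (fun i => p (fst i)) (fun i _ => snd i)); assumption).
  assert (U1 : UC D2 0 (fun i s => 1 - s * (q (fst i) s * snd i))).
  { apply (UC_minus D2 0 (fun _ _ => 1)); [apply open_D2 | apply UC_cst |].
    apply (UC_mult D2 0 (fun _ s => s)); assumption. }
  assert (U2 : UC D2 0 (fun i s => 0 - (q (fst i) s * snd i + s * (p (fst i) s * snd i)))).
  { apply (UC_minus D2 0 (fun _ _ => 0)); [apply open_D2 | apply UC_cst |].
    apply UC_plus; [exact Uqv |]. apply (UC_mult D2 0 (fun _ s => s)); assumption. }
  apply (UC_minus D2 0 (fun i s => 2 * (1 - s * (q (fst i) s * snd i)) *
    (0 - (q (fst i) s * snd i + s * (p (fst i) s * snd i))))); [apply open_D2 | |].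
  - apply UC_mult; [| exact U2]. apply (UC_mult D2 0 (fun _ _ => 2)); [apply UC_cst | exact U1].
  - apply UC_mult; [| exact Upv]. apply UC_mult; [| exact Uqv].
    apply (UC_mult D2 0 (fun _ _ => 2)); [apply UC_cst |].
    apply (UC_mult D2 0 (fun i _ => fst i)); assumption.
Qed.

Lemma Fb1_UC0 : UC D2 0 Fb1.
Proof.
  pose proof (den_UC 0 q_UC0) as Ud. pose proof (num_UC 0 q_UC0) as Un.
  apply UC_plus; [apply UC_mult; [apply num1_UC0 | exact Ud] |].
  apply UC_mult; [exact Un |].
  apply (UC_minus D2 0 (fun _ _ => 0)); [apply open_D2 | apply UC_cst |].
  apply UC_mult.
  - apply (UC_mult D2 0 (fun _ _ => 1 / 2)); [apply UC_cst | apply rho1_UC0].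
  - apply UC_mult; [exact Ud | apply UC_mult; exact Ud].
Qed.

Lemma Fb1_2d kap s v : D kap s -> 0 <= v <= 1 ->
  continuity_2d_pt (fun s v => Fb1 (kap, v) s) s v.
Proof.
  intros H Hv.
  pose proof (qv_2d kap s v H) as Cqv. pose proof (s_2d s v) as Cs.
  pose proof (num_2d kap s v H) as Cn. pose proof (den_2d kap s v H Hv) as Cd.
  assert (Cp : continuity_2d_pt (fun s _ => p kap s) s v)
    by (apply (continuous_2d_fst (p kap)), (UC_cont _ _ _ p_UC0 kap s H)).
  assert (Cq : continuity_2d_pt (fun s _ => q kap s) s v)
    by (apply (continuous_2d_fst (q kap)), q_cont_at, H).
  assert (Cpv : continuity_2d_pt (fun s v => p kap s * v) s v)
    by (apply continuity_2d_pt_mult; [exact Cp | apply continuity_2d_pt_id2]).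
  assert (C1 : continuity_2d_pt (fun s v => 1 - s * (q kap s * v)) s v).
  { apply continuity_2d_pt_minus; [apply continuity_2d_pt_const |].
    apply continuity_2d_pt_mult; assumption. }
  assert (C2 : continuity_2d_pt (fun s v => 0 - (q kap s * v + s * (p kap s * v))) s v).
  { apply continuity_2d_pt_minus; [apply continuity_2d_pt_const |].
    apply continuity_2d_pt_plus; [exact Cqv | apply continuity_2d_pt_mult; assumption]. }
  apply continuity_2d_pt_plus; apply continuity_2d_pt_mult; try assumption.
  - apply continuity_2d_pt_opp, continuity_2d_pt_plus.
    + apply continuity_2d_pt_mult; [exact Cp | apply continuity_2d_pt_mult; assumption].
    + apply continuity_2d_pt_mult; [exact Cq |].
      apply continuity_2d_pt_plus; apply continuity_2d_pt_mult; assumption.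
  - apply continuity_2d_pt_minus; [apply continuity_2d_pt_const |].
    apply continuity_2d_pt_mult.
    + apply continuity_2d_pt_mult; [apply continuity_2d_pt_const |]. unfold rho1; simpl.
      apply continuity_2d_pt_minus.
      * apply continuity_2d_pt_mult; [| exact C2].
        apply continuity_2d_pt_mult; [apply continuity_2d_pt_const | exact C1].
      * apply continuity_2d_pt_mult; [| exact Cpv].
        apply continuity_2d_pt_mult; [apply continuity_2d_pt_const | exact Cqv].
    + apply continuity_2d_pt_mult; [exact Cd | apply continuity_2d_pt_mult; exact Cd].
Qed.

Lemma Bsq_UC1 : UC D 1 Bsq.
Proof.
  destruct Bsq_UC0 as [Hb [Hc _]]. split; [exact Hb | split; [exact Hc |]].
  exists (fun kap s => RInt (fun v => Fb1 (kap, v) s) 0 1). split.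
  - intros kap s Hs. destruct (near_D kap s Hs) as [r [Hr Hr']].
    apply (RInt_param_derive (fun s v => Fb (kap, v) s) (fun s v => Fb1 (kap, v) s) s r Hr).
    + intros s' v Hs' Hv. apply Fb_derive; auto.
    + intros s' v Hs' Hv. apply (continuity_2d_section (fun s v => Fb (kap, v) s)), Fb_2d; auto.
    + intros v Hv. apply Fb1_2d; assumption.
  - split; [| split; [| exact Logic.I]].
    + apply (RInt_family_bound Fb1 Fb1_UC0 Fb1_2d).
    + intros kap s Hs. apply (RInt_family_cont Fb1 kap s Fb1_2d Hs).
Qed.

(** A bootstrap: [p] contains [q] and an integral over [q] but no derivative of [q], so each order
    of [q] gives the same order of [p] and the next order of [q]. It is carried to 2, where [p]
    needs the one bounded derivative that [Yh1] has. *)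
Lemma q_UC2 : UC D 2 q.
Proof.
  apply q_UC_S, p_UC; [apply q_UC_S, p_UC0 | lia | apply Bsq_UC1].
Qed.

Let z (kap s : R) : R := s + (kap ^ 2 - s ^ 2) * q kap s.
Let z1 (kap s : R) : R := m kap s * / c kap * / sqrt (rho kap s (q kap s)).

(** This closed form of the derivative of [z] contains [q] but not its derivative, so it is as
    smooth as [q]. Differentiating the definition of [z] would give one order less, too few for
    Liouville's transformation. *)
Lemma z1_UC : UC D 2 z1.
Proof.
  apply (UC_mult D 2 (fun kap s => m kap s * / c kap)); [| apply inv_sqrt_rho_q_UC, q_UC2].
  apply (UC_mult D 2 m (fun kap _ => / c kap)); [| apply invc_UC].
  apply (UC_le D 3); [lia | exact Hm].
Qed.

Lemma z_UC0 : UC D 0 z.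
Proof.
  apply (UC_plus D 0 (fun _ s => s)); [apply s_UC |].
  apply UC_mult; [| apply q_UC0].
  apply (UC_minus D 0 (fun kap _ => kap ^ 2) (fun _ s => s ^ 2)); [apply open_kdom | |]; simpl.
  - apply (UC_mult D 0 (fun kap _ => kap)); [apply kap_UC |].
    apply (UC_mult D 0 (fun kap _ => kap)); [apply kap_UC | apply UC_cst].
  - apply (UC_mult D 0 (fun _ s => s)); [apply s_UC |].
    apply (UC_mult D 0 (fun _ s => s)); [apply s_UC | apply UC_cst].
Qed.

(** The terms [3 s Y / c] from the equation for [Y] and from [Bs_identity] cancel, and so does
    [1 - 2 s q]; only [m / (c sqrt rho)] remains. *)
Lemma z_derive kap s : D kap s -> is_derive (z kap) s (z1 kap s).
Proof.
  intros Hs. destruct (Hq kap s Hs) as [Ha HB].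
  pose proof (Bs_identity kap eta s (q kap s) Heta Ha) as HI.
  destruct (proj2 Y_UC kap s Hs) as [_ HYode].
  assert (Hsr : 0 < sqrt (rho kap s (q kap s)))
    by (apply sqrt_lt_R0, (adm_rho_pos kap eta); [lra | exact Ha]).
  pose proof (c_ge kap (proj1 Hs)) as Hc.
  eapply is_derive_eq.
  - apply (is_derive_plus (fun s => s) (fun s => (kap ^ 2 - s ^ 2) * q kap s));
      [apply @is_derive_id |].
    apply (is_derive_mult (fun s => kap ^ 2 - s ^ 2) (q kap) s (- (2 * s)) (p kap s));
      [auto_derive; [exact Logic.I | ring] | apply q_family_derive, Hs | intros; apply Rmult_comm].
  - unfold plus, mult, one; simpl. unfold z1, p, Yh1. as_R.
    rewrite HB in HI. unfold Yh in HI.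
    set (t := sqrt (rho kap s (q kap s))) in *.
    transitivity (1 - 2 * s * q kap s + ((kap ^ 2 - s ^ 2) * Derive (Y kap) s * / c kap
      - (kap ^ 2 - s ^ 2) * Bs kap s (q kap s)) * / t); [ring |].
    rewrite HI, HYode. field. lra.
Qed.

Lemma z_relation kap s : D kap s ->
  c kap ^ 2 * (kap ^ 2 - z kap s ^ 2) * z1 kap s ^ 2 = (kap ^ 2 - s ^ 2) * m kap s ^ 2.
Proof.
  intros Hs. destruct (Hq kap s Hs) as [Ha HB].
  pose proof (adm_rho_pos kap eta s (q kap s) (proj1 Heta) Ha) as Hr.
  assert (Hsr : 0 < sqrt (rho kap s (q kap s))) by (apply sqrt_lt_R0, Hr).
  pose proof (sqrt_sqrt _ (Rlt_le _ _ Hr)) as Hss.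
  pose proof (c_ge kap (proj1 Hs)) as Hc.
  replace (kap ^ 2 - z kap s ^ 2) with ((kap ^ 2 - s ^ 2) * rho kap s (q kap s))
    by (unfold z, rho; ring).
  rewrite <- Hss. unfold z1. field. lra.
Qed.

Lemma z1_low : exists z0, 0 < z0 /\ forall kap s, D kap s -> z0 <= z1 kap s.
Proof.
  destruct c_le as [K [HK HcK]].
  assert (Hr : UC D 0 (fun kap s => rho kap s (q kap s))).
  { apply (rho_UC D 0 (fun kap _ => kap)); [apply open_kdom | apply kap_UC | apply s_UC | apply q_UC0]. }
  destruct (UC_bound _ _ _ Hr) as [Kr [HKr HbKr]].
  assert (HsK : 0 < sqrt Kr) by (apply sqrt_lt_R0, HKr).
  exists (m0 * / K * / sqrt Kr). split.
  - apply Rmult_lt_0_compat; [apply Rmult_lt_0_compat; [exact Hm0 |] |]; apply Rinv_0_lt_compat; lra.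
  - intros kap s Hs. destruct (Hq kap s Hs) as [Ha HB].
    pose proof (adm_rho_pos kap eta s (q kap s) (proj1 Heta) Ha) as Hrp.
    pose proof (c_ge kap (proj1 Hs)) as Hc. pose proof (HcK kap (proj1 Hs)) as Hc'.
    assert (0 < / K) by (apply Rinv_0_lt_compat; lra).
    assert (0 < / sqrt Kr) by (apply Rinv_0_lt_compat; lra).
    assert (H1 : / sqrt Kr <= / sqrt (rho kap s (q kap s))).
    { apply Rinv_le_contravar; [apply sqrt_lt_R0, Hrp |]. apply sqrt_le_1_alt.
      eapply Rle_trans; [apply Rle_abs | apply (HbKr kap s Hs)]. }
    assert (H2 : / K <= / c kap) by (apply Rinv_le_contravar; lra).
    specialize (Hlow kap s Hs).
    apply Rmult_le_compat; [apply Rmult_le_pos; lra | lra | | exact H1].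
    apply Rmult_le_compat; lra.
Qed.

(** The integral against [m - c] vanishes by the choice of [c]; the constant [c] leaves the area of
    a half disc. *)
Lemma phase_integral kap : 0 < kap <= km ->
  RInt (fun s => sqrt (kap ^ 2 - s ^ 2) * m kap s) (- kap) kap = c kap * (PI * kap ^ 2 / 2).
Proof.
  intros Hk. assert (Hk0 : 0 < kap) by lra. assert (HkS : kap < S) by lra.
  destruct (UC_deriv _ _ _ Hm) as [m1 [Hd1 HU1]].
  destruct (UC_deriv _ _ _ HU1) as [m2 [Hd2 HU2]].
  destruct (UC_deriv _ _ _ HU2) as [m3 [Hd3 HU3]].
  destruct (UC_bound _ _ _ HU1) as [N1 [HN1 Hb1]].
  destruct (UC_bound _ _ _ HU2) as [N2 [HN2 Hb2]].
  destruct (UC_bound _ _ _ HU3) as [N3 [HN3 Hb3]].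
  assert (H0 : RInt (fun s => sqrt (kap ^ 2 - s ^ 2) * (m kap s - c kap)) (- kap) kap = 0).
  { apply (sqrt_disc_integral kap S Hk0 HkS (m kap) (m1 kap) (m2 kap) (m3 kap) N1 N2 N3
      (m_section kap Hk)); intros s Hs.
    - apply Hd1; split; assumption.
    - apply Hd2; split; assumption.
    - apply Hd3; split; assumption.
    - apply Hb1; split; assumption.
    - apply Hb2; split; assumption.
    - apply Hb3; split; assumption. }
  assert (Hsq : forall s, continuous (fun s => sqrt (kap ^ 2 - s ^ 2)) s).
  { intros s; apply continuous_sqrt_comp, @ex_derive_continuous; auto_derive; exact Logic.I. }
  assert (Hmc : forall s, - S < s < S -> continuous (m kap) s).
  { intros s Hs; apply (UC_cont _ _ _ Hm kap s). split; assumption. }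
  assert (E1 : ex_RInt (fun s => sqrt (kap ^ 2 - s ^ 2) * (m kap s - c kap)) (- kap) kap).
  { apply ex_RInt_cont; [lra |]; intros s Hs.
    apply (continuous_mult (fun s => sqrt (kap ^ 2 - s ^ 2)) (fun s => m kap s - c kap)); [apply Hsq |].
    apply (continuous_minus (m kap) (fun _ => c kap)); [apply Hmc; lra | apply continuous_const]. }
  assert (E2 : ex_RInt (fun s => sqrt (kap ^ 2 - s ^ 2)) (- kap) kap)
    by (apply ex_RInt_cont; [lra | intros s Hs; apply Hsq]).
  rewrite <- half_disc_integral by exact Hk0. rewrite <- RInt_scal_R by exact E2.
  rewrite <- (Rplus_0_l (RInt (fun x => c kap * _) _ _)). rewrite <- H0.
  rewrite <- RInt_plus_R; [| exact E1 | apply (ex_RInt_scal (V := R_NormedModule)), E2].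
  apply RInt_ext; intros s _. as_R. ring.
Qed.

End LangerFamily.

(* [z] is Langer's variable: it turns [(kap^2 - s^2) m^2 ds^2] into the harmonic
   [c^2 (kap^2 - z^2) dz^2], uniformly down to the merging of the turning points. *)
Lemma langer_variable km S m0 (m : R -> R -> R) :
  km < S -> 0 < m0 -> UC (kdom km S) 3 m ->
  (forall kap s, kdom km S kap s -> m0 <= m kap s) ->
  exists (c : R -> R) (z z1 : R -> R -> R) (K z0 : R),
    0 < z0 /\ UC (kdom km S) 0 z /\ UC (kdom km S) 2 z1 /\
    (forall kap, 0 < kap <= km -> m0 <= c kap <= K /\
       RInt (fun s => sqrt (kap ^ 2 - s ^ 2) * m kap s) (- kap) kap
       = c kap * (PI * kap ^ 2 / 2)) /\
    (forall kap s, kdom km S kap s ->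
       is_derive (z kap) s (z1 kap s) /\ z0 <= z1 kap s /\
       c kap ^ 2 * (kap ^ 2 - z kap s ^ 2) * z1 kap s ^ 2 = (kap ^ 2 - s ^ 2) * m kap s ^ 2).
Proof.
  intros Hkm Hm0 Hm Hlow.
  destruct (q_family km S m0 Hkm Hm0 m Hm Hlow) as [eta [q [Heta Hq]]].
  destruct (c_le km S m0 Hkm m Hm) as [K [HK HcK]].
  destruct (z1_low km S m0 Hkm Hm0 m Hm Hlow eta q Heta Hq) as [z0 [Hz0 Hz1]].
  exists (fun kap => mean_weight kap (m kap)),
    (fun kap s => s + (kap ^ 2 - s ^ 2) * q kap s),
    (fun kap s => m kap s * / mean_weight kap (m kap) * / sqrt (rho kap s (q kap s))), K, z0.
  split; [exact Hz0 |]. split; [| split; [| split]].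
  - apply (z_UC0 km S m0 Hkm Hm0 m Hm Hlow eta q Heta Hq).
  - apply (z1_UC km S m0 Hkm Hm0 m Hm Hlow eta q Heta Hq).
  - intros kap Hk. split; [split |].
    + apply (c_ge km S m0 Hkm m Hm Hlow kap Hk).
    + apply HcK, Hk.
    + apply (phase_integral km S Hkm m Hm kap Hk).
  - intros kap s Hs. split; [| split].
    + apply (z_derive km S m0 Hkm Hm0 m Hm Hlow eta q Heta Hq kap s Hs).
    + apply Hz1, Hs.
    + apply (z_relation km S m0 Hkm Hm0 m Hm Hlow eta q Heta Hq kap s Hs).
Qed.

(** * Hermite polynomials and the Lyapunov form *)

(** The physicists' Hermite polynomials. The 0 of the inner match is a dummy value, since its
    coefficient [INR k] vanishes for [k = 0]. *)
Fixpoint herm (n : nat) (x : R) : R :=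
  match n with
  | O => 1
  | S k => 2 * x * herm k x - 2 * INR k * match k with O => 0 | S j => herm j x end
  end.

Lemma herm_rec k x : herm (S (S k)) x = 2 * x * herm (S k) x - 2 * INR (S k) * herm k x.
Proof. reflexivity. Qed.

Lemma herm_derive k x :
  is_derive (herm (S k)) x (2 * INR (S k) * herm k x) /\
  is_derive (herm k) x (2 * x * herm k x - herm (S k) x).
Proof.
  induction k as [|k [IH1 IH2]].
  - split.
    + simpl. apply is_derive_ext with (fun x => 2 * x); [intros; as_R; ring |].
      auto_derive; [exact Logic.I | ring].
    + eapply is_derive_eq; [apply @is_derive_const | unfold zero; simpl; ring].
  - split.
    + apply is_derive_ext with (fun x => 2 * x * herm (S k) x - 2 * INR (S k) * herm k x);
        [intros; symmetry; apply herm_rec |].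
      eapply is_derive_eq.
      * apply (is_derive_minus (fun x => 2 * x * herm (S k) x) (fun x => 2 * INR (S k) * herm k x)).
        -- apply (is_derive_mult (fun x => 2 * x) (herm (S k)) x 2 (2 * INR (S k) * herm k x));
             [auto_derive; [exact Logic.I | ring] | exact IH1 | intros; apply Rmult_comm].
        -- apply (is_derive_scal (herm k)), IH2.
      * to_R. rewrite (S_INR (S k)). as_R. ring.
    + eapply is_derive_eq; [exact IH1 |]. rewrite herm_rec. as_R. ring.
Qed.

(** This is [herm (k + 1)^2 - herm k * herm (k + 2)] with [herm (k + 2)] eliminated by the
    recurrence. Up to the factor [exp (- x^2)] it is also the Wronskian of the Hermite functions
    number [k] and [k + 1]. *)
Definition turan (k : nat) (x : R) : R :=
  herm (S k) x ^ 2 - 2 * x * herm (S k) x * herm k x + 2 * INR (S k) * herm k x ^ 2.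

(* Turan's inequality, by [turan (S k) = 2 herm (S k)^2 + 2 (k + 1) turan k]. *)
Lemma turan_pos k x : 0 < turan k x /\ 2 * herm k x ^ 2 <= turan k x.
Proof.
  induction k as [|k [IH1 IH2]].
  - unfold turan; simpl. split; ring_simplify; lra.
  - assert (E : turan (S k) x = 2 * herm (S k) x ^ 2 + 2 * INR (S k) * turan k x).
    { unfold turan. rewrite herm_rec. rewrite (S_INR (S k)). ring. }
    assert (Hk : 0 < INR (S k)) by (apply lt_0_INR; lia).
    assert (0 < INR (S k) * turan k x) by (apply Rmult_lt_0_compat; assumption).
    pose proof (pow2_ge_0 (herm (S k) x)). split; lra.
Qed.

(** For the Hermite functions [f], [g] number [k], [k + 1] and their Wronskian [w], these are
    [r = f g / w] and [e = (f g)' / w]. Since [w' = - 2 f g], the first equation is the quotient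
    rule. The operator that annihilates [f] and [g] is [W'' + 2 r W' - (x^2 - 2 n + e) W] with
    [n = k + 1]. The bounds rest on [turan_pos]. *)
Lemma riccati_pair k : exists r e : R -> R, forall x,
  is_derive r x (e x + 2 * r x ^ 2) /\
  is_derive e x (2 * x + 4 * x ^ 2 * r x - 8 * INR (S k) * r x + 2 * e x * r x) /\
  e x ^ 2 = (1 + 2 * x * r x) ^ 2 - 8 * INR (S k) * r x ^ 2 /\
  Rabs (r x) <= 5 / 4 + x ^ 2 /\ Rabs (e x) <= INR (S k) + 2 + 2 * x ^ 2.
Proof.
  set (n := INR (S k)).
  exists (fun x => herm (S k) x * herm k x / turan k x),
         (fun x => (2 * n * herm k x ^ 2 - herm (S k) x ^ 2) / turan k x).
  intros x. destruct (herm_derive k x) as [H1 H0]. fold n in H1.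
  destruct (turan_pos k x) as [Ht Ht2].
  assert (HT : is_derive (turan k) x (2 * x * turan k x - 2 * herm (S k) x * herm k x)).
  { unfold turan. fold n. eapply is_derive_eq.
    - apply (is_derive_plus (fun x => herm (S k) x ^ 2 - 2 * x * herm (S k) x * herm k x)
        (fun x => 2 * n * herm k x ^ 2)).
      + apply (is_derive_minus (fun x => herm (S k) x ^ 2)
          (fun x => 2 * x * herm (S k) x * herm k x)).
        * apply (is_derive_pow (herm (S k)) 2); exact H1.
        * apply (is_derive_mult (fun x => 2 * x * herm (S k) x) (herm k));
            [| exact H0 | intros; apply Rmult_comm].
          apply (is_derive_mult (fun x => 2 * x) (herm (S k)) x 2);
            [auto_derive; [exact Logic.I | ring] | exact H1 | intros; apply Rmult_comm].
      + apply (is_derive_scal (fun x => herm k x ^ 2)), (is_derive_pow (herm k) 2); exact H0.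
    - to_R. simpl Nat.pred. simpl INR. as_R. ring. }
  assert (Hn : 0 < n) by (apply lt_0_INR; lia).
  assert (ET : turan k x = herm (S k) x ^ 2 - 2 * x * herm (S k) x * herm k x + 2 * n * herm k x ^ 2)
    by reflexivity.
  set (b := herm (S k)) in *. set (a := herm k) in *. set (T := turan k) in *.
  split; [| split; [| split; [| split]]].
  - eapply is_derive_eq.
    + apply (is_derive_div (fun x => b x * a x) T); [| exact HT | lra].
      apply (is_derive_mult b a); [exact H1 | exact H0 | intros; apply Rmult_comm].
    + to_R. as_R. field. lra.
  - eapply is_derive_eq.
    + apply (is_derive_div (fun x => 2 * n * a x ^ 2 - b x ^ 2) T); [| exact HT | lra].
      apply (is_derive_minus (fun x => 2 * n * a x ^ 2) (fun x => b x ^ 2)).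
      * apply (is_derive_scal (fun x => a x ^ 2)), (is_derive_pow a 2); exact H0.
      * apply (is_derive_pow b 2); exact H1.
    + to_R. simpl Nat.pred. simpl INR. as_R. rewrite ET in *. field. lra.
  - rewrite ET in *. field. lra.
  - unfold Rdiv. rewrite Rabs_mult, (Rabs_right (/ T x)) by (apply Rle_ge, Rlt_le, Rinv_0_lt_compat, Ht).
    apply Rmult_le_reg_r with (T x); [exact Ht |]. rewrite Rmult_assoc, Rinv_l by lra.
    rewrite Rmult_1_r. apply Rabs_le.
    assert (0 <= (b x - 2 * x * a x) ^ 2) by apply pow2_ge_0.
    assert (0 <= (b x - a x) ^ 2) by apply pow2_ge_0.
    assert (0 <= (b x + a x) ^ 2) by apply pow2_ge_0.
    assert (0 <= n * a x ^ 2) by (apply Rmult_le_pos; [lra | apply pow2_ge_0]).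
    assert (HxT : x ^ 2 * (2 * a x ^ 2) <= x ^ 2 * T x) by (apply Rmult_le_compat_l; [apply pow2_ge_0 | lra]).
    split; lra.
  - unfold Rdiv. rewrite Rabs_mult, (Rabs_right (/ T x)) by (apply Rle_ge, Rlt_le, Rinv_0_lt_compat, Ht).
    apply Rmult_le_reg_r with (T x); [exact Ht |]. rewrite Rmult_assoc, Rinv_l by lra.
    rewrite Rmult_1_r. apply Rabs_le.
    assert (0 <= (b x - 2 * x * a x) ^ 2) by apply pow2_ge_0.
    assert (0 <= n * a x ^ 2) by (apply Rmult_le_pos; [lra | apply pow2_ge_0]).
    assert (HxT : x ^ 2 * (2 * a x ^ 2) <= x ^ 2 * T x) by (apply Rmult_le_compat_l; [apply pow2_ge_0 | lra]).
    assert (HnT : n * (2 * a x ^ 2) <= n * T x) by (apply Rmult_le_compat_l; lra).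
    pose proof (pow2_ge_0 (b x)).
    split; lra.
Qed.

(* With [W' = V] and [V' = (x^2 - L) W] in the variable [x = xi], the quadratic
   form below has derivative
   [(2 r V + (2 n - L - e) W)^2 + (1 - (L - 2 n)^2) W^2]: it is the boundary term
   of [<(H - 2n + 1) W, (H - 2n - 1) W> = |B W|^2], where [H = - d^2/dx^2 + x^2]
   and [B W] is the Wronskian of two consecutive Hermite functions and [W],
   divided by the (positive) Wronskian of the Hermite functions. *)
Lemma lyapunov_exists L0 d : 0 < L0 -> 0 < d <= 1 ->
  (forall j : nat, d <= Rabs (L0 - (2 * INR j + 1))) ->
  exists Rf : R -> R -> R -> R,
    (forall (xi W V : R -> R) (xi1 L s : R),
       is_derive xi s xi1 -> 0 <= xi1 -> is_derive W s (xi1 * V s) ->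
       is_derive V s (xi1 * (xi s ^ 2 - L) * W s) -> Rabs (L - L0) <= d / 2 ->
       exists l, is_derive (fun s => Rf (xi s) (W s) (V s)) s l /\
         xi1 * (d / 2) * W s ^ 2 <= l) /\
    (forall x W V, Rabs (Rf x W V) <= 12 * (1 + L0 + x ^ 2) ^ 2 * (W ^ 2 + V ^ 2)).
Proof.
  intros HL0 Hd Hj.
  (* So [2 n - 1 <= L0 < 2 n + 1]. *)
  destruct (nfloor_ex ((L0 + 1) / 2)) as [n [Hn1 Hn2]]; [lra |].
  destruct n as [|k].
  (* Below the lowest eigenvalue 1 the Gaussian alone takes the place of the pair: [d/dx + x]
     annihilates it, and up to the factor [xi1] the form has derivative
     [(V + x W)^2 + (1 - L) W^2]. *)
  - exists (fun x W V => W * V + x * W ^ 2). split.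
    + intros xi W V xi1 L s Hxi Hxi1 HW HV HL.
      assert (H0 : L0 <= 1 - d).
      { specialize (Hj 0%nat). simpl in Hj, Hn2. rewrite Rabs_left1 in Hj by lra. lra. }
      apply Rabs_le_between in HL.
      eexists; split.
      * apply (is_derive_plus (fun s => W s * V s) (fun s => xi s * W s ^ 2)).
        -- apply (is_derive_mult W V); [exact HW | exact HV | intros; apply Rmult_comm].
        -- apply (is_derive_mult xi (fun s => W s ^ 2)); [exact Hxi | | intros; apply Rmult_comm].
           apply (is_derive_pow W 2); exact HW.
      * to_R. simpl INR. simpl Nat.pred.
        match goal with |- _ <= ?X => replace X with
          (xi1 * ((V s + xi s * W s) ^ 2 + (1 - L) * W s ^ 2)) by (as_R; ring) end.
        rewrite Rmult_assoc. apply Rmult_le_compat_l; [exact Hxi1 |].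
        pose proof (pow2_ge_0 (V s + xi s * W s)). nra.
    + intros x W V.
      assert (HB : 1 <= 1 + L0 + x ^ 2) by (pose proof (pow2_ge_0 x); lra).
      set (B := 1 + L0 + x ^ 2) in *.
      assert (HBB : B <= B ^ 2) by nra.
      assert (Hx : Rabs x <= B).
      { apply Rabs_le. unfold B. split; nra. }
      pose proof (pow2_ge_0 W); pose proof (pow2_ge_0 V).
      assert (H1 : Rabs (W * V) <= W ^ 2 + V ^ 2) by (apply Rabs_le; split; nra).
      assert (H2 : Rabs (x * W ^ 2) <= B * (W ^ 2 + V ^ 2)).
      { rewrite Rabs_mult, (Rabs_right (W ^ 2)) by lra.
        apply Rmult_le_compat; [apply Rabs_pos | lra | exact Hx | lra]. }
      eapply Rle_trans; [apply Rabs_triang |].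
      nra.
  - destruct (riccati_pair k) as [r [e Hre]]. set (n := INR (S k)) in *.
    assert (Hlo : 2 * n - 1 + d <= L0).
    { specialize (Hj k). rewrite Rabs_right in Hj; unfold n in *; rewrite S_INR in *; lra. }
    assert (Hhi : L0 <= 2 * n + 1 - d).
    { specialize (Hj (S k)). fold n in Hj. rewrite Rabs_left1 in Hj by lra. lra. }
    exists (fun x W V => 2 * r x * V ^ 2 - 2 * e x * (W * V)
              + (2 * x + 2 * x ^ 2 * r x - 4 * n * r x) * W ^ 2). split.
    + intros xi W V xi1 L s Hxi Hxi1 HW HV HL.
      destruct (Hre (xi s)) as [Hr [He [Hee _]]].
      assert (Hrx : is_derive (fun s => r (xi s)) s (xi1 * (e (xi s) + 2 * r (xi s) ^ 2)))
        by (apply (is_derive_comp r xi); assumption).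
      assert (Hex : is_derive (fun s => e (xi s)) s
        (xi1 * (2 * xi s + 4 * xi s ^ 2 * r (xi s) - 8 * n * r (xi s) + 2 * e (xi s) * r (xi s))))
        by (apply (is_derive_comp e xi); assumption).
      assert (Hx2 : is_derive (fun s => xi s ^ 2) s (2 * xi1 * xi s)).
      { eapply is_derive_eq; [apply (is_derive_pow xi 2); exact Hxi | simpl; as_R; ring]. }
      assert (HW2 : is_derive (fun s => W s ^ 2) s (2 * (xi1 * V s) * W s)).
      { eapply is_derive_eq; [apply (is_derive_pow W 2); exact HW | simpl; as_R; ring]. }
      assert (HV2 : is_derive (fun s => V s ^ 2) s (2 * (xi1 * (xi s ^ 2 - L) * W s) * V s)).
      { eapply is_derive_eq; [apply (is_derive_pow V 2); exact HV | simpl; as_R; ring]. }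
      assert (HWV : is_derive (fun s => W s * V s) s
        (xi1 * V s * V s + W s * (xi1 * (xi s ^ 2 - L) * W s))).
      { apply (is_derive_mult W V); [exact HW | exact HV | intros; apply Rmult_comm]. }
      eexists; split.
      * apply (is_derive_plus (fun s => 2 * r (xi s) * V s ^ 2 - 2 * e (xi s) * (W s * V s))
          (fun s => (2 * xi s + 2 * xi s ^ 2 * r (xi s) - 4 * n * r (xi s)) * W s ^ 2)).
        -- apply (is_derive_minus (fun s => 2 * r (xi s) * V s ^ 2)
             (fun s => 2 * e (xi s) * (W s * V s))).
           ++ apply (is_derive_mult (fun s => 2 * r (xi s)) (fun s => V s ^ 2));
                [apply (is_derive_scal (fun s => r (xi s))), Hrx | exact HV2 |
                 intros; apply Rmult_comm].
           ++ apply (is_derive_mult (fun s => 2 * e (xi s)) (fun s => W s * V s));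
                [apply (is_derive_scal (fun s => e (xi s))), Hex | exact HWV |
                 intros; apply Rmult_comm].
        -- apply (is_derive_mult
             (fun s => 2 * xi s + 2 * xi s ^ 2 * r (xi s) - 4 * n * r (xi s)) (fun s => W s ^ 2));
             [| exact HW2 | intros; apply Rmult_comm].
           apply (is_derive_minus (fun s => 2 * xi s + 2 * xi s ^ 2 * r (xi s))
             (fun s => 4 * n * r (xi s))).
           ++ apply (is_derive_plus (fun s => 2 * xi s) (fun s => 2 * xi s ^ 2 * r (xi s)));
                [apply (is_derive_scal xi), Hxi |].
              apply (is_derive_mult (fun s => 2 * xi s ^ 2) (fun s => r (xi s)));
                [apply (is_derive_scal (fun s => xi s ^ 2)), Hx2 | exact Hrx |
                 intros; apply Rmult_comm].
           ++ apply (is_derive_scal (fun s => r (xi s))), Hrx.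
      * to_R.
        set (x := xi s) in *. set (R0 := r x) in *. set (E0 := e x) in *.
        set (w := W s). set (v := V s).
        apply Rle_trans with (xi1 * ((2 * R0 * v + (2 * n - L - E0) * w) ^ 2
          + (1 - (L - 2 * n) ^ 2) * w ^ 2)).
        -- rewrite Rmult_assoc. apply Rmult_le_compat_l; [exact Hxi1 |].
           pose proof (pow2_ge_0 (2 * R0 * v + (2 * n - L - E0) * w)). pose proof (pow2_ge_0 w).
           apply Rabs_le_between in HL.
           assert (d / 2 <= 1 - (L - 2 * n) ^ 2) by nra.
           assert (d / 2 * w ^ 2 <= (1 - (L - 2 * n) ^ 2) * w ^ 2) by (apply Rmult_le_compat_r; lra).
           lra.
        -- apply Req_le.
           (* The two sides differ by a multiple of the algebraic relation between [e] and [r],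
              which is added and then cancelled. *)
           match goal with |- _ = ?Y => transitivity (Y
             + xi1 * w ^ 2 * (E0 ^ 2 - ((1 + 2 * x * R0) ^ 2 - 8 * n * R0 ^ 2))) end;
             [as_R; ring | rewrite Hee; as_R; ring].
    + intros x W V. destruct (Hre x) as [_ [_ [_ [Hr He]]]].
      assert (HB : 1 <= 1 + L0 + x ^ 2) by (pose proof (pow2_ge_0 x); lra).
      pose proof (pow2_ge_0 x) as Hx2.
      set (B := 1 + L0 + x ^ 2) in *.
      assert (HBB : B <= B ^ 2) by nra.
      assert (Hx : Rabs x <= B) by (apply Rabs_le; unfold B; split; nra).
      assert (Hr' : Rabs (r x) <= 5 / 4 * B) by (unfold B; lra).
      assert (He' : Rabs (e x) <= 3 * B ^ 2) by (unfold B in *; lra).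
      pose proof (pow2_ge_0 W); pose proof (pow2_ge_0 V).
      set (N := W ^ 2 + V ^ 2) in *.
      assert (A1 : Rabs (2 * r x * V ^ 2) <= 5 / 2 * B ^ 2 * N).
      { rewrite !Rabs_mult, (Rabs_right 2), (Rabs_right (V ^ 2)) by lra.
        apply Rmult_le_compat; [apply Rmult_le_pos; [lra | apply Rabs_pos] | lra | lra | unfold N; lra]. }
      assert (A2 : Rabs (2 * e x * (W * V)) <= 3 * B ^ 2 * N).
      { assert (H1 : Rabs (2 * (W * V)) <= N) by (pose proof (pow2_ge_0 (W + V)); pose proof (pow2_ge_0 (W - V));
          unfold N; apply Rabs_le; split; lra).
        replace (2 * e x * (W * V)) with (e x * (2 * (W * V))) by ring. rewrite Rabs_mult.
        apply Rmult_le_compat; [apply Rabs_pos | apply Rabs_pos | exact He' | exact H1]. }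
      assert (A3 : Rabs ((2 * x + 2 * x ^ 2 * r x - 4 * n * r x) * W ^ 2) <= 13 / 2 * B ^ 2 * N).
      { rewrite Rabs_mult, (Rabs_right (W ^ 2)) by lra.
        apply Rmult_le_compat; [apply Rabs_pos | lra | | unfold N; lra].
        replace (2 * x + 2 * x ^ 2 * r x - 4 * n * r x) with (2 * x + (2 * x ^ 2 - 4 * n) * r x) by ring.
        eapply Rle_trans; [apply Rabs_triang |]. rewrite !Rabs_mult, (Rabs_right 2) by lra.
        assert (Rabs (2 * x ^ 2 - 4 * n) * Rabs (r x) <= (18 / 5 * B) * (5 / 4 * B)).
        { apply Rmult_le_compat; try apply Rabs_pos; [| exact Hr'].
          apply Rabs_le. unfold B; split; lra. }
        nra. }
      eapply Rle_trans; [apply Rabs_triang |].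
      pose proof (Rabs_triang (2 * r x * V ^ 2) (- (2 * e x * (W * V)))) as Ht.
      rewrite Rabs_Ropp in Ht. unfold Rminus at 1. lra.
Qed.

(** * Forbidden regions and Liouville's transformation *)

(** The third power is enough for [quantization_mismatch], where it leaves a quantity of order
    [eps^2] against a growth of order [eps]. *)
Lemma exp_neg_cube x : 0 < x -> exp (- x) <= 27 / x ^ 3.
Proof.
  intros Hx. rewrite exp_Ropp.
  assert (H : x / 3 <= exp (x / 3)) by (pose proof (exp_ineq1_le (x / 3)); lra).
  assert (E : exp x = exp (x / 3) ^ 3).
  { simpl. rewrite Rmult_1_r, <- !exp_plus. f_equal; field. }
  assert (H3 : (x / 3) ^ 3 <= exp x) by (rewrite E; apply pow_incr; lra).
  assert (Hx3 : 0 < (x / 3) ^ 3) by (apply pow_lt; lra).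
  replace (27 / x ^ 3) with (/ (x / 3) ^ 3) by (field; lra).
  apply Rinv_le_contravar; assumption.
Qed.

Lemma is_derive_prod (f g : R -> R) x df dg : is_derive f x df -> is_derive g x dg ->
  is_derive (fun x => f x * g x) x (df * g x + f x * dg).
Proof. intros Hf Hg; apply (is_derive_mult f g); auto; intros; apply Rmult_comm. Qed.

Lemma is_derive_square (f : R -> R) x df : is_derive f x df ->
  is_derive (fun x => f x ^ 2) x (2 * df * f x).
Proof.
  intros Hf; eapply is_derive_eq; [apply (is_derive_pow f 2); exact Hf | simpl; as_R; ring].
Qed.

(* In the forbidden region [h = - y u] decays at the rate [2 k / eps]. *)
Lemma forbidden_decay eps k s1 sm s2 s3 s4 (y u P d : R -> R) :
  0 < eps -> 0 < k -> s1 < sm -> sm < s2 -> s2 < s3 -> s3 < s4 ->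
  (forall s, s1 <= s <= s4 -> is_derive y s (P s * u s / eps)) ->
  (forall s, s1 <= s <= s4 -> is_derive u s (d s * y s / eps)) ->
  (forall s, s1 <= s <= s4 -> k <= P s) -> (forall s, s1 <= s <= s4 -> k <= d s) ->
  (forall s, s1 <= s <= s4 -> y s * u s <= 0) ->
  (forall s, s1 <= s <= sm -> y sm ^ 2 <= y s ^ 2) /\
  exists s, s3 <= s <= s4 /\
    y s ^ 2 + u s ^ 2
    <= eps ^ 2 / (2 * k ^ 2 * (s2 - sm) * (s4 - s3)) * exp (- (2 * k * (s3 - s2) / eps)) * y sm ^ 2.
Proof.
  intros He Hk H1 H2 H3 H4 Hy Hu HP Hd Hyu.
  assert (Hie : 0 < / eps) by (apply Rinv_0_lt_compat, He).
  pose (h := fun s => - (y s * u s)).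
  pose (h1 := fun s => - ((P s * u s ^ 2 + d s * y s ^ 2) / eps)).
  assert (Hh0 : forall s, s1 <= s <= s4 -> 0 <= h s) by (intros s Hs; unfold h; specialize (Hyu s Hs); lra).
  assert (Hh : forall s, s1 <= s <= s4 -> is_derive h s (h1 s)).
  { intros s Hs. eapply is_derive_eq.
    - apply (is_derive_opp (fun s => y s * u s)), is_derive_prod; [apply Hy, Hs | apply Hu, Hs].
    - to_R. unfold h1. field. lra. }
  assert (Hh1 : forall s, s1 <= s <= s4 -> k * (y s ^ 2 + u s ^ 2) <= - h1 s * eps).
  { intros s Hs. unfold h1. replace (- - ((P s * u s ^ 2 + d s * y s ^ 2) / eps) * eps)
      with (P s * u s ^ 2 + d s * y s ^ 2) by (field; lra).
    specialize (HP s Hs). specialize (Hd s Hs).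
    nra. }
  assert (Hh2 : forall s, s1 <= s <= s4 -> 2 * k * h s <= - h1 s * eps).
  { intros s Hs. eapply Rle_trans; [| apply Hh1, Hs]. unfold h.
    pose proof (pow2_ge_0 (y s + u s)). nra. }
  assert (Hh1n : forall s, s1 <= s <= s4 -> h1 s <= 0).
  { intros s Hs. specialize (Hh2 s Hs). specialize (Hh0 s Hs).
    destruct (Rle_dec (h1 s) 0) as [H|H]; [exact H | exfalso].
    nra. }
  assert (Hdec : forall a b, s1 <= a -> a <= b -> b <= s4 -> h b <= h a).
  { intros a b Ha Hab Hb.
    assert (H : - h a <= - h b); [| lra].
    apply (is_derive_le_compat (fun s => - h s) (fun s => - h1 s)); [exact Hab | |].
    - intros c Hc; apply (is_derive_opp h), Hh; lra.
    - intros c Hc. specialize (Hh1n c). lra. }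
  assert (Hy2 : forall s, s1 <= s <= s4 -> is_derive (fun s => - y s ^ 2) s (2 * P s * h s / eps)).
  { intros s Hs. eapply is_derive_eq.
    - apply (is_derive_opp (fun s => y s ^ 2)), is_derive_square, Hy, Hs.
    - to_R. unfold h. field. lra. }
  assert (Hy2p : forall s, s1 <= s <= s4 -> 0 <= 2 * P s * h s / eps).
  { intros s Hs. specialize (HP s Hs). specialize (Hh0 s Hs).
    apply Rmult_le_pos; [apply Rmult_le_pos; lra | lra]. }
  split.
  { intros s Hs. assert (H : - y s ^ 2 <= - y sm ^ 2); [| lra].
    apply (is_derive_le_compat (fun s => - y s ^ 2) (fun s => 2 * P s * h s / eps)); [lra | |];
      intros c Hc; [apply Hy2 | apply Hy2p]; lra. }
  (* Over [[sm, s2]] the decrease of [y^2] has the rate [2 P h / eps] with [h >= h s2], and it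
     cannot exceed [y sm^2]. *)
  assert (A1 : h s2 * (2 * k * (s2 - sm)) <= eps * y sm ^ 2).
  { destruct (MVT_is_derive (fun s => - y s ^ 2) (fun s => 2 * P s * h s / eps) sm s2)
      as [c [Hc Hcc]]; [lra | intros c Hc; apply Hy2; lra |].
    assert (Hcs : s1 <= c <= s4) by lra.
    assert (Hhc : h s2 <= h c) by (apply Hdec; lra).
    specialize (HP c Hcs). pose proof (pow2_ge_0 (y s2)).
    pose proof (Hh0 s2 ltac:(lra)) as Hh20.
    assert (E : eps * (- y s2 ^ 2 - - y sm ^ 2) = 2 * P c * h c * (s2 - sm)).
    { rewrite Hc. field. lra. }
    assert (k * h s2 <= P c * h c) by (apply Rmult_le_compat; lra).
    assert (k * h s2 * (s2 - sm) <= P c * h c * (s2 - sm)) by (apply Rmult_le_compat_r; lra).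
    assert (0 <= eps * y s2 ^ 2) by (apply Rmult_le_pos; lra).
    lra. }
  assert (A2 : h s3 <= h s2 * exp (- (2 * k * (s3 - s2) / eps))).
  { pose (E := fun s => - (h s * exp (2 * k * (s - s2) / eps))).
    assert (HE : E s2 <= E s3).
    { apply (is_derive_le_compat E (fun s => - ((h1 s + h s * (2 * k / eps))
        * exp (2 * k * (s - s2) / eps)))); [lra | |].
      - intros s Hs. eapply is_derive_eq.
        + apply (is_derive_opp (fun s => h s * exp (2 * k * (s - s2) / eps))).
          apply is_derive_prod; [apply Hh; lra |].
          apply (is_derive_comp exp (fun s => 2 * k * (s - s2) / eps) s
            (exp (2 * k * (s - s2) / eps)) (2 * k / eps)).
          * apply is_derive_exp.
          * auto_derive; [exact Logic.I | field; lra].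
        + to_R. ring.
      - intros s Hs. specialize (Hh2 s ltac:(lra)).
        assert (H : h1 s + h s * (2 * k / eps) <= 0).
        { replace (h1 s + h s * (2 * k / eps)) with ((h1 s * eps + 2 * k * h s) * / eps) by (field; lra).
          assert (H : 0 <= (- (h1 s * eps + 2 * k * h s)) * / eps) by (apply Rmult_le_pos; lra). lra. }
        pose proof (exp_pos (2 * k * (s - s2) / eps)). nra. }
    unfold E in HE. rewrite Rminus_diag in HE.
    replace (2 * k * 0 / eps) with 0 in HE by (unfold Rdiv; ring). rewrite exp_0 in HE.
    pose proof (exp_pos (2 * k * (s3 - s2) / eps)) as Hep.
    rewrite exp_Ropp. apply Rmult_le_reg_r with (exp (2 * k * (s3 - s2) / eps)); [exact Hep |].
    set (X := exp (2 * k * (s3 - s2) / eps)) in *.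
    replace (h s2 * / X * X) with (h s2) by (field; lra). lra. }
  (* Smallness of [h] says nothing yet about [y] and [u] separately. But [- h1] dominates
     [k (y^2 + u^2) / eps], and [h] decreases by at most [h s3] over [[s3, s4]], so both are small
     at some point. *)
  destruct (MVT_is_derive h h1 s3 s4) as [c [Hc Hcc]]; [lra | intros c Hc; apply Hh; lra |].
  exists c; split; [lra |].
  pose proof (Hh1 c ltac:(lra)) as Hc1. pose proof (Hh0 s4 ltac:(lra)) as Hs40.
  assert (A3 : k * (y c ^ 2 + u c ^ 2) * (s4 - s3) <= eps * h s3).
  { assert (k * (y c ^ 2 + u c ^ 2) * (s4 - s3) <= - h1 c * eps * (s4 - s3))
      by (apply Rmult_le_compat_r; lra).
    assert (E : - h1 c * eps * (s4 - s3) = eps * (h s3 - h s4)).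
    { replace (h s3 - h s4) with (- (h1 c * (s4 - s3))) by lra. ring. }
    assert (0 <= eps * h s4) by (apply Rmult_le_pos; lra). lra. }
  set (e := exp (- (2 * k * (s3 - s2) / eps))) in *.
  assert (He0 : 0 < e) by apply exp_pos.
  assert (Hden : 0 < 2 * k ^ 2 * (s2 - sm) * (s4 - s3)).
  { repeat apply Rmult_lt_0_compat; try lra; nra. }
  apply Rmult_le_reg_r with (2 * k ^ 2 * (s2 - sm) * (s4 - s3)); [exact Hden |].
  replace (eps ^ 2 / (2 * k ^ 2 * (s2 - sm) * (s4 - s3)) * e * y sm ^ 2
    * (2 * k ^ 2 * (s2 - sm) * (s4 - s3))) with (eps * (e * (eps * y sm ^ 2)))
    by (field; repeat split; lra).
  apply Rle_trans with (eps * (h s3 * (2 * k * (s2 - sm)))).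
  - replace ((y c ^ 2 + u c ^ 2) * (2 * k ^ 2 * (s2 - sm) * (s4 - s3)))
      with (k * (y c ^ 2 + u c ^ 2) * (s4 - s3) * (2 * k * (s2 - sm))) by ring.
    rewrite <- (Rmult_assoc eps). apply Rmult_le_compat_r; [| exact A3].
    apply Rmult_le_pos; lra.
  - apply Rmult_le_compat_l; [lra |].
    apply Rle_trans with (h s2 * e * (2 * k * (s2 - sm))).
    + apply Rmult_le_compat_r; [apply Rmult_le_pos; lra | exact A2].
    + replace (h s2 * e * (2 * k * (s2 - sm))) with (e * (h s2 * (2 * k * (s2 - sm)))) by ring.
      apply Rmult_le_compat_l; lra.
Qed.

(* Liouville's transformation to the variable [xi = sqrt (c / eps) z]. *)
Lemma liouville_transform (eps c kap g s : R) (y u z b : R -> R) (p Xp z1 a1 b1 : R -> R) :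
  0 < eps -> 0 < c -> 0 < g -> g * g = c / eps ->
  0 < z1 s -> 0 < b s -> b s = p s / z1 s ->
  is_derive y s (p s * u s / eps) ->
  is_derive u s (- ((kap ^ 2 - s ^ 2) * Xp s) * y s / eps) ->
  is_derive z s (z1 s) -> is_derive b s (b1 s) ->
  is_derive (fun s => b1 s / (2 * (b s * z1 s))) s (a1 s) ->
  c ^ 2 * (kap ^ 2 - z s ^ 2) * z1 s ^ 2 = (kap ^ 2 - s ^ 2) * (p s * Xp s) ->
  let a := fun s => b1 s / (2 * (b s * z1 s)) in
  let W := fun s => y s / sqrt (b s) in
  let V := fun s => (sqrt (b s) * u s / eps - a s * W s) / g in
  is_derive (fun s => g * z s) s (g * z1 s) /\
  is_derive W s (g * z1 s * V s) /\
  is_derive V s (g * z1 s * ((g * z s) ^ 2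
     - (c * kap ^ 2 / eps + eps / c * (a1 s / z1 s - a s ^ 2))) * W s).
Proof.
  intros He Hc Hg Hgg Hz1 Hb Hbp Hy Hu Hz Hbd Had Hrel a W V.
  assert (Hsb : 0 < sqrt (b s)) by (apply sqrt_lt_R0, Hb).
  assert (Hss : sqrt (b s) * sqrt (b s) = b s) by (apply sqrt_sqrt; lra).
  (* With [dxi = g z1 ds] the first equation reads [dy/dxi = b u / (g eps)]; dividing [y] by
     [sqrt b] is what removes the first-order term. *)
  assert (Hps : p s = b s * z1 s) by (rewrite Hbp; field; lra).
  assert (HW : is_derive W s (g * z1 s * V s)).
  { eapply is_derive_eq.
    - apply (is_derive_div y (fun s => sqrt (b s))); [exact Hy | | lra].
      apply (is_derive_sqrt b); [exact Hbd | exact Hb].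
    - to_R. unfold V, W, a. rewrite Hps. set (t := sqrt (b s)) in *. rewrite <- Hss.
      field. repeat split; lra. }
  split; [| split; [exact HW |]].
  - apply (is_derive_scal z), Hz.
  - assert (HV : is_derive V s ((b1 s / (2 * sqrt (b s)) * u s / eps
        + sqrt (b s) * (- ((kap ^ 2 - s ^ 2) * Xp s) * y s / eps) / eps
        - (a1 s * W s + a s * (g * z1 s * V s))) / g)).
    { apply is_derive_ext with (fun s => / g * (/ eps * (sqrt (b s) * u s) - a s * W s)).
      { intros x. unfold V. as_R. field. lra. }
      eapply is_derive_eq.
      - apply (is_derive_scal (fun s => / eps * (sqrt (b s) * u s) - a s * W s)).
        apply (is_derive_minus (fun s => / eps * (sqrt (b s) * u s)) (fun s => a s * W s)).
        + apply (is_derive_scal (fun s => sqrt (b s) * u s)).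
          apply is_derive_prod; [apply (is_derive_sqrt b); [exact Hbd | exact Hb] | exact Hu].
        + apply is_derive_prod; [exact Had | exact HW].
      - to_R. field. lra. }
    eapply is_derive_eq; [exact HV |]. as_R.
    assert (E1 : c * kap ^ 2 / eps = g * g * kap ^ 2) by (rewrite Hgg; field; lra).
    assert (E2 : eps / c = / (g * g)) by (rewrite Hgg; field; lra).
    assert (E3 : c = g * g * eps) by (rewrite Hgg; field; lra).
    assert (HX : (kap ^ 2 - s ^ 2) * Xp s * b s
       = (g * g * eps) ^ 2 * (kap ^ 2 - z s ^ 2) * z1 s).
    { rewrite <- E3. apply Rmult_eq_reg_r with (z1 s); [| lra].
      transitivity ((kap ^ 2 - s ^ 2) * (p s * Xp s)); [rewrite Hps; ring |].
      rewrite <- Hrel. ring. }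
    rewrite E1, E2.
    assert (Ha : b1 s = 2 * a s * (b s * z1 s)) by (unfold a; field; lra).
    assert (HyW : y s = W s * sqrt (b s)) by (unfold W; field; lra).
    assert (HVu : u s = eps * (g * V s + a s * W s) / sqrt (b s))
      by (unfold V; field; repeat split; lra).
    rewrite Ha, HVu, HyW. clearbody a W V. set (t := sqrt (b s)) in *. clearbody t.
    rewrite <- Hss.
    transitivity ((2 * a s * z1 s * (g * V s + a s * W s) / 2
      - (kap ^ 2 - s ^ 2) * Xp s * (t * t) * W s / (eps * eps)
      - a1 s * W s - a s * (g * z1 s * V s)) / g); [field; repeat split; lra |].
    rewrite Hss, HX. field. repeat split; lra.
Qed.

(** * Growth of the form against decay in the forbidden regions *)

Section Mismatch.
Context (km S1 Sm S2 S3 S4 S m0 K z0 k0 : R).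
Context (Hkm : 0 < km) (H1 : km < S1) (Hm : S1 < Sm) (H2 : Sm < S2) (H3 : S2 < S3)
        (H4 : S3 < S4) (HS : S4 < S).
Context (c : R -> R) (z z1 p Xp : R -> R -> R).
Context (Hm0 : 0 < m0) (Hz0 : 0 < z0) (Hk0 : 0 < k0).
Context (Uz : UC (kdom km S) 0 z) (Uz1 : UC (kdom km S) 2 z1) (Up : UC (kdom km S) 2 p).
Context (Hc : forall kap, 0 < kap <= km -> m0 <= c kap <= K).
Context (Hz : forall kap s, kdom km S kap s ->
       is_derive (z kap) s (z1 kap s) /\ z0 <= z1 kap s /\
       c kap ^ 2 * (kap ^ 2 - z kap s ^ 2) * z1 kap s ^ 2
       = (kap ^ 2 - s ^ 2) * (p kap s * Xp kap s)).
Context (Hp : forall kap s, kdom km S kap s -> k0 <= p kap s /\ k0 <= Xp kap s).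

(** The solution is measured by [A = y Sm^2 + y (- Sm)^2]. The form grows by at least a multiple of
    [eps A] across the two strips between [S1] and [Sm] in absolute value, while at suitable points
    further out it is exponentially small relative to [A]; hence [A = 0]. The conclusion is a common
    zero, so nontriviality is left to the caller. *)
Lemma quantization_mismatch : exists M e0, 0 < M /\ 0 < e0 /\
  forall eps kap (y u : R -> R), 0 < eps < e0 -> 0 < kap <= km ->
    (forall s, - S < s < S -> is_derive y s (p kap s * u s / eps)) ->
    (forall s, - S < s < S -> is_derive u s (- ((kap ^ 2 - s ^ 2) * Xp kap s) * y s / eps)) ->
    (forall s, S1 <= s <= S4 -> y s * u s <= 0) ->
    (forall s, - S4 <= s <= - S1 -> 0 <= y s * u s) ->
    (forall j : nat, M * eps <= Rabs (c kap * kap ^ 2 / eps - (2 * INR j + 1))) ->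
    exists s, - S < s < S /\ y s = 0 /\ u s = 0.
Proof.
  set (D := kdom km S) in *.
  assert (Ub : UC D 2 (fun kap s => p kap s * / z1 kap s)).
  { apply UC_mult; [exact Up |]. apply UC_inv with z0; [apply open_kdom | exact Hz0 | | exact Uz1].
    intros kap s Hs; apply Hz, Hs. }
  set (b := fun kap s => p kap s * / z1 kap s) in *.
  destruct (UC_deriv _ _ _ Ub) as [b1 [Hb1 Ub1]].
  destruct (UC_bound _ _ _ Uz1) as [Kz1 [HKz1 Bz1]].
  destruct (UC_bound _ _ _ Uz) as [Kz [HKz Bz]].
  destruct (UC_bound _ _ _ Ub) as [Kb [HKb Bb]].
  assert (Hz1le : forall kap s, D kap s -> z0 <= z1 kap s <= Kz1).
  { intros kap s Hs; split; [apply Hz, Hs | eapply Rle_trans; [apply Rle_abs | apply Bz1, Hs]]. }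
  assert (Hblow : forall kap s, D kap s -> k0 * / Kz1 <= b kap s).
  { intros kap s Hs. destruct (Hp kap s Hs) as [Hp0 _]. destruct (Hz1le kap s Hs) as [Hl Hu].
    apply Rmult_le_compat; [lra | apply Rlt_le, Rinv_0_lt_compat; lra | exact Hp0 |].
    apply Rinv_le_contravar; lra. }
  set (bm := k0 * / Kz1) in *.
  assert (Hbm : 0 < bm) by (apply Rmult_lt_0_compat; [lra | apply Rinv_0_lt_compat; lra]).
  assert (Hbup : forall kap s, D kap s -> b kap s <= Kb).
  { intros kap s Hs; eapply Rle_trans; [apply Rle_abs | apply Bb, Hs]. }
  assert (Ua : UC D 1 (fun kap s => b1 kap s * / (2 * (b kap s * z1 kap s)))).
  { apply UC_mult; [exact Ub1 |].
    apply UC_inv with (2 * (bm * z0)); [apply open_kdom | | |].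
    - apply Rmult_lt_0_compat; [lra | apply Rmult_lt_0_compat; lra].
    - intros kap s Hs. apply Rmult_le_compat_l; [lra |].
      destruct (Hz1le kap s Hs). apply Rmult_le_compat; try lra. apply Hblow, Hs.
    - apply (UC_mult D 1 (fun _ _ => 2)); [apply UC_cst |].
      apply UC_mult; (apply (UC_le D 2); [lia | assumption]). }
  set (a := fun kap s => b1 kap s * / (2 * (b kap s * z1 kap s))) in *.
  destruct (UC_deriv _ _ _ Ua) as [a1 [Ha1 Ua1]].
  destruct (UC_bound _ _ _ Ua) as [Ka [HKa Ba]].
  destruct (UC_bound _ _ _ Ua1) as [Ka1 [HKa1 Ba1]].
  set (Kpsi := / m0 * (Ka1 * / z0 + Ka ^ 2)).
  assert (Him0 : 0 < / m0) by (apply Rinv_0_lt_compat, Hm0).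
  assert (Hiz0 : 0 < / z0) by (apply Rinv_0_lt_compat, Hz0).
  assert (Hibm : 0 < / bm) by (apply Rinv_0_lt_compat, Hbm).
  assert (HiKb : 0 < / Kb) by (apply Rinv_0_lt_compat, HKb).
  assert (HKa2 : 0 < Ka ^ 2) by (apply pow_lt, HKa).
  assert (HKpsi : 0 < Kpsi).
  { apply Rmult_lt_0_compat; [lra |].
    assert (0 < Ka1 * / z0) by (apply Rmult_lt_0_compat; lra). lra. }
  (* [Kpsi eps] bounds the shift of [L] from [L0], and [lyapunov_exists] tolerates [d / 2] with
     [d = M eps]. *)
  set (M := 2 * Kpsi).
  assert (HK : m0 <= K) by (specialize (Hc km); lra).
  (* [C1 / eps] will bound [1 + L0 + xi^2], [C2 / eps] the ratio of [W^2 + V^2] to [y^2 + u^2], and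
     [C3 eps y^2], from below, the growth rate of the form. *)
  set (C1 := 1 + K * km ^ 2 + K * Kz ^ 2).
  set (C2 := / bm + 2 * / m0 * (Kb + Ka ^ 2 * / bm)).
  set (C3 := sqrt m0 * z0 * (M / 2) * / Kb).
  (* Beyond [S1] the coefficient [(s^2 - kap^2) Xp] is at least [(S1^2 - km^2) k0] for all
     [kap <= km]. *)
  set (kk := Rmin k0 ((S1 ^ 2 - km ^ 2) * k0)).
  assert (HS1 : 0 < (S1 ^ 2 - km ^ 2) * k0).
  { apply Rmult_lt_0_compat; [nra | exact Hk0]. }
  assert (Hkk : 0 < kk) by (apply Rmin_glb_lt; lra).
  assert (Hkk1 : kk <= k0) by apply Rmin_l.
  assert (Hkk2 : kk <= (S1 ^ 2 - km ^ 2) * k0) by apply Rmin_r.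
  set (C4 := / (2 * kk ^ 2 * (S2 - Sm) * (S4 - S3))).
  set (rate := 2 * kk * (S3 - S2)).
  assert (Hrate : 0 < rate) by (apply Rmult_lt_0_compat; lra).
  assert (HC4d : 0 < 2 * kk ^ 2 * (S2 - Sm) * (S4 - S3)).
  { repeat apply Rmult_lt_0_compat; try lra; nra. }
  assert (HC4 : 0 < C4) by (apply Rinv_0_lt_compat, HC4d).
  assert (HC1 : 1 <= C1).
  { assert (0 <= K * km ^ 2) by (apply Rmult_le_pos; [lra | apply pow2_ge_0]).
    assert (0 <= K * Kz ^ 2) by (apply Rmult_le_pos; [lra | apply pow2_ge_0]). unfold C1; lra. }
  assert (HC2 : 0 < C2).
  { assert (0 < Ka ^ 2 * / bm) by (apply Rmult_lt_0_compat; lra).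
    assert (0 < 2 * / m0 * (Kb + Ka ^ 2 * / bm))
      by (apply Rmult_lt_0_compat; lra). unfold C2; lra. }
  assert (Hsm0 : 0 < sqrt m0) by (apply sqrt_lt_R0, Hm0).
  assert (HM : 0 < M) by (unfold M; lra).
  assert (HC3 : 0 < C3).
  { assert (HM2 : 0 < M / 2) by lra.
    exact (Rmult_lt_0_compat _ _ (Rmult_lt_0_compat _ _
      (Rmult_lt_0_compat _ _ Hsm0 Hz0) HM2) HiKb). }
  assert (HC12 : 0 < C1 ^ 2) by (apply pow_lt; lra).
  assert (H12 : 0 < 12) by lra.
  set (C5 := 12 * C1 ^ 2 * C2 * C4).
  assert (HC5 : 0 < C5).
  { exact (Rmult_lt_0_compat _ _ (Rmult_lt_0_compat _ _
      (Rmult_lt_0_compat _ _ H12 HC12) HC2) HC4). }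
  (* The threshold below which [C5 / eps * (27 eps^3 / rate^3)] is smaller than the growth
     [C3 (Sm - S1) eps]. *)
  set (e1 := C3 * (Sm - S1) * rate ^ 3 / (27 * C5)).
  assert (Hr3 : 0 < rate ^ 3) by (apply pow_lt, Hrate).
  assert (He1 : 0 < e1).
  { apply Rmult_lt_0_compat; [| apply Rinv_0_lt_compat; lra].
    apply Rmult_lt_0_compat; [apply Rmult_lt_0_compat; lra | exact Hr3]. }
  (* Below [/ M] the distance [d = M eps] is at most 1, as [lyapunov_exists] requires. *)
  exists M, (Rmin 1 (Rmin (/ M) e1)). split; [exact HM |]. split.
  { repeat apply Rmin_glb_lt; try lra. apply Rinv_0_lt_compat, HM. }
  intros eps kap y u Heps Hk Hy Hu Hsr Hsl Hj.
  assert (He : 0 < eps) by lra.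
  assert (Helt1 : eps < 1) by (eapply Rlt_le_trans; [apply Heps | apply Rmin_l]).
  assert (HeM : eps < / M).
  { eapply Rlt_le_trans; [apply Heps |]. eapply Rle_trans; [apply Rmin_r | apply Rmin_l]. }
  assert (Hee1 : eps < e1).
  { eapply Rlt_le_trans; [apply Heps |]. eapply Rle_trans; [apply Rmin_r | apply Rmin_r]. }
  assert (HMe : M * eps <= 1).
  { apply Rmult_lt_compat_l with (r := M) in HeM; [| exact HM]. rewrite Rinv_r in HeM; lra. }
  assert (HMe0 : 0 < M * eps) by (apply Rmult_lt_0_compat; lra).
  assert (Hie1 : 1 <= / eps) by (rewrite <- Rinv_1; apply Rinv_le_contravar; lra).
  pose proof (Hc kap Hk) as Hck.
  assert (HDs : forall s, - S < s < S -> D kap s) by (intros s Hs; split; assumption).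
  set (g := sqrt (c kap / eps)).
  assert (Hcie : 0 < c kap / eps) by (apply Rmult_lt_0_compat; lra).
  assert (Hgg : g * g = c kap / eps) by (apply sqrt_sqrt; lra).
  assert (Hgm : sqrt m0 <= g).
  { apply sqrt_le_1_alt. rewrite <- (Rmult_1_r m0).
    apply Rmult_le_compat; lra. }
  set (L0 := c kap * kap ^ 2 / eps) in *.
  assert (HL0 : 0 < L0).
  { apply Rmult_lt_0_compat; [apply Rmult_lt_0_compat; [lra | apply pow_lt; lra] | lra]. }
  destruct (lyapunov_exists L0 (M * eps) HL0 (conj HMe0 HMe) Hj) as [Rf [HRd HRb]].
  set (W := fun s => y s / sqrt (b kap s)).
  set (V := fun s => (sqrt (b kap s) * u s / eps - a kap s * W s) / g).
  set (Rs := fun s => Rf (g * z kap s) (W s) (V s)).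
  assert (HWy : forall s, - S < s < S -> y s ^ 2 * / Kb <= W s ^ 2 <= y s ^ 2 * / bm).
  { intros s Hs. pose proof (Hblow kap s (HDs s Hs)) as Hb0. pose proof (Hbup kap s (HDs s Hs)) as Hb2.
    assert (Hsb : 0 < sqrt (b kap s)) by (apply sqrt_lt_R0; lra).
    assert (E : W s ^ 2 = y s ^ 2 * / b kap s).
    { unfold W. rewrite <- (sqrt_sqrt (b kap s)) at 2 by lra. field. lra. }
    rewrite E. pose proof (pow2_ge_0 (y s)).
    split; apply Rmult_le_compat_l; try assumption; apply Rinv_le_contravar; lra. }
  assert (HRder : forall s, - S < s < S -> is_derive Rs s (Derive Rs s) /\
     C3 * eps * y s ^ 2 <= Derive Rs s).
  { intros s Hs. pose proof (HDs s Hs) as Hd. destruct (Hz kap s Hd) as [Hzd [Hz1l Hrel]].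
    pose proof (Hblow kap s Hd) as Hb0.
    destruct (liouville_transform eps (c kap) kap g s y u (z kap) (b kap) (p kap) (Xp kap)
      (z1 kap) (a1 kap) (b1 kap)) as [T1 [T2 T3]]; try assumption; try lra.
    - reflexivity.
    - apply Hy, Hs.
    - apply Hu, Hs.
    - apply Hb1, Hd.
    - apply (Ha1 kap s Hd).
    - destruct (HRd (fun s => g * z kap s) W V (g * z1 kap s)
        (c kap * kap ^ 2 / eps + eps / c kap * (a1 kap s / z1 kap s - a kap s ^ 2)) s)
        as [l [Hl Hl2]]; try assumption.
      + apply Rmult_le_pos; lra.
      + fold L0. replace (L0 + eps / c kap * (a1 kap s / z1 kap s - a kap s ^ 2) - L0)
          with (eps * (/ c kap * (a1 kap s * / z1 kap s - a kap s ^ 2))) by (field; lra).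
        rewrite Rabs_mult, (Rabs_right eps) by lra. unfold M.
        replace (2 * Kpsi * eps / 2) with (eps * Kpsi) by field.
        apply Rmult_le_compat_l; [lra |]. rewrite Rabs_mult.
        assert (Hic : 0 < / c kap) by (apply Rinv_0_lt_compat; lra).
        assert (Hiz1 : 0 < / z1 kap s) by (apply Rinv_0_lt_compat; lra).
        apply Rmult_le_compat; try apply Rabs_pos.
        * rewrite Rabs_right by lra. apply Rinv_le_contravar; lra.
        * eapply Rle_trans; [apply Rabs_triang |]. rewrite Rabs_Ropp, Rabs_mult.
          rewrite (Rabs_right (/ z1 kap s)) by lra. apply Rplus_le_compat.
          -- apply Rmult_le_compat; [apply Rabs_pos | lra | apply Ba1, Hd |].
             apply Rinv_le_contravar; lra.
          -- rewrite <- RPow_abs. apply pow_incr. split; [apply Rabs_pos | apply Ba, Hd].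
      + assert (HDl : Derive Rs s = l) by (apply is_derive_unique; exact Hl).
        rewrite HDl. split; [exact Hl |].
        eapply Rle_trans; [| exact Hl2]. destruct (HWy s Hs) as [HW1 _].
        unfold C3. replace (sqrt m0 * z0 * (M / 2) * / Kb * eps * y s ^ 2)
          with (sqrt m0 * z0 * (M * eps / 2) * (y s ^ 2 * / Kb)) by (field; lra).
        pose proof (pow2_ge_0 (y s)).
        apply Rmult_le_compat; [| apply Rmult_le_pos; lra | | exact HW1].
        * apply Rmult_le_pos; [apply Rmult_le_pos; lra | lra].
        * apply Rmult_le_compat_r; [lra |]. apply Rmult_le_compat; lra. }
  assert (HRbd : forall s, - S < s < S -> Rabs (Rs s) <= 12 * C1 ^ 2 * C2 / eps ^ 3 * (y s ^ 2 + u s ^ 2)).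
  { intros s Hs. pose proof (HDs s Hs) as Hd.
    pose proof (Hblow kap s Hd) as Hb0. pose proof (Hbup kap s Hd) as Hb2.
    eapply Rle_trans; [apply HRb |].
    pose proof (pow2_ge_0 (y s)) as Hy2. pose proof (pow2_ge_0 (u s)) as Hu2.
    assert (B1 : 1 + L0 + (g * z kap s) ^ 2 <= C1 / eps).
    { assert (E : (g * z kap s) ^ 2 = c kap / eps * z kap s ^ 2) by (rewrite <- Hgg; ring).
      unfold L0, C1.
      assert (kap ^ 2 <= km ^ 2) by (apply pow_incr; lra).
      assert (z kap s ^ 2 <= Kz ^ 2).
      { rewrite <- (pow2_abs (z kap s)). apply pow_incr. split; [apply Rabs_pos | apply Bz, Hd]. }
      assert (c kap * kap ^ 2 <= K * km ^ 2) by (apply Rmult_le_compat; try lra; apply pow2_ge_0).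
      assert (c kap * z kap s ^ 2 <= K * Kz ^ 2) by (apply Rmult_le_compat; try lra; apply pow2_ge_0).
      assert ((c kap * kap ^ 2 + c kap * z kap s ^ 2) * / eps <= (K * km ^ 2 + K * Kz ^ 2) * / eps)
        by (apply Rmult_le_compat_r; lra).
      lra. }
    assert (B0 : 0 <= 1 + L0 + (g * z kap s) ^ 2) by (pose proof (pow2_ge_0 (g * z kap s)); lra).
    (* [V] contains [u / eps] but also [/ g], whose square is of order [eps]: in all [V^2] costs one
       power of [/ eps]. *)
    assert (HV : V s ^ 2 <= / eps * (2 * / m0 * (Kb + Ka ^ 2 * / bm)) * (y s ^ 2 + u s ^ 2)).
    { set (t := sqrt (b kap s)) in *.
      assert (Htt : t * t = b kap s) by (apply sqrt_sqrt; lra).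
      assert (E : V s ^ 2 = (t * u s / eps - a kap s * W s) ^ 2 * / (g * g)).
      { unfold V. fold t. field. lra. }
      rewrite E, Hgg.
      assert (A0 : (t * u s / eps - a kap s * W s) ^ 2
         <= 2 * (b kap s * u s ^ 2 * / eps * / eps + a kap s ^ 2 * W s ^ 2)).
      { rewrite <- Htt. pose proof (pow2_ge_0 (t * u s / eps + a kap s * W s)) as Hsq.
        lra. }
      assert (A1 : b kap s * u s ^ 2 <= Kb * u s ^ 2) by (apply Rmult_le_compat_r; lra).
      assert (A2 : a kap s ^ 2 * W s ^ 2 <= Ka ^ 2 * (y s ^ 2 * / bm)).
      { apply Rmult_le_compat; try apply pow2_ge_0; [| apply HWy, Hs].
        rewrite <- (pow2_abs (a kap s)). apply pow_incr. split; [apply Rabs_pos | apply Ba, Hd]. }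
      assert (A3 : (t * u s / eps - a kap s * W s) ^ 2
         <= 2 * / eps * / eps * (Kb + Ka ^ 2 * / bm) * (y s ^ 2 + u s ^ 2)).
      { eapply Rle_trans; [exact A0 |].
        assert (Hi2 : 1 <= / eps * / eps) by nra.
        assert (HX : 0 < Ka ^ 2 * / bm) by (apply Rmult_lt_0_compat; lra).
        set (X := Ka ^ 2 * / bm) in *.
        assert (F1 : b kap s * u s ^ 2 * / eps * / eps <= / eps * / eps * (Kb * u s ^ 2)).
        { rewrite Rmult_assoc, Rmult_comm. apply Rmult_le_compat_l; lra. }
        assert (F2 : a kap s ^ 2 * W s ^ 2 <= / eps * / eps * (X * y s ^ 2)).
        { eapply Rle_trans; [exact A2 |].
          replace (Ka ^ 2 * (y s ^ 2 * / bm)) with (1 * (X * y s ^ 2)) by (unfold X; ring).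
          apply Rmult_le_compat_r; [apply Rmult_le_pos; lra | exact Hi2]. }
        assert (F3 : 0 <= / eps * / eps * (Kb * y s ^ 2 + X * u s ^ 2)).
        { apply Rmult_le_pos; [lra |]. apply Rplus_le_le_0_compat; apply Rmult_le_pos; lra. }
        lra. }
      assert (Hice : / (c kap / eps) <= eps * / m0).
      { replace (/ (c kap / eps)) with (eps * / c kap) by (field; lra).
        apply Rmult_le_compat_l; [lra |]. apply Rinv_le_contravar; lra. }
      apply Rle_trans with ((2 * / eps * / eps * (Kb + Ka ^ 2 * / bm) * (y s ^ 2 + u s ^ 2)) * (eps * / m0)).
      - apply Rmult_le_compat; [apply pow2_ge_0 | apply Rlt_le, Rinv_0_lt_compat, Hcie | exact A3 | exact Hice].
      - apply Req_le. field. lra. }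
    assert (HW2 : W s ^ 2 <= / eps * / bm * (y s ^ 2 + u s ^ 2)).
    { eapply Rle_trans; [apply HWy, Hs |].
      assert (1 * / bm <= / eps * / bm) by (apply Rmult_le_compat_r; lra).
      rewrite Rmult_comm. apply Rmult_le_compat; lra. }
    assert (HWV : W s ^ 2 + V s ^ 2 <= C2 / eps * (y s ^ 2 + u s ^ 2)).
    { unfold C2. eapply Rle_trans; [apply Rplus_le_compat; [exact HW2 | exact HV] |].
      apply Req_le; field; lra. }
    apply Rle_trans with (12 * (C1 / eps) ^ 2 * (C2 / eps * (y s ^ 2 + u s ^ 2))).
    - apply Rmult_le_compat; [| | | exact HWV].
      + apply Rmult_le_pos; [lra | apply pow2_ge_0].
      + pose proof (pow2_ge_0 (W s)); pose proof (pow2_ge_0 (V s)); lra.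
      + apply Rmult_le_compat_l; [lra |]. apply pow_incr; split; assumption.
    - apply Req_le; field; lra. }
  assert (Hmono : forall s t, - S < s -> s <= t -> t < S -> Rs s <= Rs t).
  { intros s t Hs Hst Ht. apply (is_derive_le_compat Rs (Derive Rs)); [exact Hst | |].
    - intros x Hx; apply HRder; lra.
    - intros x Hx. destruct (HRder x) as [_ Hx2]; [lra |].
      eapply Rle_trans; [| exact Hx2]. apply Rmult_le_pos; [apply Rmult_le_pos; lra | apply pow2_ge_0]. }
  assert (Hgrow : forall s t w, - S < s -> s <= t -> t < S ->
     (forall x, s <= x <= t -> w <= y x ^ 2) -> C3 * eps * w * (t - s) <= Rs t - Rs s).
  { intros s t w Hs Hst Ht Hw.
    assert (H : Rs s - C3 * eps * w * s <= Rs t - C3 * eps * w * t); [| lra].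
    apply (is_derive_le_compat (fun x => Rs x - C3 * eps * w * x)
      (fun x => Derive Rs x - C3 * eps * w)); [exact Hst | |].
    - intros x Hx. apply (is_derive_minus Rs (fun x => C3 * eps * w * x)); [apply HRder; lra |].
      auto_derive; [exact Logic.I | ring].
    - intros x Hx. destruct (HRder x) as [_ Hx2]; [lra |]. specialize (Hw x Hx).
      assert (C3 * eps * w <= C3 * eps * y x ^ 2)
        by (apply Rmult_le_compat_l; [apply Rmult_le_pos; lra | exact Hw]). lra. }
  assert (Hdlow : forall s, S1 ^ 2 <= s ^ 2 -> - S < s < S -> kk <= - ((kap ^ 2 - s ^ 2) * Xp kap s)).
  { intros s Hs Hs2. destruct (Hp kap s (HDs s Hs2)) as [_ HX].
    eapply Rle_trans; [exact Hkk2 |].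
    replace (- ((kap ^ 2 - s ^ 2) * Xp kap s)) with ((s ^ 2 - kap ^ 2) * Xp kap s) by ring.
    assert (kap ^ 2 <= km ^ 2) by (apply pow_incr; lra). assert (km ^ 2 < S1 ^ 2) by nra.
    apply Rmult_le_compat; lra. }
  destruct (forbidden_decay eps kk S1 Sm S2 S3 S4 y u (p kap)
    (fun s => - ((kap ^ 2 - s ^ 2) * Xp kap s))) as [Dr [sr [Hsr1 Hsr2]]]; try assumption.
  { intros s Hs; apply Hy; lra. }
  { intros s Hs; apply Hu; lra. }
  { intros s Hs. eapply Rle_trans; [exact Hkk1 |]. apply Hp, HDs; lra. }
  { intros s Hs. apply Hdlow; [apply pow_incr; lra | lra]. }
  (* Reflection with a change of sign of [u] preserves the form of the system and turns the sign
     condition on the left into the one on the right. *)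
  destruct (forbidden_decay eps kk S1 Sm S2 S3 S4 (fun s => y (- s)) (fun s => - u (- s))
    (fun s => p kap (- s)) (fun s => - ((kap ^ 2 - (- s) ^ 2) * Xp kap (- s))))
    as [Dl [sl [Hsl1 Hsl2]]]; try assumption.
  { intros s Hs. eapply is_derive_eq; [apply is_derive_refl, Hy; lra | as_R; field; lra]. }
  { intros s Hs. eapply is_derive_eq.
    - apply (is_derive_opp (fun s => u (- s))), is_derive_refl, Hu; lra.
    - to_R. field; lra. }
  { intros s Hs. eapply Rle_trans; [exact Hkk1 |]. apply Hp, HDs; lra. }
  { intros s Hs. apply Hdlow; [| lra]. replace ((- s) ^ 2) with (s ^ 2) by ring. apply pow_incr; lra. }
  { intros s Hs. specialize (Hsl (- s)). lra. }
  set (A := y Sm ^ 2 + y (- Sm) ^ 2).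
  pose proof (pow2_ge_0 (y Sm)) as Hy1. pose proof (pow2_ge_0 (y (- Sm))) as Hy2.
  assert (HA : A = 0).
  { destruct (Req_dec A 0) as [H0|H0]; [exact H0 | exfalso].
    assert (HA0 : 0 < A) by (unfold A in *; lra).
    assert (G1 : C3 * eps * y Sm ^ 2 * (Sm - S1) <= Rs Sm - Rs S1)
      by (apply Hgrow; try lra; exact Dr).
    assert (G2 : C3 * eps * y (- Sm) ^ 2 * (- S1 - - Sm) <= Rs (- S1) - Rs (- Sm)).
    { apply Hgrow; try lra. intros x Hx. replace x with (- - x) by ring. apply Dl; lra. }
    pose proof (Hmono Sm sr ltac:(lra) ltac:(lra) ltac:(lra)) as G3.
    pose proof (Hmono (- S1) S1 ltac:(lra) ltac:(lra) ltac:(lra)) as G4.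
    pose proof (Hmono (- sl) (- Sm) ltac:(lra) ltac:(lra) ltac:(lra)) as G5.
    pose proof (HRbd sr ltac:(lra)) as B1. pose proof (HRbd (- sl) ltac:(lra)) as B2.
    fold rate in Hsr2, Hsl2.
    assert (Hexp : exp (- (rate / eps)) <= 27 * eps ^ 3 / rate ^ 3).
    { eapply Rle_trans; [apply exp_neg_cube; apply Rmult_lt_0_compat; lra |].
      apply Req_le; field; lra. }
    set (X := exp (- (rate / eps))) in *.
    assert (HCe : 0 < 12 * C1 ^ 2 * C2 / eps ^ 3).
    { apply Rmult_lt_0_compat; [| apply Rinv_0_lt_compat, pow_lt, He].
      exact (Rmult_lt_0_compat _ _ (Rmult_lt_0_compat _ _ H12 HC12) HC2). }
    assert (U1 : Rabs (Rs sr) + Rabs (Rs (- sl)) <= C5 / eps * X * A).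
    { apply Rle_trans with (12 * C1 ^ 2 * C2 / eps ^ 3 * ((y sr ^ 2 + u sr ^ 2)
        + (y (- sl) ^ 2 + u (- sl) ^ 2))); [lra |].
      apply Rle_trans with (12 * C1 ^ 2 * C2 / eps ^ 3 * (eps ^ 2 * C4 * X * A)).
      - apply Rmult_le_compat_l; [lra |]. unfold A, C4.
        lra.
      - apply Req_le; unfold C5; field; lra. }
    assert (U2 : C5 / eps * X * A <= C5 / eps * (27 * eps ^ 3 / rate ^ 3) * A).
    { apply Rmult_le_compat_r; [lra |]. apply Rmult_le_compat_l; [| exact Hexp].
      apply Rmult_le_pos; lra. }
    assert (U3 : C5 / eps * (27 * eps ^ 3 / rate ^ 3) * A < C3 * (Sm - S1) * eps * A).
    { apply Rmult_lt_compat_r; [exact HA0 |].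
      replace (C5 / eps * (27 * eps ^ 3 / rate ^ 3)) with (27 * C5 / rate ^ 3 * eps * eps)
        by (field; lra).
      apply Rmult_lt_compat_r; [exact He |].
      replace (C3 * (Sm - S1)) with (27 * C5 / rate ^ 3 * e1) by (unfold e1; field; lra).
      apply Rmult_lt_compat_l; [| exact Hee1].
      apply Rmult_lt_0_compat; [lra | apply Rinv_0_lt_compat, Hr3]. }
    pose proof (Rle_abs (Rs sr)) as Q1. pose proof (Rle_abs (- Rs (- sl))) as Q2.
    rewrite Rabs_Ropp in Q2. unfold A in *. lra. }
  (* With [y Sm = 0] the decay estimate makes [y^2 + u^2] vanish at [sr]. *)
  exists sr. split; [lra |].
  assert (Hysm : y Sm ^ 2 = 0) by (unfold A in HA; lra).
  rewrite Hysm, Rmult_0_r in Hsr2.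
  pose proof (pow2_ge_0 (y sr)) as Q1. pose proof (pow2_ge_0 (u sr)) as Q2.
  split; [assert (E : y sr * y sr = 0) by lra | assert (E : u sr * u sr = 0) by lra];
    apply Rmult_integral in E; tauto.
Qed.

End Mismatch.

(** * The Morse coordinate *)

Lemma continuous_bound (f : R -> R) a b : (forall x, a <= x <= b -> continuous f x) ->
  exists K, forall x, a <= x <= b -> Rabs (f x) <= K.
Proof.
  intros Hf. destruct (bounded_continuity f a b) as [K HK]; [exact Hf |].
  exists K; intros x Hx; apply Rlt_le, (HK x Hx).
Qed.

Lemma continuous_pos_bound (f : R -> R) a b : a <= b ->
  (forall x, a <= x <= b -> continuous f x) -> (forall x, a <= x <= b -> 0 < f x) ->
  exists k, 0 < k /\ forall x, a <= x <= b -> k <= f x.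
Proof.
  intros Hab Hf Hp. destruct (continuity_ab_min f a b Hab) as [x0 [Hx0 Hx0i]].
  - intros x Hx; apply continuity_pt_filterlim, Hf, Hx.
  - exists (f x0); split; [apply Hp, Hx0i | exact Hx0].
Qed.

Lemma Ck_UC n f a : Ck n f -> UC (ivl (- a) a) n (fun _ => f).
Proof.
  intros [Hex Hc].
  assert (H : forall j k, (k + j = n)%nat -> UC (ivl (- a) a) j (fun _ => Derive_n f k)).
  { induction j as [|j IH]; intros k Hk.
    - replace k with n by lia.
      destruct (continuous_bound (Derive_n f n) (- a) a) as [K HK]; [intros; apply Hc |].
      split; [exists K; intros i x [H1 H2]; apply HK; lra |].
      split; [intros; apply Hc | exact Logic.I].
    - assert (Hd : forall x, is_derive (Derive_n f k) x (Derive_n f (S k) x)).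
      { intros x. apply Derive_correct. apply (Hex (S k) x). lia. }
      destruct (continuous_bound (Derive_n f k) (- a) a) as [K HK].
      { intros x _. apply (is_derive_cont _ x _ (Hd x)). }
      split; [exists K; intros i x [H1 H2]; apply HK; lra |].
      split; [intros i x _; apply (is_derive_cont _ x _ (Hd x)) |].
      exists (fun _ => Derive_n f (S k)). split; [intros i x _; apply Hd | apply IH; lia]. }
  apply (H n 0%nat); lia.
Qed.

Lemma dilated_ftc (f f1 : R -> R) s :
  (forall x, is_derive f x (f1 x)) -> (forall x, continuous f1 x) ->
  s * RInt (fun v => f1 (s * v)) 0 1 = f s - f 0.
Proof.
  intros Hf Hc. rewrite <- RInt_scal_R.
  - apply (is_RInt_unique (V := R_CompleteNormedModule)).
    replace (f s - f 0) with (f (s * 1) - f (s * 0)) by (f_equal; f_equal; ring).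
    apply (is_RInt_derive (fun v => f (s * v)) (fun v => s * f1 (s * v))).
    + intros v _. apply (is_derive_comp f (fun v => s * v)); [apply Hf |].
      auto_derive; [exact Logic.I | ring].
    + intros v _. apply (continuous_scal_r s (fun v => f1 (s * v))).
      apply (continuous_comp (fun v => s * v) f1); [| apply Hc].
      apply @ex_derive_continuous; auto_derive; exact Logic.I.
  - apply ex_RInt_cont; [lra |]; intros v _.
    apply (continuous_comp (fun v => s * v) f1); [| apply Hc].
    apply @ex_derive_continuous; auto_derive; exact Logic.I.
Qed.

Lemma cont_id w : continuous (fun w : R => w) w.
Proof. apply continuous_id. Qed.

Lemma id_01 w : 0 <= w <= 1 -> 0 <= w <= 1.
Proof. tauto. Qed.

Section Morse.
Context (rp : R -> R) (r0 : R).
Context (rp_C5 : Ck 5 rp) (rp_0 : rp 0 = r0) (drp_0 : Derive rp 0 = 0).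
Context (d2rp_0 : 0 < Derive_n rp 2 0).
Context (drp_pos : forall x, 0 < x -> 0 < Derive rp x).
Context (drp_neg : forall x, x < 0 -> Derive rp x < 0).

Let r1 := Derive rp.
Let r2 := Derive_n rp 2.

Lemma rp_derive x : is_derive rp x (r1 x).
Proof. apply Derive_correct, (proj1 rp_C5 1%nat x); lia. Qed.

Lemma r1_derive x : is_derive r1 x (r2 x).
Proof. apply Derive_correct, (proj1 rp_C5 2%nat x); lia. Qed.

Lemma r2_cont x : continuous r2 x.
Proof.
  apply (is_derive_cont r2 x (Derive_n rp 3 x)). apply Derive_correct, (proj1 rp_C5 3%nat x); lia.
Qed.

Lemma rp_incr x y : 0 <= x -> x < y -> rp x < rp y.
Proof.
  intros Hx Hxy. destruct (MVT_is_derive rp r1 x y Hxy) as [c [Hc Hcc]]; [intros; apply rp_derive |].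
  assert (0 < r1 c) by (apply drp_pos; lra).
  assert (0 < r1 c * (y - x)) by (apply Rmult_lt_0_compat; lra). lra.
Qed.

Lemma rp_decr x y : y <= 0 -> x < y -> rp y < rp x.
Proof.
  intros Hx Hxy. destruct (MVT_is_derive rp r1 x y Hxy) as [c [Hc Hcc]]; [intros; apply rp_derive |].
  assert (r1 c < 0) by (apply drp_neg; lra). nra.
Qed.

Lemma rp_gt x : x <> 0 -> r0 < rp x.
Proof.
  intros Hx; rewrite <- rp_0. destruct (Rdichotomy x 0 Hx) as [H|H].
  - apply rp_decr; lra.
  - apply rp_incr; lra.
Qed.

(* [k1 = r1 / x] and [g = (rp - r0) / x^2], continued smoothly to [x = 0]. *)
Let k1 := dilated (fun _ => 1) (fun w => w) 0 r2.
Let g := dilated (fun w => w) (fun w => w) 0 k1.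

(** Two of the five derivatives go here; passing from [r2] to [k1] and [g] is averaging and costs
    none. *)
Lemma UC_r2 a : UC (ivl (- a) a) 3 (fun _ => r2).
Proof.
  pose proof (Ck_UC 5 rp a rp_C5) as H.
  destruct (UC_Derive _ 4 _ (open_ivl (- a) a) H) as [_ H1].
  destruct (UC_Derive _ 3 _ (open_ivl (- a) a) H1) as [_ H2]. exact H2.
Qed.

Lemma UC_k1 a : 0 < a -> UC (ivl (- a) a) 3 (fun _ => k1).
Proof.
  intros Ha. apply (dilated_UC (fun w => w) 0 (- a) a cont_id id_01);
    [lra | intros; apply continuous_const | apply UC_r2].
Qed.

Lemma UC_g a : 0 < a -> UC (ivl (- a) a) 3 (fun _ => g).
Proof.
  intros Ha. apply (dilated_UC (fun w => w) 0 (- a) a cont_id id_01);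
    [lra | exact cont_id | apply UC_k1, Ha].
Qed.

Lemma k1_cont x : continuous k1 x.
Proof.
  assert (H : 0 < Rabs x + 1) by (pose proof (Rabs_pos x); lra).
  apply (UC_cont _ _ _ (UC_k1 _ H) tt x). apply Rabs_lt_between. lra.
Qed.

Lemma k1_eq x : x * k1 x = r1 x.
Proof.
  transitivity (x * RInt (fun v => r2 (x * v)) 0 1).
  - f_equal. apply RInt_ext; intros v _.
    as_R. rewrite Rmult_1_l, Rplus_0_l, Rminus_0_r. reflexivity.
  - rewrite (dilated_ftc r1 r2) by (apply r1_derive || apply r2_cont).
    unfold r1 at 2. rewrite drp_0. ring.
Qed.

Lemma g_eq x : x ^ 2 * g x = rp x - r0.
Proof.
  rewrite <- rp_0. rewrite <- (dilated_ftc rp r1).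
  - simpl. rewrite Rmult_1_r, Rmult_assoc. f_equal. unfold g, dilated.
    rewrite <- RInt_scal_R.
    + apply RInt_ext; intros v _. as_R. rewrite <- k1_eq. rewrite Rplus_0_l, Rminus_0_r. ring.
    + apply ex_RInt_cont; [lra |]; intros v _.
      apply (continuous_mult (fun v => v) (fun v => k1 (0 + (x - 0) * v))); [apply cont_id |].
      apply (continuous_comp (fun v => 0 + (x - 0) * v) k1); [| apply k1_cont].
      apply @ex_derive_continuous; auto_derive; exact Logic.I.
  - apply rp_derive.
  - intros y. apply (is_derive_cont r1 y (r2 y)), r1_derive.
Qed.

Lemma k1_0 : k1 0 = r2 0.
Proof.
  transitivity (RInt (fun _ => r2 0) 0 1).
  - apply RInt_ext; intros v _. as_R. rewrite Rmult_1_l. f_equal. ring.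
  - rewrite RInt_const. to_R. ring.
Qed.

Lemma g_0 : g 0 = k1 0 / 2.
Proof.
  transitivity (RInt (fun v => v * k1 0) 0 1).
  - apply RInt_ext; intros v _. as_R. do 2 f_equal. ring.
  - rewrite (RInt_poly _ (fun v => v ^ 2 / 2 * k1 0)).
    + field.
    + intros x; auto_derive; [exact Logic.I | field].
    + intros x; apply @ex_derive_continuous; auto_derive; exact Logic.I.
Qed.

Lemma k1_pos x : 0 < k1 x.
Proof.
  destruct (Rtotal_order x 0) as [H|[->|H]].
  - pose proof (k1_eq x) as E. pose proof (drp_neg x H) as Hn. fold r1 in Hn.
    destruct (Rlt_dec 0 (k1 x)) as [Hk|Hk]; [exact Hk | exfalso].
    assert (0 <= x * k1 x) by nra. lra.
  - rewrite k1_0. exact d2rp_0.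
  - pose proof (k1_eq x) as E. pose proof (drp_pos x H) as Hn. fold r1 in Hn.
    destruct (Rlt_dec 0 (k1 x)) as [Hk|Hk]; [exact Hk | exfalso].
    assert (x * k1 x <= 0) by nra. lra.
Qed.

Lemma g_pos x : 0 < g x.
Proof.
  destruct (Req_dec x 0) as [->|H].
  - rewrite g_0. pose proof (k1_pos 0). lra.
  - pose proof (g_eq x) as E. pose proof (rp_gt x H) as Hg.
    destruct (Rlt_dec 0 (g x)) as [Hk|Hk]; [exact Hk | exfalso].
    assert (x ^ 2 * g x <= 0) by nra. lra.
Qed.

Let sc (x : R) : R := x * sqrt (g x).
(** The derivative of [sc], with [g'] eliminated in favour of [k1]; in this form it keeps all three
    derivatives of [g]. *)
Let sc1 (x : R) : R := k1 x * / (2 * sqrt (g x)).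

(** Away from 0 this is the derivative of [x^2 g = rp - r0], divided by [x]; at 0 it reduces to
    [g_0]. *)
Lemma g_derive_rel x : exists g1, is_derive g x g1 /\ 2 * g x + x * g1 = k1 x.
Proof.
  assert (H : 0 < Rabs x + 1) by (pose proof (Rabs_pos x); lra).
  assert (Hx : ivl (- (Rabs x + 1)) (Rabs x + 1) tt x) by (apply Rabs_lt_between; lra).
  destruct (UC_Derive _ 2 _ (open_ivl _ _) (UC_g _ H)) as [Hd _].
  specialize (Hd tt x Hx). exists (Derive g x); split; [exact Hd |].
  destruct (Req_dec x 0) as [->|Hx0].
  - rewrite g_0. field.
  - assert (E : is_derive (fun x => x ^ 2 * g x) x (2 * x * g x + x ^ 2 * Derive g x)).
    { apply is_derive_prod; [auto_derive; [exact Logic.I | ring] | exact Hd]. }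
    assert (E2 : is_derive (fun x => x ^ 2 * g x) x (r1 x)).
    { apply is_derive_ext with (fun x => rp x - r0); [intros; symmetry; apply g_eq |].
      eapply is_derive_eq.
      - apply (is_derive_minus rp (fun _ => r0)); [apply rp_derive | apply @is_derive_const].
      - to_R. ring. }
    apply is_derive_unique in E. apply is_derive_unique in E2.
    apply Rmult_eq_reg_l with x; [| exact Hx0]. rewrite k1_eq. lra.
Qed.

Lemma sc_derive x : is_derive sc x (sc1 x).
Proof.
  destruct (g_derive_rel x) as [g1 [Hg1 Hrel]]. pose proof (g_pos x) as Hg.
  assert (Hs : 0 < sqrt (g x)) by (apply sqrt_lt_R0, Hg).
  pose proof (sqrt_sqrt (g x) (Rlt_le _ _ Hg)) as Hss.
  eapply is_derive_eq.
  - apply (is_derive_prod (fun x => x) (fun x => sqrt (g x))); [apply @is_derive_id |].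
    apply (is_derive_sqrt g); [exact Hg1 | exact Hg].
  - unfold sc1. rewrite <- Hrel. to_R.
    set (t := sqrt (g x)) in *. clearbody t. rewrite <- Hss. field. lra.
Qed.

Lemma sc1_pos x : 0 < sc1 x.
Proof.
  apply Rmult_lt_0_compat; [apply k1_pos | apply Rinv_0_lt_compat].
  apply Rmult_lt_0_compat; [lra | apply sqrt_lt_R0, g_pos].
Qed.

Lemma sc_sq x : sc x ^ 2 = rp x - r0.
Proof.
  rewrite <- g_eq. unfold sc. rewrite Rpow_mult_distr, pow2_sqrt; [reflexivity |].
  apply Rlt_le, g_pos.
Qed.

Lemma sc_incr x y : x < y -> sc x < sc y.
Proof.
  intros Hxy. destruct (MVT_is_derive sc sc1 x y Hxy) as [c [Hc Hcc]]; [intros; apply sc_derive |].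
  pose proof (sc1_pos c). assert (0 < sc1 c * (y - x)) by (apply Rmult_lt_0_compat; lra). lra.
Qed.

Lemma sc_0 : sc 0 = 0.
Proof. unfold sc; ring. Qed.

Lemma sc1_UC a : 0 < a -> UC (ivl (- a) a) 3 (fun _ => sc1).
Proof.
  intros Ha.
  assert (Hgc : forall x, - a <= x <= a -> continuous g x).
  { intros x Hx. assert (Ha1 : 0 < a + 1) by lra.
    apply (UC_cont _ _ _ (UC_g _ Ha1) tt x). split; lra. }
  destruct (continuous_pos_bound g (- a) a) as [k [Hk Hkg]];
    [lra | exact Hgc | intros; apply g_pos |].
  assert (Hs : 0 < sqrt k) by (apply sqrt_lt_R0, Hk).
  apply (UC_mult _ 3 (fun _ => k1) (fun _ x => / (2 * sqrt (g x)))); [apply UC_k1, Ha |].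
  apply UC_inv with (2 * sqrt k); [apply open_ivl | lra | |].
  - intros i x [H1 H2]. apply Rmult_le_compat_l; [lra |]. apply sqrt_le_1_alt, Hkg; lra.
  - apply (UC_mult _ 3 (fun _ _ => 2)); [apply UC_cst |].
    apply UC_sqrt with k; [apply open_ivl | exact Hk | | apply UC_g, Ha].
    intros i x [H1 H2]; apply Hkg; lra.
Qed.

(* The inverse of [sc]: it straightens [rp] to [r0 + s^2]. *)
Lemma morse_coordinate Sb : 0 < Sb ->
  (exists a, 0 < a /\ r0 + Sb ^ 2 < rp a /\ r0 + Sb ^ 2 < rp (- a)) ->
  exists (a x0 : R) (X X1 : R -> R), 0 < a /\ 0 < x0 /\
    UC (ivl (- Sb) Sb) 4 (fun _ => X) /\ UC (ivl (- Sb) Sb) 3 (fun _ => X1) /\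
    (forall s, - Sb < s < Sb -> - a < X s < a /\ rp (X s) = r0 + s ^ 2 /\
       is_derive X s (X1 s) /\ x0 <= X1 s /\ (0 <= s -> 0 <= X s) /\ (s <= 0 -> X s <= 0)) /\
    (forall x s, 0 <= s < Sb -> rp x = r0 + s ^ 2 -> 0 <= x -> x = X s) /\
    (forall x s, - Sb < s <= 0 -> rp x = r0 + s ^ 2 -> x <= 0 -> x = X s).
Proof.
  intros HSb [a [Ha [Hap Ham]]].
  assert (Hsa : Sb < sc a).
  { assert (H : sc 0 < sc a) by (apply sc_incr, Ha). rewrite sc_0 in H.
    pose proof (sc_sq a). nra. }
  assert (Hsma : sc (- a) < - Sb).
  { assert (H : sc (- a) < sc 0) by (apply sc_incr; lra). rewrite sc_0 in H.
    pose proof (sc_sq (- a)). nra. }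
  assert (Hex : forall s, - Sb < s < Sb -> exists x, - a < x < a /\ sc x = s).
  { intros s Hs. destruct (IVT_gen sc (- a) a s) as [x [Hx Hxs]].
    - intros x. apply (is_derive_continuity_pt sc x (sc1 x)), sc_derive.
    - rewrite Rmin_left, Rmax_right by lra. lra.
    - rewrite Rmin_left, Rmax_right in Hx by lra.
      exists x; split; [| exact Hxs].
      destruct (Req_dec x a) as [->|H1]; [lra |].
      destruct (Req_dec x (- a)) as [->|H2]; [lra | lra]. }
  set (X := fun s => epsilon (inhabits 0) (fun x => - a < x < a /\ sc x = s)).
  assert (HX : forall s, - Sb < s < Sb -> - a < X s < a /\ sc (X s) = s).
  { intros s Hs. apply (epsilon_spec (inhabits 0) (fun x => - a < x < a /\ sc x = s)), Hex, Hs. }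
  destruct (UC_bound _ _ _ (sc1_UC a Ha)) as [K1 [HK1 BK1]].
  assert (Hsc1c : forall x, continuous sc1 x).
  { intros x. assert (H : 0 < Rabs x + 1) by (pose proof (Rabs_pos x); lra).
    apply (UC_cont _ _ _ (sc1_UC _ H) tt x). apply Rabs_lt_between. lra. }
  destruct (continuous_pos_bound sc1 (- a) a) as [kl [Hkl Hklx]];
    [lra | intros; apply Hsc1c | intros; apply sc1_pos |].
  assert (Hinj : forall x y, sc x = sc y -> x = y).
  { intros x y H. destruct (Rtotal_order x y) as [H1|[H1|H1]]; [| exact H1 |];
      apply sc_incr in H1; lra. }
  assert (Hlip : forall s t, - Sb < s < Sb -> - Sb < t < Sb ->
     Rabs (X t - X s) * kl <= Rabs (t - s)).
  { assert (Hlt : forall x y, - a < x < a -> - a < y < a -> x < y -> (y - x) * kl <= sc y - sc x).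
    { intros x y Hx Hy Hxy. destruct (MVT_is_derive sc sc1 x y Hxy) as [c [Hc Hcc]];
        [intros; apply sc_derive |].
      rewrite Hc, Rmult_comm. apply Rmult_le_compat_r; [lra | apply Hklx; lra]. }
    intros s t Hs Ht. destruct (HX s Hs) as [Hs1 Hs2]. destruct (HX t Ht) as [Ht1 Ht2].
    destruct (Rtotal_order (X s) (X t)) as [H|[H|H]].
    - specialize (Hlt _ _ Hs1 Ht1 H). rewrite Hs2, Ht2 in Hlt.
      rewrite (Rabs_right (X t - X s)) by lra. eapply Rle_trans; [exact Hlt | apply Rle_abs].
    - rewrite H, Rminus_diag, Rabs_R0. rewrite Rmult_0_l. apply Rabs_pos.
    - specialize (Hlt _ _ Ht1 Hs1 H).
      rewrite (Rabs_left (X t - X s)) by lra. rewrite Rabs_minus_sym.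
      eapply Rle_trans; [| apply Rle_abs]. lra. }
  assert (HXc : forall s, - Sb < s < Sb -> continuous X s).
  { intros s Hs. apply continuity_pt_filterlim, continuity_pt_locally. intros e.
    destruct (near_ivl (- Sb) Sb s Hs) as [r [Hr Hr']].
    assert (Hm : 0 < Rmin r (e * kl)).
    { apply Rmin_glb_lt; [exact Hr | apply Rmult_lt_0_compat; [apply cond_pos | exact Hkl]]. }
    exists (mkposreal _ Hm). intros t Ht. assert (Ht' : Rabs (t - s) < Rmin r (e * kl)) by exact Ht.
    assert (Ht1 : Rabs (t - s) < r) by (eapply Rlt_le_trans; [exact Ht' | apply Rmin_l]).
    assert (Ht2 : Rabs (t - s) < e * kl) by (eapply Rlt_le_trans; [exact Ht' | apply Rmin_r]).
    apply Rmult_lt_reg_r with kl; [exact Hkl |].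
    eapply Rle_lt_trans; [apply Hlip; auto | exact Ht2]. }
  set (X1 := fun s => / sc1 (X s)).
  assert (HXd : forall s, - Sb < s < Sb -> is_derive X s (X1 s)).
  { intros s Hs. destruct (HX s Hs) as [Hs1 Hs2].
    (* The divided difference of [sc] at [X s], with the derivative as the value at [X s] itself. It
       is continuous there, which is what [is_derive_mult_zero] needs to differentiate the
       inverse. *)
    set (phi := fun x => if Req_EM_T x (X s) then sc1 (X s) else (sc x - sc (X s)) / (x - X s)).
    assert (Hphi0 : phi (X s) = sc1 (X s)).
    { unfold phi; destruct (Req_EM_T (X s) (X s)); [reflexivity | congruence]. }
    assert (Hphic : continuous phi (X s)).
    { apply continuity_pt_filterlim, continuity_pt_locally. intros e. rewrite Hphi0.
      pose proof (sc_derive (X s)) as Hd. apply is_derive_Reals in Hd.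
      destruct (Hd e (cond_pos e)) as [d Hd']. exists d. intros x Hx.
      assert (Hx' : Rabs (x - X s) < d) by exact Hx.
      unfold phi. destruct (Req_EM_T x (X s)) as [_|Hne].
      - rewrite Rminus_diag, Rabs_R0. apply cond_pos.
      - specialize (Hd' (x - X s)). assert (Ex : @eq R (X s + (x - X s)) x) by ring. rewrite Ex in Hd'.
        apply Hd'; [lra | exact Hx']. }
    apply is_derive_ext_loc with (fun t => (t - s) * / phi (X t) + X s).
    { apply filter_imp with (fun y => - Sb < y < Sb); [| apply open_interval, Hs].
      intros t Ht. destruct (HX t Ht) as [Ht1 Ht2]. as_R.
      unfold phi. destruct (Req_EM_T (X t) (X s)) as [He|Hne].
      - replace t with s; [ring |]. rewrite <- Hs2, <- Ht2, He. reflexivity.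
      - rewrite Hs2, Ht2. assert (Hts : t - s <> 0).
        { intros H. apply Hne, Hinj. lra. }
        field. split; lra. }
    eapply is_derive_eq.
    - apply (is_derive_plus (fun t => (t - s) * / phi (X t)) (fun _ => X s)); [| apply @is_derive_const].
      apply (is_derive_mult_zero (fun t => t - s) (fun t => / phi (X t)) s 1).
      + auto_derive; [exact Logic.I | ring].
      + ring.
      + apply (continuous_comp (fun t => phi (X t)) Rinv).
        * apply (continuous_comp X phi); [apply HXc, Hs | exact Hphic].
        * apply continuous_Rinv. rewrite Hphi0. apply Rgt_not_eq, sc1_pos.
    - to_R. rewrite Hphi0. unfold X1. ring. }
  (* Since [X1 = / sc1 (X)], each order of [X] gives the same order of [X1] and hence the next of
     [X], up to the three derivatives of [sc1]. *)
  assert (HX1UC : forall n, (n <= 3)%nat -> UC (ivl (- Sb) Sb) n (fun _ => X) ->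
     UC (ivl (- Sb) Sb) n (fun _ => X1)).
  { intros n Hn H. apply UC_inv with kl; [apply open_ivl | exact Hkl | |].
    - intros i s Hs. apply Hklx. destruct (HX s Hs). lra.
    - apply (UC_comp (ivl (- Sb) Sb) (ivl (- a) a) n (fun _ => sc1) (fun _ => X)).
      + intros i s Hs. apply HX, Hs.
      + apply (UC_le _ 3); [exact Hn | apply sc1_UC, Ha].
      + exact H. }
  assert (HXUC : forall n, (n <= 4)%nat -> UC (ivl (- Sb) Sb) n (fun _ => X)).
  { induction n as [|n IH]; intros Hn.
    - split; [| split; [| exact Logic.I]].
      + exists a. intros i s Hs. destruct (HX s Hs). apply Rabs_le; lra.
      + intros i s Hs. apply HXc, Hs.
    - specialize (IH ltac:(lia)). split; [| split].
      + exists a. intros i s Hs. destruct (HX s Hs). apply Rabs_le; lra.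
      + intros i s Hs. apply HXc, Hs.
      + exists (fun _ => X1). split; [intros i s Hs; apply HXd, Hs |].
        apply HX1UC; [lia | exact IH]. }
  exists a, (/ K1), X, X1.
  split; [exact Ha |]. split; [apply Rinv_0_lt_compat, HK1 |].
  split; [apply HXUC; lia |]. split; [apply HX1UC; [lia | apply HXUC; lia] |].
  assert (Hrp : forall x, rp x = r0 + sc x ^ 2) by (intros x; rewrite sc_sq; ring).
  split; [| split].
  - intros s Hs. destruct (HX s Hs) as [Hs1 Hs2].
    split; [exact Hs1 |]. split; [rewrite Hrp, Hs2; reflexivity |]. split; [apply HXd, Hs |].
    split; [| split].
    + apply Rinv_le_contravar; [apply sc1_pos |].
      eapply Rle_trans; [apply Rle_abs | apply (BK1 tt), Hs1].
    + intros H0. destruct (Rle_dec 0 (X s)) as [H|H]; [exact H |].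
      assert (Hn : sc (X s) < sc 0) by (apply sc_incr; lra). rewrite sc_0 in Hn. lra.
    + intros H0. destruct (Rle_dec (X s) 0) as [H|H]; [exact H |].
      assert (Hn : sc 0 < sc (X s)) by (apply sc_incr; lra). rewrite sc_0 in Hn. lra.
  - intros x s Hs Hx Hx0. apply Hinj. destruct (HX s) as [_ ->]; [lra |].
    rewrite Hrp in Hx.
    assert (0 <= sc x).
    { destruct Hx0 as [H|<-]; [apply sc_incr in H; rewrite sc_0 in H; lra | rewrite sc_0; lra]. }
    nra.
  - intros x s Hs Hx Hx0. apply Hinj. destruct (HX s) as [_ ->]; [lra |].
    rewrite Hrp in Hx.
    assert (sc x <= 0).
    { destruct Hx0 as [H| ->]; [apply sc_incr in H; rewrite sc_0 in H; lra | rewrite sc_0; lra]. }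
    nra.
Qed.

End Morse.

(** * Reduction to a real system *)

Lemma RInt_gen_bounded (f : R -> R) :
  (forall x, continuous f x) -> (forall x, 0 <= f x) ->
  ex_RInt_gen f (Rbar_locally m_infty) (Rbar_locally p_infty) ->
  exists K, forall a b, a <= b -> RInt f a b <= K.
Proof.
  intros Hc Hf [l Hl].
  assert (Hex : forall a b, ex_RInt f a b).
  { intros a b; apply (ex_RInt_continuous (V := R_CompleteNormedModule)); intros; apply Hc. }
  assert (Hge : forall a b, a <= b -> 0 <= RInt f a b)
    by (intros a b Hab; apply RInt_ge_0; auto).
  destruct (Hl (ball l 1)) as [Q T HQ HT HQT]; [exists (mkposreal 1 Rlt_0_1); auto |].
  destruct HQ as [M HM]. destruct HT as [N HN].
  exists (l + 1). intros a b Hab.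
  pose (x := Rmin (M - 1) a). pose (y := Rmax (N + 1) b).
  assert (Hx : x < M) by (unfold x; pose proof (Rmin_l (M - 1) a); lra).
  assert (Hy : N < y) by (unfold y; pose proof (Rmax_l (N + 1) b); lra).
  assert (Hxa : x <= a) by apply Rmin_r. assert (Hby : b <= y) by apply Rmax_r.
  destruct (HQT x y (HM x Hx) (HN y Hy)) as [v [Hv Hvb]]; simpl in Hv.
  assert (Hvl : v < l + 1).
  { assert (H : Rabs (v - l) < 1) by exact Hvb. apply Rabs_def2 in H; lra. }
  assert (Hvv : RInt f x y = v) by (apply (is_RInt_unique (V := R_CompleteNormedModule)), Hv).
  pose proof (RInt_Chasles (V := R_CompleteNormedModule) f x a y (Hex _ _) (Hex _ _)) as C1.
  pose proof (RInt_Chasles (V := R_CompleteNormedModule) f a b y (Hex _ _) (Hex _ _)) as C2.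
  unfold plus in C1, C2; simpl in C1, C2.
  pose proof (Hge x a Hxa). pose proof (Hge b y Hby). lra.
Qed.

Notation C2_R := (prod_NormedModule R_AbsRing C_R_NormedModule C_R_NormedModule).

Lemma is_derive_linear (w : R -> C * C) x (dw : C2_R) (phi : C2_R -> R) :
  @is_linear R_AbsRing C2_R R_NormedModule phi ->
  @is_derive R_AbsRing C2_R w x dw ->
  is_derive (fun x => phi (w x)) x (phi dw).
Proof.
  intros Hphi Hw.
  refine (filterdiff_ext_lin _ (fun y => phi (@scal R_AbsRing C2_R y dw)) _ _ _).
  - apply (@filterdiff_comp' R_AbsRing R_NormedModule C2_R R_NormedModule w phi x
      (fun y => @scal R_AbsRing C2_R y dw) phi Hw).
    apply filterdiff_linear, Hphi.
  - intros y. apply (@linear_scal R_AbsRing C2_R R_NormedModule phi Hphi).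
Qed.

(* For a solution [w = (w1, w2)] of the Zakharov-Shabat system, both
   [(Re w2 - Im w1, Re w1 - Im w2)] and [(Re w1 + Im w2, Im w1 + Re w2)] solve this
   real system. *)
Definition real_system (eps lambda : R) (rp rm y u : R -> R) : Prop :=
  (forall x, is_derive y x ((lambda - rm x) * u x / eps)) /\
  (forall x, is_derive u x (- (lambda - rp x) * y x / eps)).

Lemma real_reduction eps lambda rp rm : 0 < eps ->
  is_eigenvalue eps (zakharov_shabat rp rm) lambda ->
  exists y u K, real_system eps lambda rp rm y u /\
    (forall a b, a <= b -> RInt (fun x => y x ^ 2 + u x ^ 2) a b <= K) /\
    exists x, ~ (y x = 0 /\ u x = 0).
Proof.
  intros He [w [Hw [Hint [x0 Hx0]]]].
  set (a1 := fun x => fst (fst (w x))). set (a2 := fun x => snd (fst (w x))).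
  set (b1 := fun x => fst (snd (w x))). set (b2 := fun x => snd (snd (w x))).
  set (mu := fun x => lambda + / 2 * dphase rp rm x). set (A := amplitude rp rm).
  assert (L1 : @is_linear R_AbsRing C2_R C_R_NormedModule fst) by apply is_linear_fst.
  assert (L2 : @is_linear R_AbsRing C2_R C_R_NormedModule snd) by apply is_linear_snd.
  assert (L3 : @is_linear R_AbsRing C_R_NormedModule R_NormedModule fst)
    by apply (@is_linear_fst R_AbsRing R_NormedModule R_NormedModule).
  assert (L4 : @is_linear R_AbsRing C_R_NormedModule R_NormedModule snd)
    by apply (@is_linear_snd R_AbsRing R_NormedModule R_NormedModule).
  assert (Hd : forall x, is_derive a1 x ((mu x * a2 x + A x * b1 x) / eps) /\
     is_derive a2 x ((- mu x * a1 x + A x * b2 x) / eps) /\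
     is_derive b1 x ((A x * a1 x - mu x * b2 x) / eps) /\
     is_derive b2 x ((A x * a2 x + mu x * b1 x) / eps)).
  { intros x. destruct (Hw x) as [dw [Hdw Heq]].
    pose proof (is_derive_linear w x dw (fun v => fst (fst v))
      (@is_linear_comp R_AbsRing C2_R C_R_NormedModule R_NormedModule fst fst L1 L3) Hdw) as D1.
    pose proof (is_derive_linear w x dw (fun v => snd (fst v))
      (@is_linear_comp R_AbsRing C2_R C_R_NormedModule R_NormedModule fst snd L1 L4) Hdw) as D2.
    pose proof (is_derive_linear w x dw (fun v => fst (snd v))
      (@is_linear_comp R_AbsRing C2_R C_R_NormedModule R_NormedModule snd fst L2 L3) Hdw) as D3.
    pose proof (is_derive_linear w x dw (fun v => snd (snd v))
      (@is_linear_comp R_AbsRing C2_R C_R_NormedModule R_NormedModule snd snd L2 L4) Hdw) as D4.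
    revert D1 D2 D3 D4 Heq. unfold a1, a2, b1, b2.
    destruct dw as [[d1 d2] [d3 d4]]. destruct (w x) as [[v1 v2] [v3 v4]].
    simpl.
    intros D1 D2 D3 D4 Heq. injection Heq as F1 F2 F3 F4.
    change (amplitude rp rm x) with (A x) in *.
    change (lambda + / 2 * dphase rp rm x) with (mu x) in *.
    split; [| split; [| split]]; eapply is_derive_eq; try eassumption;
      apply Rmult_eq_reg_l with eps; try lra; field_simplify; lra. }
  assert (Hnorm : forall x, sqnorm2 (w x) = a1 x ^ 2 + a2 x ^ 2 + (b1 x ^ 2 + b2 x ^ 2)).
  { intros x. unfold sqnorm2, Cmod.
    rewrite !pow2_sqrt; [reflexivity | |]; apply Rplus_le_le_0_compat; apply pow2_ge_0. }
  assert (Hcont : forall x, continuous a1 x /\ continuous a2 x /\ continuous b1 x /\ continuous b2 x).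
  { intros x. destruct (Hd x) as [D1 [D2 [D3 D4]]].
    repeat split; eapply is_derive_cont; eassumption. }
  assert (Hsq : forall (f : R -> R) x, continuous f x -> continuous (fun x => f x ^ 2) x).
  { intros f x Hf. apply (continuous_mult f (fun x => f x * 1)); [exact Hf |].
    apply (continuous_mult f (fun _ => 1)); [exact Hf | apply continuous_const]. }
  assert (Hnc : forall x, continuous (fun x => sqnorm2 (w x)) x).
  { intros x. apply continuous_ext with (fun x => (a1 x ^ 2 + a2 x ^ 2) + (b1 x ^ 2 + b2 x ^ 2));
      [intros; symmetry; apply Hnorm |].
    destruct (Hcont x) as [C1 [C2 [C3 C4]]].
    apply (continuous_plus (fun x => a1 x ^ 2 + a2 x ^ 2) (fun x => b1 x ^ 2 + b2 x ^ 2)).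
    - apply (continuous_plus (fun x => a1 x ^ 2) (fun x => a2 x ^ 2)); apply Hsq; assumption.
    - apply (continuous_plus (fun x => b1 x ^ 2) (fun x => b2 x ^ 2)); apply Hsq; assumption. }
  destruct (RInt_gen_bounded (fun x => sqnorm2 (w x)) Hnc) as [K HK].
  { intros x. rewrite Hnorm.
    pose proof (pow2_ge_0 (a1 x)); pose proof (pow2_ge_0 (a2 x));
    pose proof (pow2_ge_0 (b1 x)); pose proof (pow2_ge_0 (b2 x)); lra. }
  { exact Hint. }
  assert (Hmu : forall x, mu x + A x = lambda - rm x /\ mu x - A x = lambda - rp x).
  { intros x. unfold mu, A, dphase, amplitude. split; field. }
  assert (Hbound : forall y u : R -> R, (forall x, continuous y x) -> (forall x, continuous u x) ->
     (forall x, y x ^ 2 + u x ^ 2 <= 2 * sqnorm2 (w x)) ->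
     forall a b, a <= b -> RInt (fun x => y x ^ 2 + u x ^ 2) a b <= 2 * K).
  { intros y u Hy Hu Hyu a b Hab.
    apply Rle_trans with (RInt (fun x => 2 * sqnorm2 (w x)) a b).
    - apply RInt_le; [exact Hab | | | intros; apply Hyu].
      + apply ex_RInt_cont; [exact Hab |]; intros x _.
        apply (continuous_plus (fun x => y x ^ 2) (fun x => u x ^ 2)); apply Hsq; auto.
      + apply ex_RInt_cont; [exact Hab |]; intros x _.
        apply (continuous_scal_r 2 (fun x => sqnorm2 (w x))), Hnc.
    - rewrite RInt_scal_R; [apply Rmult_le_compat_l; [lra | apply HK, Hab] |].
      apply ex_RInt_cont; [exact Hab | intros; apply Hnc]. }
  (* The four combinations determine [w x0], so at least one of the two real solutions is
     nontrivial. *)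
  assert (Hchoice : ~ (b1 x0 - a2 x0 = 0 /\ a1 x0 - b2 x0 = 0) \/
                    ~ (a1 x0 + b2 x0 = 0 /\ a2 x0 + b1 x0 = 0)).
  { destruct (Req_dec (b1 x0 - a2 x0) 0) as [E1|E1]; [| left; tauto].
    destruct (Req_dec (a1 x0 - b2 x0) 0) as [E2|E2]; [| left; tauto].
    right. intros [E3 E4]. apply Hx0.
    unfold a1, a2, b1, b2 in *. destruct (w x0) as [[v1 v2] [v3 v4]]. simpl in *.
    unfold RtoC. repeat f_equal; lra. }
  destruct Hchoice as [Hne|Hne].
  - exists (fun x => b1 x - a2 x), (fun x => a1 x - b2 x), (2 * K).
    split; [split; intros x; destruct (Hd x) as [D1 [D2 [D3 D4]]]; destruct (Hmu x) as [M1 M2] | split].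
    + eapply is_derive_eq; [apply (is_derive_minus b1 a2); eassumption |].
      to_R. rewrite <- M1. field. lra.
    + eapply is_derive_eq; [apply (is_derive_minus a1 b2); eassumption |].
      to_R. rewrite <- M2. field. lra.
    + apply Hbound.
      * intros x; destruct (Hcont x) as [C1 [C2 [C3 C4]]]; apply (continuous_minus b1 a2); assumption.
      * intros x; destruct (Hcont x) as [C1 [C2 [C3 C4]]]; apply (continuous_minus a1 b2); assumption.
      * intros x. rewrite Hnorm.
        pose proof (pow2_ge_0 (b1 x + a2 x)); pose proof (pow2_ge_0 (a1 x + b2 x)). lra.
    + exists x0. exact Hne.
  - exists (fun x => a1 x + b2 x), (fun x => a2 x + b1 x), (2 * K).
    split; [split; intros x; destruct (Hd x) as [D1 [D2 [D3 D4]]]; destruct (Hmu x) as [M1 M2] | split].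
    + eapply is_derive_eq; [apply (is_derive_plus a1 b2); eassumption |].
      to_R. rewrite <- M1. field. lra.
    + eapply is_derive_eq; [apply (is_derive_plus a2 b1); eassumption |].
      to_R. rewrite <- M2. field. lra.
    + apply Hbound.
      * intros x; destruct (Hcont x) as [C1 [C2 [C3 C4]]]; apply (continuous_plus a1 b2); assumption.
      * intros x; destruct (Hcont x) as [C1 [C2 [C3 C4]]]; apply (continuous_plus a2 b1); assumption.
      * intros x. rewrite Hnorm.
        pose proof (pow2_ge_0 (b1 x - a2 x)); pose proof (pow2_ge_0 (a1 x - b2 x)). lra.
    + exists x0. exact Hne.
Qed.

(** To the right of [x0] the product [y u] has a nonnegative derivative. Were it positive at [x0],
    [y^2 + u^2 >= 2 y u] would stay above a positive constant, against the bound on its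
    integrals. *)
Lemma L2_sign eps K (y u P Q : R -> R) x0 : 0 < eps ->
  (forall x, is_derive y x (P x * u x / eps)) ->
  (forall x, is_derive u x (- Q x * y x / eps)) ->
  (forall x, x0 <= x -> 0 <= P x) -> (forall x, x0 <= x -> Q x <= 0) ->
  (forall a b, a <= b -> RInt (fun x => y x ^ 2 + u x ^ 2) a b <= K) ->
  y x0 * u x0 <= 0.
Proof.
  intros He Hy Hu HP HQ HK.
  destruct (Rle_dec (y x0 * u x0) 0) as [H|H]; [exact H | exfalso].
  set (c := y x0 * u x0) in *.
  assert (Hie : 0 < / eps) by (apply Rinv_0_lt_compat, He).
  assert (Hm : forall x, x0 <= x -> c <= y x * u x).
  { intros x Hx. apply (is_derive_le_compat (fun x => y x * u x)
      (fun x => (P x * u x ^ 2 + - Q x * y x ^ 2) / eps)); [exact Hx | |].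
    - intros t _. eapply is_derive_eq; [apply is_derive_prod; [apply Hy | apply Hu] |].
      as_R. field. lra.
    - intros t Ht. specialize (HP t ltac:(lra)). specialize (HQ t ltac:(lra)).
      apply Rmult_le_pos; [| lra].
      apply Rplus_le_le_0_compat; apply Rmult_le_pos; try apply pow2_ge_0; lra. }
  (* The length over which the constant [2 c] integrates to [Rabs K + 1], more than [K]. *)
  pose (T := (Rabs K + 1) / (2 * c)).
  assert (HT : 0 < T).
  { apply Rmult_lt_0_compat; [pose proof (Rabs_pos K); lra | apply Rinv_0_lt_compat; lra]. }
  assert (Hlow : RInt (fun _ => 2 * c) x0 (x0 + T) <= RInt (fun x => y x ^ 2 + u x ^ 2) x0 (x0 + T)).
  { apply RInt_le; [lra | apply ex_RInt_const | |].
    - apply ex_RInt_cont; [lra |]; intros x _.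
      apply @ex_derive_continuous. eexists. apply @is_derive_plus; apply is_derive_square; [apply Hy | apply Hu].
    - intros x Hx. specialize (Hm x ltac:(lra)). pose proof (pow2_ge_0 (y x - u x)). lra. }
  assert (E : RInt (fun _ => 2 * c) x0 (x0 + T) = Rabs K + 1).
  { rewrite RInt_const. to_R. unfold T. field; lra. }
  specialize (HK x0 (x0 + T) ltac:(lra)). pose proof (Rle_abs K). lra.
Qed.

Lemma L2_sign_left eps K (y u P Q : R -> R) x0 : 0 < eps ->
  (forall x, is_derive y x (P x * u x / eps)) ->
  (forall x, is_derive u x (- Q x * y x / eps)) ->
  (forall x, x <= x0 -> 0 <= P x) -> (forall x, x <= x0 -> Q x <= 0) ->
  (forall a b, a <= b -> RInt (fun x => y x ^ 2 + u x ^ 2) a b <= K) ->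
  0 <= y x0 * u x0.
Proof.
  intros He Hy Hu HP HQ HK.
  assert (H : y (- - x0) * - u (- - x0) <= 0).
  { apply (L2_sign eps K (fun x => y (- x)) (fun x => - u (- x)) (fun x => P (- x)) (fun x => Q (- x)));
      [exact He | | | | |].
    - intros x. eapply is_derive_eq; [apply is_derive_refl, Hy | as_R; field; lra].
    - intros x. eapply is_derive_eq.
      + apply (is_derive_opp (fun x => u (- x))), is_derive_refl, Hu.
      + to_R. field; lra.
    - intros x Hx; apply HP; lra.
    - intros x Hx; apply HQ; lra.
    - intros a b Hab. apply Rle_trans with (RInt (fun x => y x ^ 2 + u x ^ 2) (- b) (- a));
        [| apply HK; lra]. apply Req_le.
      set (f := fun x => y x ^ 2 + u x ^ 2). set (h := fun x => y (- x) ^ 2 + (- u (- x)) ^ 2).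
      assert (Hcf : forall x, continuous f x).
      { intros x. apply @ex_derive_continuous. eexists.
        apply @is_derive_plus; apply is_derive_square; [apply Hy | apply Hu]. }
      assert (Hfh : forall x, f (-1 * x + 0) = h x).
      { intros x. unfold f, h. replace (-1 * x + 0) with (- x) by ring. ring. }
      assert (Hexf : forall p q, ex_RInt f p q).
      { intros p q; apply (ex_RInt_continuous (V := R_CompleteNormedModule)); intros; apply Hcf. }
      assert (Hexh : ex_RInt h b a).
      { apply (ex_RInt_continuous (V := R_CompleteNormedModule)). intros x _.
        apply continuous_ext with (fun x => f (-1 * x + 0)); [exact Hfh |].
        apply (continuous_comp (fun x => -1 * x + 0) f); [| apply Hcf].
        apply @ex_derive_continuous; auto_derive; exact Logic.I. }
      transitivity (-1 * RInt h b a).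
      + rewrite <- (opp_RInt_swap h b a Hexh). to_R. ring.
      + rewrite <- RInt_scal_R by exact Hexh.
        transitivity (RInt (fun x => scal (-1) (f (-1 * x + 0))) b a).
        * apply RInt_ext; intros x _. rewrite Hfh. reflexivity.
        * etransitivity;
            [apply (RInt_comp_lin (V := R_CompleteNormedModule) f (-1) 0 b a (Hexf _ _)) |].
          f_equal; ring. }
  rewrite Ropp_involutive in H. lra.
Qed.

(** Gronwall's argument for [y^2 + u^2] in both directions. Its derivative contains only [P - Q],
    which will be [rp - rm]; the bound 2 gives the rate [2 / eps]. *)
Lemma trivial_solution eps (y u P Q : R -> R) x0 : 0 < eps ->
  (forall x, is_derive y x (P x * u x / eps)) ->
  (forall x, is_derive u x (- Q x * y x / eps)) ->
  (forall x, Rabs (P x - Q x) <= 2) -> y x0 = 0 -> u x0 = 0 ->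
  forall x, y x = 0 /\ u x = 0.
Proof.
  intros He Hy Hu HPQ Hy0 Hu0 x.
  assert (Hie : 0 < / eps) by (apply Rinv_0_lt_compat, He).
  set (N := fun x => y x ^ 2 + u x ^ 2). set (B := 2 / eps).
  assert (HN : forall x, is_derive N x (2 * (P x - Q x) * (y x * u x) / eps)).
  { intros t. eapply is_derive_eq.
    - apply (is_derive_plus (fun x => y x ^ 2) (fun x => u x ^ 2)); apply is_derive_square;
        [apply Hy | apply Hu].
    - to_R. field; lra. }
  assert (HNb : forall x, Rabs (2 * (P x - Q x) * (y x * u x) / eps) <= B * N x).
  { intros t. unfold B, Rdiv. replace (2 * (P t - Q t) * (y t * u t) * / eps)
      with ((P t - Q t) * (2 * (y t * u t)) * / eps) by ring.
    rewrite !(Rabs_mult _ (/ eps)), (Rabs_right (/ eps)) by lra.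
    rewrite Rabs_mult. replace (2 * / eps * N t) with (2 * N t * / eps) by ring.
    apply Rmult_le_compat_r; [lra |]. apply Rmult_le_compat; try apply Rabs_pos; [apply HPQ |].
    unfold N. pose proof (pow2_ge_0 (y t + u t)); pose proof (pow2_ge_0 (y t - u t)).
    apply Rabs_le; split; lra. }
  assert (HN0 : N x0 = 0) by (unfold N; rewrite Hy0, Hu0; ring).
  assert (HE : forall k t, is_derive (fun x => N x * exp (k * x)) t
     ((2 * (P t - Q t) * (y t * u t) / eps + k * N t) * exp (k * t))).
  { intros k t. eapply is_derive_eq.
    - apply is_derive_prod; [apply HN |].
      apply (is_derive_comp exp (fun x => k * x) t (exp (k * t)) k); [apply is_derive_exp |].
      auto_derive; [exact Logic.I | ring].
    - to_R. ring. }
  assert (HNx : N x <= 0).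
  { destruct (Rle_dec x0 x) as [Hx|Hx].
    - assert (H : - (N x0 * exp (- B * x0)) <= - (N x * exp (- B * x))).
      { apply (is_derive_le_compat (fun x => - (N x * exp (- B * x)))
          (fun t => - ((2 * (P t - Q t) * (y t * u t) / eps + - B * N t) * exp (- B * t)))); [exact Hx | |].
        - intros t _. apply (is_derive_opp (fun x => N x * exp (- B * x))), HE.
        - intros t _. specialize (HNb t). apply Rabs_le_between in HNb.
          pose proof (exp_pos (- B * t)). nra. }
      pose proof (exp_pos (- B * x)). nra.
    - assert (H : N x * exp (B * x) <= N x0 * exp (B * x0)).
      { apply (is_derive_le_compat (fun x => N x * exp (B * x))
          (fun t => (2 * (P t - Q t) * (y t * u t) / eps + B * N t) * exp (B * t))); [lra | |].
        - intros t _. apply HE.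
        - intros t _. specialize (HNb t). apply Rabs_le_between in HNb.
          pose proof (exp_pos (B * t)). apply Rmult_le_pos; lra. }
      pose proof (exp_pos (B * x)). nra. }
  unfold N in HNx. pose proof (pow2_ge_0 (y x)) as Q1; pose proof (pow2_ge_0 (u x)) as Q2.
  split; [assert (E : y x * y x = 0) by lra | assert (E : u x * u x = 0) by lra];
    apply Rmult_integral in E; tauto.
Qed.

Lemma Rabs_sin_le x : Rabs (sin x) <= Rabs x.
Proof.
  assert (H : forall x, 0 <= x -> - x <= sin x <= x).
  { intros t Ht. split.
    - assert (E : 0 + sin 0 <= t + sin t); [| rewrite sin_0 in E; lra].
      apply (is_derive_le_compat (fun x => x + sin x) (fun x => 1 + cos x)); [exact Ht | |].
      + intros c _; auto_derive; [exact Logic.I | ring].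
      + intros c _; pose proof (COS_bound c); lra.
    - assert (E : 0 - sin 0 <= t - sin t); [| rewrite sin_0 in E; lra].
      apply (is_derive_le_compat (fun x => x - sin x) (fun x => 1 - cos x)); [exact Ht | |].
      + intros c _; auto_derive; [exact Logic.I | ring].
      + intros c _; pose proof (COS_bound c); lra. }
  destruct (Rle_dec 0 x) as [Hx|Hx].
  - rewrite (Rabs_right x) by lra. apply Rabs_le, H, Hx.
  - rewrite (Rabs_left x) by lra. rewrite <- Rabs_Ropp, <- sin_neg. apply Rabs_le, H; lra.
Qed.

(** The cosine vanishes at the odd multiples of [PI / 2], and shifting by multiples of [PI] reduces
    it to a sine near 0. *)
Lemma cos_near_odd L (j : nat) :
  Rabs (cos (PI / 2 * L)) <= PI / 2 * Rabs (L - (2 * INR j + 1)).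
Proof.
  assert (Hshift : forall (n : nat) x, Rabs (cos (x + INR n * PI)) = Rabs (cos x)).
  { induction n as [|n IH]; intros x.
    - rewrite Rmult_0_l, Rplus_0_r. reflexivity.
    - rewrite S_INR. replace (x + (INR n + 1) * PI) with ((x + INR n * PI) + PI) by ring.
      rewrite neg_cos, Rabs_Ropp. apply IH. }
  pose proof PI_RGT_0 as HPI.
  set (d := PI / 2 * (L - (2 * INR j + 1))).
  replace (PI / 2 * L) with ((PI / 2 + d) + INR j * PI) by (unfold d; field).
  rewrite Hshift.
  assert (E : cos (PI / 2 + d) = - sin d).
  { rewrite cos_plus, cos_PI2, sin_PI2. ring. }
  rewrite E, Rabs_Ropp. eapply Rle_trans; [apply Rabs_sin_le |].
  unfold d. rewrite Rabs_mult, (Rabs_right (PI / 2)) by lra. lra.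
Qed.

(** * The quantization rule *)

Theorem theorem2 (rp rm : R -> R) (max_rm min_rp : R)
  (rp_C5 : Ck 5 rp) (rm_C5 : Ck 5 rm)
  (max_rmP : is_max_value rm max_rm) (min_rpP : is_min_value rp min_rp)
  (rm_ge : forall x : R, -1 <= rm x)
  (gap : max_rm < min_rp)
  (rp_le : forall x : R, rp x <= 1)
  (rp_lim_pinfty : is_lim rp p_infty 1) (rp_lim_minfty : is_lim rp m_infty 1)
  (rm_lim_pinfty : is_lim rm p_infty (-1))
  (rm_lim_minfty : is_lim rm m_infty (-1))
  (drp_O : bigO_infty (Derive rp) (fun x => / Rabs x))
  (d2rp_O : bigO_infty (Derive_n rp 2) (fun x => / (Rabs x ^ 2)))
  (drp_0 : Derive rp 0 = 0)
  (d2rp_0 : 0 < Derive_n rp 2 0)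
  (drp_pos : forall x : R, 0 < x -> 0 < Derive rp x)
  (drp_neg : forall x : R, x < 0 -> Derive rp x < 0)
  (lambda_max : R) (lambda_maxP : min_rp < lambda_max < 1) :
  exists K eps0 : R, 0 < K /\ 0 < eps0 /\
    forall eps lambda : R, 0 < eps < eps0 ->
      min_rp < lambda <= lambda_max ->
      is_eigenvalue eps (zakharov_shabat rp rm) lambda ->
      forall xm xp : R, xm < 0 < xp -> rp xm = lambda -> rp xp = lambda ->
        Rabs (cos (/ eps *
          RInt (fun x => sqrt ((lambda - rp x) * (lambda - rm x))) xm xp))
        <= K * eps.
Proof.
  assert (Hr0 : rp 0 = min_rp).
  { destruct min_rpP as [[x Hx] Hmin].
    assert (H1 : rp 0 <= min_rp); [| specialize (Hmin 0); lra].
    destruct (Req_dec x 0) as [->|Hx0]; [lra |].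
    pose proof (rp_gt rp (rp 0) rp_C5 eq_refl drp_pos drp_neg x Hx0). lra. }
  assert (Hincr : forall x y, 0 <= x -> x < y -> rp x < rp y)
    by exact (rp_incr rp rp_C5 drp_pos).
  assert (Hdecr : forall x y, y <= 0 -> x < y -> rp y < rp x)
    by exact (rp_decr rp rp_C5 drp_neg).
  (* [min_rp + S^2] is halfway between [lambda_max] and the limit 1 of [rp], while [km] belongs to
     [lambda_max]: this leaves room between [km] and [S] for the forbidden regions. *)
  set (S := sqrt ((lambda_max + 1) / 2 - min_rp)).
  set (km := sqrt (lambda_max - min_rp)).
  assert (HSS : S ^ 2 = (lambda_max + 1) / 2 - min_rp) by (apply pow2_sqrt; lra).
  assert (Hkm : 0 < km) by (apply sqrt_lt_R0; lra).
  assert (HkS : km < S) by (apply sqrt_lt_1_alt; lra).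
  destruct (morse_coordinate rp min_rp rp_C5 Hr0 drp_0 d2rp_0 drp_pos drp_neg S)
    as [a [x0 [X [X1 [Ha [Hx0 [UX [UX1 [HX [HXp HXn]]]]]]]]]]; [lra | |].
  { assert (He : 0 < 1 - (min_rp + S ^ 2)) by lra.
    destruct (proj2 (is_lim_spec rp p_infty 1) rp_lim_pinfty (mkposreal _ He)) as [N1 HN1].
    destruct (proj2 (is_lim_spec rp m_infty 1) rp_lim_minfty (mkposreal _ He)) as [N2 HN2].
    exists (Rmax 1 (Rmax (N1 + 1) (- N2 + 1))).
    assert (M1 : 1 <= Rmax 1 (Rmax (N1 + 1) (- N2 + 1))) by apply Rmax_l.
    assert (M2 : N1 + 1 <= Rmax 1 (Rmax (N1 + 1) (- N2 + 1)))
      by (eapply Rle_trans; [apply Rmax_l | apply Rmax_r]).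
    assert (M3 : - N2 + 1 <= Rmax 1 (Rmax (N1 + 1) (- N2 + 1)))
      by (eapply Rle_trans; [apply Rmax_r | apply Rmax_r]).
    set (A := Rmax 1 (Rmax (N1 + 1) (- N2 + 1))) in *.
    split; [lra | split].
    - assert (H : Rabs (rp A - 1) < 1 - (min_rp + S ^ 2)) by (apply HN1; lra).
      apply Rabs_def2 in H; simpl in H; simpl; lra.
    - assert (H : Rabs (rp (- A) - 1) < 1 - (min_rp + S ^ 2)) by (apply HN2; lra).
      apply Rabs_def2 in H; simpl in H; simpl; lra. }
  set (D := kdom km S).
  assert (toD : forall n (F : R -> R), UC (ivl (- S) S) n (fun _ => F) -> UC D n (fun _ => F)).
  { intros n F HF. apply (UC_sub (fun (kap : R) => ivl (- S) S tt)).
    - intros kap s [_ Hs]; exact Hs.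
    - apply (UC_reindex (fun _ : R => tt) (ivl (- S) S) n (fun _ => F) HF). }
  set (del := min_rp - max_rm). assert (Hdel : 0 < del) by (unfold del; lra).
  assert (Hrm : forall x, del <= min_rp - rm x).
  { intros x. pose proof (proj2 max_rmP x). unfold del. lra. }
  assert (UP : UC D 3 (fun kap s => kap * kap + (min_rp - rm (X s)))).
  { apply (UC_plus D 3 (fun kap _ => kap * kap)).
    - apply (UC_mult D 3 (fun kap _ => kap)); apply kap_UC.
    - apply (UC_minus D 3 (fun _ _ => min_rp)); [apply open_kdom | apply UC_cst |].
      apply (toD 3%nat (fun s => rm (X s))).
      apply (UC_comp (ivl (- S) S) (ivl (- a) a) 3 (fun _ => rm) (fun _ => X)).
      + intros i s Hs. apply HX, Hs.
      + apply (UC_le _ 5); [lia | apply Ck_UC, rm_C5].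
      + apply (UC_le _ 4); [lia | exact UX]. }
  set (Pf := fun kap s => kap * kap + (min_rp - rm (X s))) in *.
  assert (HPf : forall kap s, del <= Pf kap s).
  { intros kap s. unfold Pf. specialize (Hrm (X s)). pose proof (Rle_0_sqr kap) as H.
    unfold Rsqr in H. lra. }
  (* In the coordinate [s], with [lambda = min_rp + kap^2], the coefficient [lambda - rm] becomes
     [Pf] and [lambda - rp] becomes [kap^2 - s^2]; each is multiplied by the Jacobian [X1]. The
     density [m] of the phase integral satisfies [m^2 = p Xp]. *)
  set (p := fun kap s => Pf kap s * X1 s).
  set (Xp := fun (_ : R) s => X1 s).
  set (m := fun kap s => sqrt (Pf kap s) * X1 s).
  assert (Up : UC D 3 p) by (apply (UC_mult D 3 Pf (fun _ => X1)); [exact UP | apply toD, UX1]).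
  assert (Um : UC D 3 m).
  { apply (UC_mult D 3 (fun kap s => sqrt (Pf kap s)) (fun _ => X1)); [| apply toD, UX1].
    apply UC_sqrt with del; [apply open_kdom | exact Hdel | intros; apply HPf | exact UP]. }
  assert (Hsdel : 0 < sqrt del) by (apply sqrt_lt_R0, Hdel).
  assert (HX1 : forall kap s, D kap s -> x0 <= X1 s) by (intros kap s [_ Hs]; apply HX, Hs).
  assert (Hm0 : 0 < sqrt del * x0) by (apply Rmult_lt_0_compat; assumption).
  destruct (langer_variable km S (sqrt del * x0) m HkS Hm0 Um) as
    [c [z [z1 [K [z0 [Hz0 [Uz [Uz1 [Hc Hz]]]]]]]]].
  { intros kap s Hs. apply Rmult_le_compat; try lra; [| apply (HX1 kap s Hs)].
    apply sqrt_le_1_alt, HPf. }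
  (* Six equal steps give the five points that [quantization_mismatch] needs between [km] and
     [S]. *)
  set (h := (S - km) / 6).
  assert (Hk0 : 0 < Rmin (del * x0) x0)
    by (apply Rmin_glb_lt; [apply Rmult_lt_0_compat |]; assumption).
  destruct (quantization_mismatch km (km + h) (km + 2 * h) (km + 3 * h) (km + 4 * h) (km + 5 * h)
    S (sqrt del * x0) K z0 (Rmin (del * x0) x0)) with (c := c) (z := z) (z1 := z1) (p := p) (Xp := Xp)
    as [M [e0 [HM [He0 Hmis]]]]; try assumption; try (unfold h; lra).
  { apply (UC_le _ 3); [lia | exact Up]. }
  { intros kap Hk. apply Hc, Hk. }
  { intros kap s Hs. destruct (Hz kap s Hs) as [Z1 [Z2 Z3]].
    split; [exact Z1 | split; [exact Z2 |]]. rewrite Z3. unfold m, p, Xp.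
    f_equal. rewrite Rpow_mult_distr, pow2_sqrt; [ring |].
    specialize (HPf kap s). lra. }
  { intros kap s Hs. specialize (HX1 kap s Hs). split.
    - eapply Rle_trans; [apply Rmin_l |]. apply Rmult_le_compat; try lra. apply HPf.
    - eapply Rle_trans; [apply Rmin_r | exact HX1]. }
  exists (PI / 2 * M), e0.
  pose proof PI_RGT_0 as HPI.
  split; [apply Rmult_lt_0_compat; lra |]. split; [exact He0 |].
  intros eps lambda Heps Hlam Heig xm xp Hxmp Hxm Hxp.
  set (kap := sqrt (lambda - min_rp)).
  assert (Hkap : 0 < kap) by (apply sqrt_lt_R0; lra).
  assert (Hkap2 : kap ^ 2 = lambda - min_rp) by (apply pow2_sqrt; lra).
  assert (Hkm' : 0 < kap <= km) by (split; [exact Hkap | apply sqrt_le_1_alt; lra]).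
  assert (Hphase : RInt (fun x => sqrt ((lambda - rp x) * (lambda - rm x))) xm xp
    = c kap * (PI * kap ^ 2 / 2)).
  { rewrite <- (proj2 (Hc kap Hkm')).
    rewrite (HXp xp kap); [| lra | rewrite Hxp, Hkap2; ring | lra].
    rewrite (HXn xm (- kap)); [| lra | rewrite Hxm; replace ((- kap) ^ 2) with (kap ^ 2) by ring;
      rewrite Hkap2; ring | lra].
    rewrite <- (RInt_comp (fun x => sqrt ((lambda - rp x) * (lambda - rm x))) X X1).
    - apply RInt_ext; intros s Hs. rewrite Rmin_left, Rmax_right in Hs by lra. to_R.
      destruct (HX s) as [_ [Hrps _]]; [lra |]. rewrite Hrps.
      assert (E : lambda - rm (X s) = Pf kap s) by (unfold Pf; simpl in Hkap2; lra).
      rewrite E. replace (lambda - (min_rp + s ^ 2)) with (kap ^ 2 - s ^ 2) by lra.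
      rewrite sqrt_mult_alt by nra. unfold m. ring.
    - intros s _. apply continuous_sqrt_comp.
      apply (continuous_mult (fun x => lambda - rp x) (fun x => lambda - rm x)).
      + apply (continuous_minus (fun _ => lambda) rp); [apply continuous_const |].
        apply @ex_derive_continuous, (proj1 rp_C5 1%nat). lia.
      + apply (continuous_minus (fun _ => lambda) rm); [apply continuous_const |].
        apply @ex_derive_continuous, (proj1 rm_C5 1%nat). lia.
    - intros s Hs. rewrite Rmin_left, Rmax_right in Hs by lra. split.
      + apply HX; lra.
      + apply (UC_cont _ _ _ UX1 tt s). split; lra. }
  rewrite Hphase. set (L0 := c kap * kap ^ 2 / eps).
  replace (/ eps * (c kap * (PI * kap ^ 2 / 2))) with (PI / 2 * L0) by (unfold L0; field; lra).
  (* Either an odd integer lies within [M eps] and the cosine is small, or [quantization_mismatch]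
     applies. *)
  destruct (Classical_Prop.classic (exists j : nat, Rabs (L0 - (2 * INR j + 1)) < M * eps))
    as [[j Hj]|Hno].
  - eapply Rle_trans; [apply (cos_near_odd L0 j) |]. rewrite Rmult_assoc.
    apply Rmult_le_compat_l; lra.
  - exfalso.
    assert (Hfar : forall j : nat, M * eps <= Rabs (L0 - (2 * INR j + 1))).
    { intros j. destruct (Rle_dec (M * eps) (Rabs (L0 - (2 * INR j + 1)))) as [H|H]; [exact H |].
      exfalso; apply Hno; exists j; lra. }
    destruct (real_reduction eps lambda rp rm (proj1 Heps) Heig) as
      [y [u [Kn [[Hy Hu] [HK [x1 Hx1]]]]]].
    destruct (Hmis eps kap (fun s => y (X s)) (fun s => u (X s)) Heps Hkm') as [s [Hs [Hys Hus]]].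
    + intros s Hs. destruct (HX s Hs) as [_ [Hrps [HXd _]]].
      eapply is_derive_eq; [apply (is_derive_comp y X); [apply Hy | exact HXd] |].
      to_R. unfold p, Pf. replace (lambda - rm (X s)) with (kap * kap + (min_rp - rm (X s)))
        by (simpl in Hkap2; lra). field; lra.
    + intros s Hs. destruct (HX s Hs) as [_ [Hrps [HXd _]]].
      eapply is_derive_eq; [apply (is_derive_comp u X); [apply Hu | exact HXd] |].
      to_R. unfold Xp. rewrite Hrps. replace (lambda - (min_rp + s ^ 2)) with (kap ^ 2 - s ^ 2) by lra.
      field; lra.
    + intros s Hs. assert (HsS : - S < s < S) by (unfold h in Hs; lra).
      destruct (HX s HsS) as [_ [Hrps [_ [_ [Hpos _]]]]]. specialize (Hpos ltac:(lra)).
      apply (L2_sign eps Kn y u (fun x => lambda - rm x) (fun x => lambda - rp x)); try assumption.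
      * lra.
      * intros x _. specialize (Hrm x). lra.
      * intros x Hx. assert (rp (X s) <= rp x).
        { destruct Hx as [Hx| <-]; [apply Rlt_le, Hincr; assumption | lra]. }
        assert (kap ^ 2 <= s ^ 2) by (apply pow_incr; lra). lra.
    + intros s Hs. assert (HsS : - S < s < S) by (unfold h in Hs; lra).
      destruct (HX s HsS) as [_ [Hrps [_ [_ [_ Hneg]]]]]. specialize (Hneg ltac:(lra)).
      apply (L2_sign_left eps Kn y u (fun x => lambda - rm x) (fun x => lambda - rp x)); try assumption.
      * lra.
      * intros x _. specialize (Hrm x). lra.
      * intros x Hx. assert (rp (X s) <= rp x).
        { destruct Hx as [Hx| ->]; [apply Rlt_le, Hdecr; assumption | lra]. }
        assert (kap ^ 2 <= (- s) ^ 2) by (apply pow_incr; lra).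
        lra.
    + exact Hfar.
    (* The common zero at [X s] forces the real solution to vanish identically, against its
       nontriviality. *)
    + apply Hx1. apply (trivial_solution eps y u (fun x => lambda - rm x) (fun x => lambda - rp x) (X s));
        try assumption; [lra |].
      intros x.
      specialize (rm_ge x). specialize (rp_le x). specialize (Hrm x).
      pose proof (proj2 min_rpP x) as Hmin. apply Rabs_le. lra.
Qed.
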